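(* Let $n\ge3$ and $1\le\alpha<\beta\le n-1$. The cluster structure $\mathcal C_{\alpha\beta}$ on $GL_n$ defined by the initial seed $(\mathcal B_{\alpha\beta},Q^n_{\alpha\beta})$ (and likewise on $SL_n$, after removing $\varphi_{11}=\det X$) is compatible with the Poisson bracket $\{\cdot,\cdot\}_{\alpha\beta}$, i.e. every extended cluster obtained from the initial seed by a sequence of mutations is log canonical with respect to $\{\cdot,\cdot\}_{\alpha\beta}$.
   Context: **Bracket.** $e_{ij}$ are matrix units, $\langle A,B\rangle=\mathrm{Tr}(AB)$, $a\wedge b=a\otimes b-b\otimes a$, $\hat h_i=\frac1n\mathrm{diag}(\underbrace{n-i,\dots,n-i}_{i},\underbrace{-i,\dots,-i}_{n-i})$ for $1\le i\le n-1$. Put $$r_0=\sum_{i=1}^{n-1}\hat h_i\otimes\hat h_i-\sum_{i=1}^{n-2}\hat h_{i+1}\otimes\hat h_i+\varepsilon\big(\hat h_\alpha\wedge\hat h_\beta+\hat h_{\beta-1}\wedge\hat h_\alpha+\hat h_\beta\wedge\hat h_{\alpha+1}\big),$$ $\varepsilon=0$ if $\beta=\alpha+1$, $\varepsilon=1$ if $\beta>\alpha+1$, and $r_{\alpha\beta}=r_0+\sum_{i<j}e_{ji}\otimes e_{ij}+e_{\alpha+1,\alpha}\wedge e_{\beta,\beta+1}$. Define $R_+\in\mathrm{End}(\mathfrak{gl}_n)$ by $\langle R_+(\eta),\zeta\rangle=\langle r_{\alpha\beta},\eta\otimes\zeta\rangle$. For functions $f,g$ on $GL_n$ with $(\nabla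 f)_{ij}=\partial f/\partial x_{ji}$, $$\{f,g\}_{\alpha\beta}(X)=\langle R_+(\nabla f\,X),\nabla g\,X\rangle-\langle R_+(X\nabla f),X\nabla g\rangle .$$ ($\det X$ is a Casimir; the bracket restricts to $SL_n$.) **Functions.** $X=(x_{ij})$ is the $n\times n$ matrix of coordinates, $X_R^C$ the submatrix with row set $R$, column set $C$, $[a,b]=\{a,\dots,b\}$. Let $$f_{ij}=\det X_{[i,n+i-j]}^{[j,n]}\ (j\ge i),\qquad f_{ij}=\det X_{[i,n]}^{[j,n-i+j]}\ (j<i).$$ If $f=f_{ij}=\det X_{[i,k]}^{[j,\ell]}$, then $f^{\rightarrow}$ (resp. $f^{\leftarrow}$, $f^{\downarrow}$, $f^{\uparrow}$) is the determinant obtained by replacing the last column $\ell$ by column $\ell+1$ of $X$ (resp. first column $j$ by column $j-1$; last row $k$ by row $k+1$; first row $i$ by row $i-1$), within the same rows (resp. columns). For $k\in[1,\alpha]$, $m\in[1,\beta]$ set, when $\alpha\ne n/2$ and $\beta\neq n/2$, $$\theta_k=f_{n+k-\alpha,k}f_{1,\beta+1}-f_{n+k-\alpha,k}^{\rightarrow}f_{1,\beta+1}^{\leftarrow},\qquad \psi_m=f_{m,n+m-\beta}f_{\alpha+1,1}-f_{m,n+m-\beta}^{\downarrow}f_{\alpha+1,1}^{\uparrow}.$$ If $\beta=n/2$, set $\psi_m=f_{m,n+m-\beta}f_{\alpha+1,1}-f_{m,n+m-\beta}^{\downarrow}f_{\alpha+1,1}^{\uparrow}$ and $\theta_k=f_{n+k-\alpha,k}\,\psi_1-f_{n+k-\alpha,k}^{\rightarrow}\,\psi_1^{*}$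 with $\psi_1^*=\det X_{[1,\beta]}^{\{\beta\}\cup[\beta+2,n]}f_{\alpha+1,1}-\det X_{[1,\beta-1]\cup\{\beta+1\}}^{\{\beta\}\cup[\beta+2,n]}f^{\uparrow}_{\alpha+1,1}$. If $\alpha=n/2$, set $\theta_k=f_{n+k-\alpha,k}f_{1,\beta+1}-f_{n+k-\alpha,k}^{\rightarrow}f_{1,\beta+1}^{\leftarrow}$ and $\psi_m=f_{m,n+m-\beta}\,\theta_1-f^{\downarrow}_{m,n+m-\beta}\,\theta_1^*$ with $\theta_1^*=\det X_{\{\alpha\}\cup[\alpha+2,n]}^{[1,\alpha]}f_{1,\beta+1}-\det X_{\{\alpha\}\cup[\alpha+2,n]}^{[1,\alpha-1]\cup\{\alpha+1\}}f_{1,\beta+1}^{\leftarrow}$. Then $\varphi_{n+k-\alpha,k}=\theta_k$ for $k\in[1,\alpha]$, $\varphi_{m,n+m-\beta}=\psi_m$ for $m\in[1,\beta]$, $\varphi_{ij}=f_{ij}$ for all other $(i,j)$, and $\mathcal B_{\alpha\beta}=\{\varphi_{ij}:i,j\in[1,n]\}$. **Quiver $Q^n_{\alpha\beta}$.** Vertices are $(i,j)\in[1,n]^2$ ($i$ = row, $j$ = column), vertex $(i,j)$ carrying $\varphi_{ij}$. Frozen vertices: all $(i,1)$ and $(1,j)$ except $(\alpha+1,1)$ and $(1,\beta+1)$, which are mutable. Arrows: first take all arrows $(i,j)\to(i,j+1)$ ($j<n$), $(i,j)\to(i+1,j)$ ($i<n$), $(i+1,j+1)\to(i,j)$ ($i,j<n$),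 except those joining two vertices both lying in $\{(i,1)\}\cup\{(1,j)\}$; then add the arrows $(\alpha,1)\to(\alpha+1,1)$, $(1,\beta)\to(1,\beta+1)$, $(n,\alpha+1)\to(1,\beta+1)$, $(1,\beta+1)\to(n,\alpha)$, $(\beta+1,n)\to(\alpha+1,1)$, $(\alpha+1,1)\to(\beta,n)$. An arrow $p\to q$ means $b_{pq}=1=-b_{qp}$ in the extended exchange matrix $\tilde B=(b_{pq})$ (rows: mutable vertices; columns: all vertices). **Mutation and compatibility.** Mutation at a mutable $p$ replaces $x_p$ by $x_p'$ with $x_px_p'=\prod_{b_{pq}>0}x_q^{b_{pq}}+\prod_{b_{pq}<0}x_q^{-b_{pq}}$ and $\tilde B$ by the usual matrix mutation $b'_{ij}=-b_{ij}$ if $i=p$ or $j=p$, $b'_{ij}=b_{ij}+\frac12(|b_{ip}|b_{pj}+b_{ip}|b_{pj}|)$ otherwise. A set is log canonical if each pair $x,y$ in it satisfies $\{x,y\}=\omega xy$ with $\omega\in\mathbb Q$. *)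

(* Defs.v *)
From HB Require Import structures.
From mathcomp Require Import all_boot all_order all_algebra.
From mathcomp Require Import generic_quotient ring_quotient fraction boolp ring.
From mathcomp.real_closed Require Import mxtens.
From mathcomp.multinomials Require Import mpoly.

Set Implicit Arguments.
Unset Strict Implicit.
Unset Printing Implicit Defensive.

Import Order.TTheory GRing.Theory Num.Theory.
Local Open Scope ring_scope.
Local Open Scope quotient_scope.

Local Notation "x %:F" := (tofrac x).

Section Seeds.

Variables (F : fieldType) (V : finType) (mut : pred V).

(* The rows of the extended exchange matrix are the mutable vertices, its
   columns are all the vertices. *)
Record seed := Seed {
  cluster : V -> F;
  exmx : {v : V | mut v} -> V -> int
}.

Definition mutate_cluster (s : seed) (p : {v : V | mut v}) (v : V) : F :=
  if v == val p then
    (\prod_(q | 0 < exmx s p q) cluster s q ^+ `|exmx s p q|%N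
     + \prod_(q | exmx s p q < 0) cluster s q ^+ `|exmx s p q|%N)
    / cluster s (val p)
  else cluster s v.

(* The division by 2 is exact. *)
Definition mutate_exmx (s : seed) (p i : {v : V | mut v}) (j : V) : int :=
  if (i == p) || (j == val p) then - exmx s i j
  else exmx s i j
       + ((`|exmx s i (val p)| * exmx s p j
           + exmx s i (val p) * `|exmx s p j|) %/ 2)%Z.

Definition mutate (s : seed) (p : {v : V | mut v}) : seed :=
  Seed (mutate_cluster s p) (mutate_exmx s p).

Definition log_canonical (br : F -> F -> F) (x : V -> F) : Prop :=
  forall p q : V, exists w : rat, br (x p) (x q) = ratr w * (x p * x q).

Definition compatible (br : F -> F -> F) (s : seed) : Prop :=
  forall ps : seq {v : V | mut v},
    log_canonical br (cluster (foldl mutate s ps)).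

End Seeds.

(* The extension of a biderivation of an integral domain to its field of
   fractions, by the quotient rule applied to f = a / b and g = c / d. *)
Definition frac_bracket (R : idomainType) (br : R -> R -> R)
    (f g : {fraction R}) : {fraction R} :=
  let a := \n_(repr f) in let b := \d_(repr f) in
  let c := \n_(repr g) in let d := \d_(repr g) in
  (b * d * br a c - b * c * br a d - a * d * br b c + a * c * br b d)%:F
  / ((b ^+ 2 * d ^+ 2)%:F).

(* {mpoly K[n * n]} is the polynomial ring in the entries of the generic
   matrix X; its field of fractions is the field of rational functions
   on GL_n. *)
Section GenericMatrix.

Variables (K : fieldType) (n : nat).

Definition genX : 'M[{mpoly K[n * n]}]_n :=
  \matrix_(i, j) 'X_(mxvec_index i j).

Definition detX : {mpoly K[n * n]} := \det genX.

(* x_ij with i, j numbered from 1 *)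
Definition x_ (i j : nat) : {mpoly K[n * n]} :=
  match insub i.-1, insub j.-1 with
  | Some a, Some b => genX a b
  | _, _ => 0
  end.

End GenericMatrix.

Section Bracket.

Variables (K : fieldType) (n alpha beta : nat).

(* e_ij with i, j numbered from 1 *)
Definition eunit (i j : nat) : 'M[K]_n :=
  \matrix_(a, b) ((a.+1 == i) && (b.+1 == j))%:R.

Definition hhat (i : nat) : 'M[K]_n :=
  diag_mx (\row_j ((if (j < i)%N then (n - i)%:R else - i%:R) / n%:R)).

(* gl_n (x) gl_n is identified with gl_{n^2} by the Kronecker product *t. *)
Definition wedge (a b : 'M[K]_n) : 'M[K]_(n * n) := a *t b - b *t a.

Definition r_zero : 'M[K]_(n * n) :=
  \sum_(1 <= i < n) hhat i *t hhat i
  - \sum_(1 <= i < n.-1) hhat i.+1 *t hhat i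
  + (if beta == alpha.+1 then 0 else 1) *:
    (wedge (hhat alpha) (hhat beta) + wedge (hhat beta.-1) (hhat alpha)
     + wedge (hhat beta) (hhat alpha.+1)).

Definition r_mx : 'M[K]_(n * n) :=
  r_zero
  + \sum_(1 <= i < n.+1) \sum_(i.+1 <= j < n.+1) eunit j i *t eunit i j
  + wedge (eunit alpha.+1 alpha) (eunit beta beta.+1).

Local Notation R := {mpoly K[n * n]}.

Definition trform (A B : 'M[R]_n) : R := \tr (A *m B).

(* Since tr((a *t b) *m (eta *t zeta)) = tr(a eta) tr(b zeta), this is the
   pairing < r, eta (x) zeta >. *)
Definition r_pairing (eta zeta : 'M[R]_n) : R :=
  \tr (map_mx (@mpolyC (n * n) K) r_mx *m (eta *t zeta)).

Definition R_plus (eta : 'M[R]_n) : 'M[R]_n :=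
  \matrix_(i, j) r_pairing eta (delta_mx j i).

Lemma R_plusP (eta zeta : 'M[R]_n) :
  trform (R_plus eta) zeta = r_pairing eta zeta.
Proof.
pose M := map_mx (@mpolyC (n * n) K) r_mx.
pose u := @mxtens_unindex n n.
have rE z : r_pairing eta z =
    \sum_k \sum_l M k l * (eta (u l).1 (u k).1 * z (u l).2 (u k).2).
  rewrite /r_pairing /mxtrace; apply: eq_bigr => k _.
  by rewrite mxE; apply: eq_bigr => l _; rewrite [(_ *t _) _ _]mxE.
rewrite rE /trform /mxtrace.
under eq_bigr => i _.
  rewrite mxE.
  under eq_bigr => j _.
    rewrite mxE rE mulr_suml.
    under eq_bigr => k _ do rewrite mulr_suml.
    over.
  rewrite exchange_big /=.
  over.
rewrite exchange_big /=; apply: eq_bigr => k _.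
under eq_bigr => i _ do rewrite exchange_big /=.
rewrite exchange_big /=; apply: eq_bigr => l _.
rewrite (bigD1 (u k).2) //= [X in _ + X]big1 ?addr0 => [|i ik].
  rewrite (bigD1 (u l).2) //= [X in _ + X]big1 ?addr0 => [|j jl].
    by rewrite !mxE !eqxx mulr1 mulrA.
  by rewrite !mxE [_ == j]eq_sym (negPf jl) !mulr0 mul0r.
rewrite big1 // => j _.
by rewrite !mxE [_ == i]eq_sym (negPf ik) andbF !mulr0 mul0r.
Qed.

Definition grad (f : R) : 'M[R]_n :=
  \matrix_(i, j) f^`M(mxvec_index j i).

Definition poly_bracket (f g : R) : R :=
  let X := genX K n in
  trform (R_plus (grad f *m X)) (grad g *m X)
  - trform (R_plus (X *m grad f)) (X *m grad g).

Definition GL_bracket : {fraction R} -> {fraction R} -> {fraction R} :=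
  frac_bracket poly_bracket.

End Bracket.

(* Rows, columns and vertices are numbered from 1. *)
Section InitialSeed.

Variables (K : fieldType) (n alpha beta : nat).

Local Notation R := {mpoly K[n * n]}.

Definition irange (a b : nat) : seq nat := iota a (b.+1 - a).

Definition minor (rs cs : seq nat) : R :=
  \det (\matrix_(a < size rs, b < size rs) x_ K n (nth 0%N rs a) (nth 0%N cs b)).

(* f_ij = det X_[i,k]^[j,l] with k = lastrow i j and l = lastcol i j *)
Definition lastrow (i j : nat) : nat := if (i <= j)%N then (n + i - j)%N else n.
Definition lastcol (i j : nat) : nat := if (i <= j)%N then n else (n + j - i)%N.

Definition f_ (i j : nat) : R :=
  minor (irange i (lastrow i j)) (irange j (lastcol i j)).
Definition f_right (i j : nat) : R :=
  minor (irange i (lastrow i j))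
        (rcons (irange j (lastcol i j).-1) (lastcol i j).+1).
Definition f_left (i j : nat) : R :=
  minor (irange i (lastrow i j)) (j.-1 :: irange j.+1 (lastcol i j)).
Definition f_down (i j : nat) : R :=
  minor (rcons (irange i (lastrow i j).-1) (lastrow i j).+1)
        (irange j (lastcol i j)).
Definition f_up (i j : nat) : R :=
  minor (i.-1 :: irange i.+1 (lastrow i j)) (irange j (lastcol i j)).

(* theta_k when beta != n/2 and psi_m when alpha != n/2 *)
Definition theta_gen (k : nat) : R :=
  f_ (n + k - alpha) k * f_ 1 beta.+1
  - f_right (n + k - alpha) k * f_left 1 beta.+1.
Definition psi_gen (m : nat) : R :=
  f_ m (n + m - beta) * f_ alpha.+1 1
  - f_down m (n + m - beta) * f_up alpha.+1 1.

Definition psi1_star : R :=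
  minor (irange 1 beta) (beta :: irange beta.+2 n) * f_ alpha.+1 1
  - minor (rcons (irange 1 beta.-1) beta.+1) (beta :: irange beta.+2 n)
    * f_up alpha.+1 1.
Definition theta1_star : R :=
  minor (alpha :: irange alpha.+2 n) (irange 1 alpha) * f_ 1 beta.+1
  - minor (alpha :: irange alpha.+2 n) (rcons (irange 1 alpha.-1) alpha.+1)
    * f_left 1 beta.+1.

Definition theta_ (k : nat) : R :=
  if beta.*2 == n then
    f_ (n + k - alpha) k * psi_gen 1 - f_right (n + k - alpha) k * psi1_star
  else theta_gen k.
Definition psi_ (m : nat) : R :=
  if alpha.*2 == n then
    f_ m (n + m - beta) * theta_gen 1 - f_down m (n + m - beta) * theta1_star
  else psi_gen m.

Definition phi_ (p : nat * nat) : R :=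
  let: (i, j) := p in
  if (1 <= j <= alpha)%N && (i == n + j - alpha)%N then theta_ j
  else if (1 <= i <= beta)%N && (j == n + i - beta)%N then psi_ i
  else f_ i j.

Definition border (p : nat * nat) : bool := (p.1 == 1%N) || (p.2 == 1%N).

Definition mutable (p : nat * nat) : bool :=
  ~~ border p || (p \in [:: (alpha.+1, 1%N); (1%N, beta.+1)]).

Definition grid_arrow (p q : nat * nat) : bool :=
  [|| q == (p.1, p.2.+1), q == (p.1.+1, p.2) | p == (q.1.+1, q.2.+1)]
  && ~~ (border p && border q).

Definition extra_arrows : seq ((nat * nat) * (nat * nat)) :=
  [:: ((alpha, 1), (alpha.+1, 1)); ((1, beta), (1, beta.+1));
      ((n, alpha.+1), (1, beta.+1)); ((1, beta.+1), (n, alpha));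
      ((beta.+1, n), (alpha.+1, 1)); ((alpha.+1, 1), (beta, n))]%N.

Definition arrows (p q : nat * nat) : nat :=
  (grid_arrow p q + count_mem (p, q) extra_arrows)%N.

Definition b_entry (p q : nat * nat) : int := (arrows p q)%:Z - (arrows q p)%:Z.

Definition vpos (v : 'I_n * 'I_n) : nat * nat := (v.1.+1, v.2.+1).

Definition GL_mutable : pred ('I_n * 'I_n) := fun v => mutable (vpos v).

Definition GL_seed : seed {fraction R} GL_mutable :=
  Seed (fun v => (phi_ (vpos v))%:F)
       (fun p q => b_entry (vpos (val p)) (vpos q)).

End InitialSeed.

Fact genX_det0 (K : fieldType) (n : nat) : n = 0%N -> \det (genX K n) = 1.
Proof. by move=> n0; subst n; rewrite det_mx00. Qed.

Fact prod_first (F : fieldType) (d : F) (n : nat) : (0 < n)%N ->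
  \prod_(i < n) (if val i == 0%N then d else 1) = d.
Proof.
by case: n => // n _; rewrite big_ord_recl /= big1 ?mulr1.
Qed.

Section SLIdeal.

Variables (K : fieldType) (n : nat).

Local Notation R := {mpoly K[n * n]}.
Local Notation detX := (detX K n).

Definition SL_ideal : {pred R} :=
  fun p => `[< exists q : R, p = q * (detX - 1) >].

Lemma SL_idealP p :
  reflect (exists q : R, p = q * (detX - 1)) (p \in SL_ideal).
Proof. exact: asboolP. Qed.

(* SL_ideal is prime because it is the kernel of the evaluation of p at the
   generic point diag(1 / det X, 1, ..., 1) X of SL_n. *)
Definition SL_pt : 'M[{fraction R}]_n :=
  \matrix_(i, j) ((if val i == 0%N then detX%:F^-1 else 1) * (genX K n i j)%:F).

Definition SL_ev : R -> {fraction R} :=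
  mmap (@tofrac R \o @mpolyC (n * n) K) (fun k => mxvec SL_pt 0 k).

Fact genX_det_neq0 : detX != 0.
Proof.
apply/eqP => /(congr1 (meval (fun k => mxvec (1%:M : 'M[K]_n) 0 k))).
rewrite rmorph0 /Defs.detX -det_map_mx (_ : map_mx _ _ = 1%:M).
  by rewrite det1 => /eqP; rewrite oner_eq0.
by apply/matrixP => i j; rewrite !mxE /= mevalXU mxvecE !mxE.
Qed.

Fact SL_ev_genX i j : SL_ev (genX K n i j) = SL_pt i j.
Proof. by rewrite /SL_ev mxE mmapX mmap1U mxvecE. Qed.

Fact SL_ev_det : SL_ev detX = 1.
Proof.
rewrite /SL_ev /Defs.detX -det_map_mx (_ : map_mx _ _ = SL_pt); last first.
  by apply/matrixP => i j; rewrite mxE -SL_ev_genX.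
have -> : SL_pt =
    diag_mx (\row_i (if val i == 0%N then detX%:F^-1 else 1))
    *m map_mx (@tofrac R) (genX K n).
  by apply/matrixP => i j; rewrite mul_diag_mx !mxE.
rewrite det_mulmx det_diag det_map_mx -/detX.
under eq_bigr => i _ do rewrite mxE.
case: (posnP n) => [n0|n_gt0].
  rewrite big1 => [|i _].
    by rewrite mul1r /Defs.detX genX_det0 // rmorph1.
  by case: i => i Hi; exfalso; rewrite n0 in Hi.
by rewrite prod_first // mulVf // tofrac_eq0 genX_det_neq0.
Qed.

Definition SL_cong (p q : R) := exists s : R, p - q = s * (detX - 1).

(* A power of det X clears the denominators of p at the generic point, and
   what remains is congruent to p modulo det X - 1. *)
Definition SL_clears (p : R) :=
  exists N : nat, exists2 q, detX%:F ^+ N * SL_ev p = q%:F & SL_cong p q.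

Fact SL_cong_expD N : exists s : R, detX ^+ N = 1 + s * (detX - 1).
Proof.
exists (\sum_(i < N) detX ^+ i); apply/eqP.
by rewrite addrC -subr_eq subrX1 mulrC.
Qed.

Fact SL_evD p q : SL_ev (p + q) = SL_ev p + SL_ev q.
Proof. by rewrite /SL_ev rmorphD. Qed.

Fact SL_evM p q : SL_ev (p * q) = SL_ev p * SL_ev q.
Proof. by rewrite /SL_ev rmorphM. Qed.

Fact SL_clearsD p q : SL_clears p -> SL_clears q -> SL_clears (p + q).
Proof.
move=> [N [p' Ep [s Es]]] [M [q' Eq [t Et]]].
exists (N + M)%N; exists (detX ^+ M * p' + detX ^+ N * q').
  rewrite SL_evD !rmorphD !rmorphM !rmorphXn /= -Ep -Eq exprD mulrDr !mulrA.
  by rewrite [detX%:F ^+ M * _]mulrC.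
have [u ->] := SL_cong_expD M; have [v ->] := SL_cong_expD N.
exists (s + t - u * p' - v * q').
rewrite (canRL (subrK _) Es) (canRL (subrK _) Et); ring.
Qed.

Fact SL_clearsM p q : SL_clears p -> SL_clears q -> SL_clears (p * q).
Proof.
move=> [N [p' Ep [s Es]]] [M [q' Eq [t Et]]].
exists (N + M)%N; exists (p' * q').
  by rewrite SL_evM !rmorphM /= -Ep -Eq exprD mulrACA.
exists (s * q + p' * t).
rewrite (canRL (subrK _) Es) (canRL (subrK _) Et); ring.
Qed.

Fact SL_clearsC c : SL_clears c%:MP.
Proof.
exists 0%N; exists c%:MP; first by rewrite mul1r /SL_ev mmapC.
by exists 0; rewrite subrr mul0r.
Qed.

Fact SL_clearsX k : SL_clears 'X_k.
Proof.
case/mxvec_indexP: k => i j.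
have -> : 'X_(mxvec_index i j) = genX K n i j by rewrite mxE.
exists (val i == 0%N); exists (genX K n i j); last first.
  by exists 0; rewrite subrr mul0r.
rewrite SL_ev_genX mxE; case: eqP => _; last by rewrite !mul1r.
by rewrite expr1 mulrA mulfV ?mul1r // tofrac_eq0 genX_det_neq0.
Qed.

Fact SL_clears_all p : SL_clears p.
Proof.
elim/mpolyind: p => [|c m p _ _ IH].
  by rewrite -mpolyC0; exact: SL_clearsC.
apply: SL_clearsD IH; rewrite -mul_mpolyC; apply: SL_clearsM.
  exact: SL_clearsC.
rewrite mpolyXE_id; elim/big_ind: _ => [||i _].
- by rewrite -mpolyC1; exact: SL_clearsC.
- exact: SL_clearsM.
elim: (m i) => [|e IHe]; first by rewrite expr0 -mpolyC1; exact: SL_clearsC.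
by rewrite exprS; apply: SL_clearsM => //; exact: SL_clearsX.
Qed.

Fact SL_ideal_ker p : (p \in SL_ideal) = (SL_ev p == 0).
Proof.
apply/SL_idealP/eqP => [[q ->]|ep].
  rewrite SL_evM /SL_ev rmorphB rmorph1 /= -/(SL_ev detX) SL_ev_det.
  by rewrite subrr mulr0.
have [N [q Eq [s Es]]] := SL_clears_all p; exists s.
move: Eq; rewrite ep mulr0 => /esym/eqP; rewrite tofrac_eq0 => /eqP q0.
by rewrite -Es q0 subr0.
Qed.

Lemma SL_ideal_closed : idealr_closed SL_ideal.
Proof.
split=> [||a p q].
- by rewrite SL_ideal_ker /SL_ev rmorph0.
- by rewrite SL_ideal_ker /SL_ev rmorph1 oner_eq0.
rewrite !SL_ideal_ker => /eqP p0 /eqP q0.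
by rewrite SL_evD SL_evM p0 q0 mulr0 addr0.
Qed.

Lemma SL_ideal_prime : prime_idealr_closed SL_ideal.
Proof. by move=> p q; rewrite !SL_ideal_ker SL_evM mulf_eq0. Qed.

HB.instance Definition _ := isIdealr.Build R SL_ideal SL_ideal_closed.
HB.instance Definition _ :=
  isPrimeIdealrClosed.Build R SL_ideal SL_ideal_prime.

(* The coordinate ring K[SL_n] = K[x_ij] / (det X - 1) *)
Definition SL_ring := {ideal_quot SL_ideal}.

HB.instance Definition _ := GRing.ComNzRing.on SL_ring.
HB.instance Definition _ := EqQuotient.on SL_ring.

Definition SL_unit : pred SL_ring := fun x => `[< exists y, y * x = 1 >].

Definition SL_inv (x : SL_ring) : SL_ring :=
  if pselect (exists y, y * x = 1) is left e then projT1 (cid e) else x.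

Lemma SL_mulVr : {in SL_unit, left_inverse 1 SL_inv *%R}.
Proof.
move=> x /asboolP ex; rewrite /SL_inv; case: pselect => // e.
by case: (cid e).
Qed.

Lemma SL_unitPl x y : y * x = 1 -> SL_unit x.
Proof. by move=> xy; apply/asboolP; exists y. Qed.

Lemma SL_invr_out : {in [predC SL_unit], SL_inv =1 id}.
Proof.
move=> x; rewrite inE => /asboolP ex; rewrite /SL_inv.
by case: pselect.
Qed.

HB.instance Definition _ := GRing.ComNzRing_hasMulInverse.Build SL_ring
  SL_mulVr SL_unitPl SL_invr_out.

Lemma SL_idomain : GRing.integral_domain_axiom SL_ring.
Proof. by move=> x y; exact: Quotient.rquot_IdomainAxiom. Qed.

HB.instance Definition _ :=
  GRing.ComUnitRing_isIntegral.Build SL_ring SL_idomain.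

Definition SL_res (p : R) : SL_ring := \pi p.

End SLIdeal.

Section SLSeed.

Variables (K : fieldType) (n alpha beta : nat).

(* det X is a Casimir, so the choice of representatives does not matter. *)
Definition SL_ring_bracket (a b : SL_ring K n) : SL_ring K n :=
  SL_res (poly_bracket alpha beta (repr a) (repr b)).

Definition SL_bracket :
    {fraction SL_ring K n} -> {fraction SL_ring K n} ->
    {fraction SL_ring K n} :=
  frac_bracket SL_ring_bracket.

Definition SL_vertex := {v : 'I_n * 'I_n | vpos v != (1, 1)%N}.

Definition SL_mutable : pred SL_vertex :=
  fun v => mutable alpha beta (vpos (val v)).

Definition SL_seed : seed {fraction SL_ring K n} SL_mutable :=
  Seed (fun v => (SL_res (phi_ K n alpha beta (vpos (val v))))%:F)
       (fun p q => b_entry n alpha beta (vpos (val (val p))) (vpos (val q))).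

End SLSeed.

(* Main.v *)
Require Import Defs.
From HB Require Import structures.
From mathcomp Require Import all_boot all_order all_algebra.
From mathcomp Require Import generic_quotient ring_quotient fraction boolp.
From mathcomp Require Import ring lra zify.
From mathcomp.real_closed Require Import mxtens.
From mathcomp.multinomials Require Import mpoly.

(* The bracket differs from the standard Sklyanin bracket by a Cartan part and
   by the exotic term e_{al+1,al} /\ e_{be,be+1}, taken once for the right and
   once for the left translations.  Both exotic terms can be removed by a
   rational change of coordinates: Y = (1 - u E) X (1 - s E'), with elementary
   matrices E, E' and suitable ratios u and s of minors of X, has the bracket
   without exotic terms.  There the minors f_ij are log canonical by the Pluecker
   relations, with explicit coefficients, and every phi_ij(X) is f_ij(Y) times a
   monomial in f_{1,be+1}(Y) and f_{al+1,1}(Y).  Thus the initial cluster is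
   log canonical with a coefficient matrix Omega that can be written down, and
   B Omega = - (1 0) is checked at every mutable vertex: at a vertex of the grid
   it is a hexagon identity, at (al+1,1) and (1,be+1) it uses the
   Belavin-Drinfeld conditions on the Cartan part.  For skew-symmetric B the
   identity B Omega = d (1 0) with d <> 0 survives mutations, and it makes the
   mutated clusters log canonical.  Cluster functions do not vanish since Y can
   be prescribed, and on SL_n det X is a Casimir equal to 1. *)

Set Implicit Arguments.
Unset Strict Implicit.
Unset Printing Implicit Defensive.

Import Order.TTheory GRing.Theory Num.Theory.
Local Open Scope ring_scope.
Local Open Scope quotient_scope.

(** * Biderivations *)

(** The ratios [u] and [s] are dictated by the exotic terms. A step that subtracts [s] times column
    [al+1] from column [al] can cancel the right exotic term only if the bracket of [s] with [x_kl]
    contains [x_k,be] when [l = be+1], and it can keep the other terms only if [s x_k,al+1] has the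
    Cartan weight of [x_k,al]. The quotient of the left neighbour of [f_{1,be+1}] by [f_{1,be+1}]
    has the first property, and the Belavin-Drinfeld condition supplies the second. The obstacle is
    that the two steps interfere in the central cases. If [be = n/2], the row changed by the left
    step is the last row of [f_{1,be+1}], so [s] must be formed after that step; this is the origin
    of [psi_1] and of its starred companion in [theta_k]. If [al = n/2] the order has to be
    reversed; transposing [X] exchanges [al] with [be], turns [rho_ij] into [delta_ij - rho_ij], and
    reduces this case to the other. The monomial factors of [phi_ij] enter an arrow sum through the
    indicators of two diagonals. At grid vertices their hexagon sums live where these diagonals meet
    the last row and the last column, and the additional arrows of the quiver cancel them there. *)

Definition biderivation (R : comNzRingType) (br : R -> R -> R) : Prop :=
  [/\ forall x y z, br (x + y) z = br x z + br y z,
      forall x y z, br (x * y) z = x * br y z + y * br x z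
    & forall x y, br x y = - br y x].

Section BiderivationRing.

Variables (R : comNzRingType) (br : R -> R -> R) (brP : biderivation br).

Lemma brDl x y z : br (x + y) z = br x z + br y z.
Proof. by case: brP. Qed.
Lemma brMl x y z : br (x * y) z = x * br y z + y * br x z.
Proof. by case: brP. Qed.
Lemma brC x y : br x y = - br y x. Proof. by case: brP. Qed.

Lemma brDr x y z : br z (x + y) = br z x + br z y.
Proof. by rewrite brC brDl opprD -!(brC z). Qed.

Lemma brMr x y z : br z (x * y) = x * br z y + y * br z x.
Proof. by rewrite brC brMl opprD -!mulrN -!(brC z). Qed.

Lemma br0l z : br 0 z = 0.
Proof. by apply: (addrI (br 0 z)); rewrite -brDl !addr0. Qed.

Lemma brNl x z : br (- x) z = - br x z.
Proof. by apply: (addrI (br x z)); rewrite -brDl !subrr br0l. Qed.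

Lemma br1l z : br 1 z = 0.
Proof.
apply: (addrI (br 1 z)).
by rewrite -{3}(mulr1 1) brMl !mul1r addr0.
Qed.

End BiderivationRing.

(** * Rational coefficients in a field of characteristic 0 *)

Section RationalScalars.

Variables (F : fieldType) (charF : [pchar F] =i pred0).

Lemma natr_char0 n : (n%:R == 0 :> F) = (n == 0)%N.
Proof. by rewrite (pcharf0P F).1. Qed.

Lemma intr_char0 (m : int) : (m%:~R == 0 :> F) = (m == 0).
Proof.
case: m => m; rewrite ?NegzE ?rmorphN ?oppr_eq0 /= -pmulrn natr_char0 //.
Qed.

(** The fraction [a / b] need not be in lowest terms, while [ratr] reads off the reduced numerator
    and denominator. Cross-multiplication compares the two, and characteristic 0 keeps the
    denominators nonzero. *)
Lemma ratr_div (a b : int) : b != 0 ->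
  ratr (a%:~R / b%:~R) = a%:~R / b%:~R :> F.
Proof.
move=> b0; set x : rat := _ / _; rewrite /ratr.
apply/eqP; rewrite eqr_div ?intr_char0 ?denq_neq0 // -!rmorphM /=.
apply/eqP; congr (_%:~R).
have: x * (denq x)%:~R * b%:~R = x * b%:~R * (denq x)%:~R by ring.
rewrite -numqE /x mulfVK ?intr_eq0 // -!rmorphM /= => /eqP.
by rewrite eqr_int => /eqP.
Qed.

Lemma ratr_char0D : {morph (@ratr F) : x y / x + y}.
Proof.
move=> x y; rewrite -(divq_num_den x) -(divq_num_den y).
have dx := denq_neq0 x; have dy := denq_neq0 y.
rewrite addf_div ?intr_eq0 // -!rmorphM -!rmorphD /= !ratr_div ?mulf_neq0 //.
by rewrite addf_div ?intr_char0 // -!rmorphM -!rmorphD.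
Qed.

Lemma ratr_char0M : {morph (@ratr F) : x y / x * y}.
Proof.
move=> x y; rewrite -(divq_num_den x) -(divq_num_den y).
have dx := denq_neq0 x; have dy := denq_neq0 y.
rewrite mulf_div -!rmorphM /= !ratr_div ?mulf_neq0 //.
by rewrite mulf_div -!rmorphM.
Qed.

Lemma ratr_char0_int (m : int) : ratr m%:~R = m%:~R :> F.
Proof. by rewrite -[m%:~R in LHS]divr1 -[1]/(1%:~R) ratr_div // divr1. Qed.

(* Carrying the proof of [charF] lets this copy of [ratr] be a ring morphism
   outside of numFieldType. *)
Definition ratF of [pchar F] =i pred0 : rat -> F := fun x => ratr x.

Fact ratF_zmod : zmod_morphism (ratF charF).
Proof.
move=> x y; rewrite /ratF; apply/eqP; rewrite -subr_eq0 opprB addrA subr_eq0.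
by rewrite -ratr_char0D subrK.
Qed.

Fact ratF_monoid : monoid_morphism (ratF charF).
Proof. by split; [exact: (ratr_char0_int 1) | exact: ratr_char0M]. Qed.

HB.instance Definition _ := GRing.isZmodMorphism.Build rat F (ratF charF) ratF_zmod.
HB.instance Definition _ :=
  GRing.isMonoidMorphism.Build rat F (ratF charF) ratF_monoid.

End RationalScalars.

(** * Calculus of log canonical pairs *)

Section LogCanonical.

Variables (F : fieldType) (charF : [pchar F] =i pred0).
Variables (br : F -> F -> F) (brP : biderivation br).

Definition log_br (w : rat) (x y : F) : Prop :=
  br x y = ratF charF w * (x * y).
Local Notation lc := log_br.

Lemma lcC w x y : lc w x y -> lc (- w) y x.
Proof. by rewrite /log_br => xy; rewrite (brC brP) xy rmorphN mulNr (mulrC y). Qed.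

Lemma lcMl a b x y z : lc a x z -> lc b y z -> lc (a + b) (x * y) z.
Proof.
rewrite /log_br => xz yz; case: brP => _ -> _.
by rewrite xz yz rmorphD /=; ring.
Qed.

Lemma lcDl a x y z : lc a x z -> lc a y z -> lc a (x + y) z.
Proof.
rewrite /log_br => xz yz; case: brP => -> _ _.
by rewrite xz yz; ring.
Qed.

Lemma lc1l z : lc 0 1 z.
Proof. by rewrite /log_br (br1l brP) rmorph0 mul0r. Qed.

Lemma lcVl a x z : lc a x z -> lc (- a) x^-1 z.
Proof.
rewrite /log_br => xz; have [->|x0] := eqVneq x 0.
  (* The inverse of 0 is 0, and both sides vanish. *)
  by rewrite invr0 (br0l brP) mul0r mulr0.
have: br (x * x^-1) z = 0 by rewrite mulfV // (br1l brP).
case: brP => _ -> _; rewrite xz rmorphN => /eqP; rewrite addr_eq0 => /eqP E.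
by apply: (mulfI x0); rewrite E; field.
Qed.

Lemma lcXl a x z n : lc a x z -> lc (n%:R * a) (x ^+ n) z.
Proof.
move=> xz; elim: n => [|n IH]; first by rewrite mul0r expr0; exact: lc1l.
by rewrite exprS -nat1r mulrDl mul1r; exact: lcMl.
Qed.

Lemma lc_prodl (I : finType) (P : pred I) (w : I -> rat) (x : I -> F) z :
  (forall i, P i -> lc (w i) (x i) z) ->
  lc (\sum_(i | P i) w i) (\prod_(i | P i) x i) z.
Proof.
move=> H; elim/big_ind2: _ => [|a y b t|]; [exact: lc1l | exact: lcMl | exact: H].
Qed.

(** Nonzero elements determine their coefficient because [ratF] is injective. This is how
    skew-symmetry passes from the bracket to the coefficient matrix. *)
Lemma lc_inj a b x y : x != 0 -> y != 0 -> lc a x y -> lc b x y -> a = b.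
Proof.
rewrite /log_br => x0 y0 -> /(mulIf (mulf_neq0 x0 y0)).
exact: fmorph_inj.
Qed.

Lemma lcMr a b x y z : lc a z x -> lc b z y -> lc (a + b) z (x * y).
Proof.
move=> /lcC zx /lcC zy; rewrite -[a + b]opprK opprD.
by apply: lcC; apply: lcMl.
Qed.

Lemma lcXr a x z n : lc a z x -> lc (n%:R * a) z (x ^+ n).
Proof.
move=> /lcC zx; rewrite -[a]opprK mulrN.
by apply: lcC; apply: lcXl.
Qed.

End LogCanonical.

(** * Mutation of compatible seeds *)

Section Mutation.

Variables (F : fieldType) (charF : [pchar F] =i pred0).
Variables (br : F -> F -> F) (brP : biderivation br).
Variables (V : finType) (mut : pred V).
Local Notation seed := (seed F mut).
Local Notation lc := (log_br charF br).

Definition posp (b : int) : int := if 0 < b then b else 0.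
Definition negp (b : int) : int := if b < 0 then - b else 0.

Lemma posp_negp b : b = posp b - negp b.
Proof. by rewrite /posp /negp; case: (ltgtP b 0) => [|H|->]; rewrite ?subr0 ?sub0r ?opprK. Qed.

(** One-sided form of the mutation rule: the sign of [c] selects the positive or the negative part
    of the entry [b]. In particular the division by 2 is exact. *)
Lemma mutate_entry (b c : int) :
  ((`|c| * b + c * `|b|) %/ 2)%Z = c * (if 0 <= c then posp b else negp b).
Proof.
rewrite -[RHS](@mulzK _ 2) //; congr (_ %/ _)%Z.
rewrite /posp /negp; case: (leP 0 c) => hc; case: (ltgtP b 0) => hb; lia.
Qed.

(* For a skew-symmetric exchange matrix, compatibility of a Poisson bracket
   with a cluster structure amounts to the matrix equation
   [exmx s *m Om = d *: (1 | 0)]. *)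
Definition compatible_seed (d : rat) (s : seed) : Prop :=
  exists Om : V -> V -> rat,
  [/\ forall v, cluster s v != 0,
      forall p q, lc (Om p q) (cluster s p) (cluster s q),
      forall i p, exmx s i (val p) = - exmx s p (val i)
    & forall p v, \sum_q (exmx s p q)%:~R * Om q v = d * (val p == v)%:R].

(** Row [p] of the matrix identity says that the two monomials of the exchange relation have equal
    coefficients against every variable other than [x_p], and coefficients differing by [d] against
    [x_p]. Hence their sum, and with it the new variable, is log canonical with the remaining
    variables. Only row and column [p] of [Om] change. *)
Lemma compatible_seed_mutate d s p : d != 0 ->
  compatible_seed d s -> compatible_seed d (mutate s p).
Proof.
move=> d0 [Om [x0 xlc bskew bOm]].
pose P : V := val p.
pose b i q : rat := (exmx s i q)%:~R.
pose bp q : rat := (posp (exmx s p q))%:~R.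
pose bm q : rat := (negp (exmx s p q))%:~R.
pose wp v := \sum_q bp q * Om q v.
pose wm v := \sum_q bm q * Om q v.
have OmC u v : Om u v = - Om v u.
  by apply: (lc_inj (x0 u) (x0 v) (xlc u v)); apply: (lcC brP).
have OmD u : Om u u = 0.
  have /eqP := OmC u u; rewrite -addr_eq0 -mulr2n mulrn_eq0 /=.
  by move/eqP.
have ppz : exmx s p P = 0 by have := bskew p p; rewrite -/P; lia.
have bpP : bp P = 0 by rewrite /bp ppz.
have bmP : bm P = 0 by rewrite /bm ppz.
have wpm v : wp v - wm v = d * (P == v)%:R.
  rewrite -bOm /wp /wm -sumrB; apply: eq_bigr => q _.
  by rewrite -mulrBl -rmorphB /= -posp_negp.
set Mp := \prod_(q | 0 < exmx s p q) cluster s q ^+ `|exmx s p q|%N.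
set Mm := \prod_(q | exmx s p q < 0) cluster s q ^+ `|exmx s p q|%N.
have Mp0 : Mp != 0 by apply/prodf_neq0 => q _; rewrite expf_neq0.
have Mplc v : lc (wp v) Mp (cluster s v).
  have -> : wp v = \sum_(q | 0 < exmx s p q) (`|exmx s p q|%N)%:R * Om q v.
    rewrite [RHS]big_mkcond; apply: eq_bigr => q _; rewrite /bp /posp.
    case: ifP => [h|]; last by rewrite mul0r.
    by rewrite -{1}(gtz0_abs h) -pmulrn.
  by apply: (lc_prodl brP) => q _; apply: (lcXl brP).
have Mmlc v : lc (wm v) Mm (cluster s v).
  have -> : wm v = \sum_(q | exmx s p q < 0) (`|exmx s p q|%N)%:R * Om q v.
    rewrite [RHS]big_mkcond; apply: eq_bigr => q _; rewrite /bm /negp.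
    case: ifP => [h|]; last by rewrite mul0r.
    by rewrite -(ltz0_abs h) -pmulrn.
  by apply: (lc_prodl brP) => q _; apply: (lcXl brP).
(* Opposite monomials would have equal coefficients against [x_p], contrary to [wpm] and
   [d != 0]. *)
have M0 : Mp + Mm != 0.
  apply/negP; rewrite addr_eq0 => /eqP E.
  have := Mplc P; rewrite E => h1.
  have h2 := Mmlc P.
  have Mm0 : - Mm != 0 by rewrite -E.
  have h3 : lc (wm P) (- Mm) (cluster s P).
    by move: h2; rewrite /log_br (brNl brP) => ->; rewrite mulNr mulrN.
  have e := lc_inj Mm0 (x0 P) h1 h3.
  have := wpm P; rewrite e subrr eqxx mulr1 => /esym/eqP.
  by rewrite (negPf d0).
have MDlc v : v != P -> lc (wp v) (Mp + Mm) (cluster s v).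
  move=> vP; apply: (lcDl brP) => //.
  have := wpm v; rewrite eq_sym (negPf vP) mulr0 => /eqP.
  by rewrite subr_eq0 => /eqP ->.
(* Coefficient of the new variable against [x_v]. For [v != P] the choice of [wp] or [wm] makes no
   difference. *)
pose Op v := wp v - Om P v.
pose Om' u v := if u == P then (if v == P then 0 else Op v)
                else if v == P then - Op u else Om u v.
have newlc v : v != P -> lc (Op v) ((Mp + Mm) / cluster s P) (cluster s v).
  by move=> vP; apply: (lcMl brP); [exact: MDlc | exact: lcVl].
exists Om'; split.
- move=> v; rewrite /= /mutate_cluster; case: ifP => _; last exact: x0.
  by apply: mulf_neq0; rewrite ?invr_eq0.
- move=> u v; rewrite /= /mutate_cluster /Om' -/P -/Mp -/Mm.
  have [uP|uP] := eqVneq u P; have [vP|vP] := eqVneq v P => //.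
  + rewrite /log_br rmorph0 mul0r.
    set z := _ / _; have /eqP := brC brP z z.
    rewrite -addr_eq0 -mulr2n -mulr_natl mulf_eq0 (natr_char0 charF) /=.
    by move/eqP.
  + exact: newlc.
  + by apply: (lcC brP); exact: newlc.
- move=> i q; rewrite /= /mutate_exmx /= -!/P.
  rewrite -!(inj_eq val_inj) -/P.
  have [ip|ip] := eqVneq (val i) P; have [qp|qp] := eqVneq (val q) P;
    rewrite /= ?(bskew i q) ?opprK //.
  rewrite [exmx s i P](bskew i p) [exmx s q P](bskew q p).
  rewrite !mutate_entry.
  move: (exmx s p (val i)) (exmx s p (val q)) (exmx s q _) => a c e.
  rewrite /posp /negp ?oppr_ge0 ?oppr_lt0 ?oppr_gt0.
  by case: (ltgtP a 0) => ha; case: (ltgtP c 0) => hc; rewrite ?ha ?hc; ring.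
move=> i v; rewrite /= /mutate_exmx -/P -!(inj_eq val_inj) -/P.
have sumP (f : V -> rat) : f P = 0 -> \sum_q f q = \sum_(q | q != P) f q.
  by move=> f0; rewrite (bigD1 P) //= f0 add0r.
have Om'v q : v != P -> q != P -> Om' q v = Om q v.
  by move=> vP qP; rewrite /Om' (negPf vP) (negPf qP).
have Om'P q : q != P -> Om' q P = - Op q.
  by move=> qP; rewrite /Om' (negPf qP) eqxx.
have dbl (f g : V -> rat) :
    \sum_q f q * (\sum_r g r * Om r q) = - \sum_r g r * (\sum_q f q * Om q r).
  under eq_bigr do rewrite mulr_sumr.
  rewrite exchange_big -sumrN; apply: eq_bigr => r _.
  rewrite mulr_sumr -sumrN; apply: eq_bigr => q _.
  by rewrite (OmC r q); ring.
have bOmr j u : \sum_q b j q * Om u q = - (d * (val j == u)%:R).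
  rewrite -bOm -sumrN; apply: eq_bigr => q _.
  by rewrite (OmC u q) mulrN.
have [ip|ip] := eqVneq (val i) P.
  have {ip}-> : i = p by apply: val_inj.
  rewrite /= -/P; have [vP|vP] := eqVneq v P.
    rewrite vP mulr1 (sumP) ?ppz ?oppr0 ?mul0r //.
    transitivity (\sum_(q | q != P) b p q * Op q).
      by apply: eq_bigr => q qP; rewrite Om'P // rmorphN /= mulrNN.
    rewrite -(sumP (fun q => b p q * Op q)); last by rewrite /b ppz mul0r.
    under eq_bigr do rewrite mulrBr.
    rewrite sumrB dbl bOmr -/P eqxx mulr1 opprK.
    under eq_bigr => r _ do rewrite [X in bp r * X](bOm p r) -/P.
    rewrite big1 ?oppr0 ?add0r // => r _; case: eqVneq => [<-|_].
      by rewrite bpP mul0r.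
    by rewrite !mulr0.
  rewrite mulr0.
  have := bOm p v; rewrite -/P eq_sym (negPf vP) mulr0 => E.
  rewrite (sumP) ?ppz ?oppr0 ?mul0r //.
  transitivity (- \sum_q (exmx s p q)%:~R * Om q v); last by rewrite E oppr0.
  rewrite -sumrN [RHS](sumP) ?ppz ?mul0r ?oppr0 //.
  by apply: eq_bigr => q qP; rewrite Om'v // rmorphN mulNr.
set c : rat := (exmx s i P)%:~R.
(* Off the column [P], row [i] of the mutated matrix is the old row plus [c] times the positive or
   the negative part of row [p], according to the sign of [c]. *)
have b'E q : q != P ->
    ((if (false || (q == P)) then - exmx s i q else
       exmx s i q + ((`|exmx s i P| * exmx s p q + exmx s i P * `|exmx s p q|) %/ 2)%Z)%:~R
     : rat) = b i q + c * (if 0 <= exmx s i P then bp q else bm q).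
  move=> qP; rewrite (negPf qP) /= mutate_entry rmorphD rmorphM /= -/(b i q) -/c.
  by rewrite /bp /bm; case: ifP.
have [vP|vP] := eqVneq v P; last first.
  have wpmE : wp v = wm v.
    by apply/eqP; rewrite -subr_eq0 wpm [P == v]eq_sym (negPf vP) mulr0.
  rewrite (bigD1 P) //= eqxx rmorphN /= -/c {1}/Om' eqxx (negPf vP).
  under eq_bigr => q qP do rewrite b'E // Om'v // mulrDl.
  rewrite big_split /=.
  have -> : \sum_(q | q != P) b i q * Om q v = d * (val i == v)%:R - c * Om P v.
    by rewrite -bOm [in RHS](bigD1 P) //= -/c addrC addrK.
  have -> : \sum_(q | q != P)
       c * (if 0 <= exmx s i P then bp q else bm q) * Om q v = c * wp v.
    under eq_bigr => q _ do rewrite -mulrA.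
    rewrite -mulr_sumr; congr (_ * _).
    rewrite -(sumP (fun q => (if 0 <= exmx s i P then bp q else bm q) * Om q v)).
      by case: (0 <= _) => //; rewrite wpmE.
    by case: (0 <= _); rewrite ?bpP ?bmP mul0r.
  by rewrite /Op; ring.
rewrite vP [in RHS](negPf ip) mulr0.
rewrite (bigD1 P) //= [Om' P P]/Om' eqxx mulr0 add0r.
under eq_bigr => q qP do rewrite b'E // Om'P // mulrN.
rewrite sumrN; apply/eqP; rewrite oppr_eq0; apply/eqP.
under eq_bigr => q _ do rewrite mulrDl.
rewrite big_split /=.
pose pm q := if 0 <= exmx s i P then bp q else bm q.
pose w q := if 0 <= exmx s i P then wp q else wm q.
have wE q : q != P -> wp q = w q.
  move=> qP; rewrite /w; case: (0 <= _) => //.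
  by apply/eqP; rewrite -subr_eq0 wpm [P == q]eq_sym (negPf qP) mulr0.
have wsum q : w q = \sum_r pm r * Om r q by rewrite /w /pm; case: (0 <= _).
have pmP : pm P = 0 by rewrite /pm; case: (0 <= _); rewrite ?bpP ?bmP.
have -> : \sum_(q | q != P) b i q * Op q = - (bp (val i) * d) - c * wp P.
  have -> : \sum_(q | q != P) b i q * Op q = \sum_q b i q * Op q - c * wp P.
    by rewrite [in RHS](bigD1 P) //= /Op OmD subr0 -/c addrC addrK.
  congr (_ - _); rewrite /Op; under eq_bigr do rewrite mulrBr.
  rewrite sumrB bOmr (negPf ip) mulr0 oppr0 subr0 dbl; congr (- _).
  under eq_bigr do rewrite bOm.
  rewrite (bigD1 (val i)) //= eqxx mulr1 big1 ?addr0 // => r ri.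
  by rewrite eq_sym (negPf ri) !mulr0.
have -> : \sum_(q | q != P) c * pm q * Op q = c * w P.
  under eq_bigr => q qP do rewrite /Op (wE _ qP) -mulrA.
  rewrite -mulr_sumr; congr (_ * _).
  rewrite -(sumP (fun q => pm q * (w q - Om P q))) ?pmP ?mul0r //.
  under eq_bigr do rewrite mulrBr.
  (* This is the skew form [Om] evaluated at the vector [pm] twice. *)
  rewrite sumrB; have -> : \sum_q pm q * w q = 0.
    have : \sum_q pm q * w q = - \sum_q pm q * w q.
      by under [LHS]eq_bigr => q _ do rewrite wsum; rewrite dbl;
         under [in LHS]eq_bigr => q _ do rewrite -wsum.
    by move/eqP; rewrite -addr_eq0 -mulr2n mulrn_eq0 /= => /eqP.
  rewrite sub0r wsum -sumrN; apply: eq_bigr => q _.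
  by rewrite (OmC q P) mulrN.
(* By skew-symmetry [bp (val i)] is 0 if [c >= 0] and [- c] otherwise; in the second case the
   equality [wp P - wm P = d] finishes. *)
rewrite /w; have := bskew i p; rewrite -/P.
case: (leP 0 (exmx s i P)) => hc e.
  have -> : bp (val i) = 0 by rewrite /bp /posp; case: ifP => //; lia.
  by ring.
have -> : bp (val i) = - c.
  by rewrite /bp /posp /c e; case: ifP => h; [rewrite rmorphN opprK | lia].
have := wpm P; rewrite eqxx mulr1 => <-; ring.
Qed.

Lemma compatible_seed_compatible d s : d != 0 ->
  compatible_seed d s -> compatible br s.
Proof.
move=> d0 sd ps; have {sd} : compatible_seed d (foldl (@mutate _ _ _) s ps).
  elim: ps s sd => //= p ps IH s sd.
  by apply: IH; apply: compatible_seed_mutate.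
by case=> Om [_ Omlc _ _] p q; exists (Om p q); apply: Omlc.
Qed.

End Mutation.

(** * Extension of a biderivation to the field of fractions *)

Section FractionBracket.

Variables (R : idomainType) (br : R -> R -> R) (brP : biderivation br).
Local Notation "x %:F" := (tofrac x).

Let frac_num (a b c d : R) : R :=
  b * d * br a c - b * c * br a d - a * d * br b c + a * c * br b d.

Lemma frac_repr (f : {fraction R}) :
  f = (\n_(repr f))%:F / (\d_(repr f))%:F.
Proof.
have d0 : (\d_(repr f))%:F != 0 by rewrite tofrac_eq0 denom_ratioP.
have H (x : {ratio R}) : \pi_{fraction R} x * (\d_x)%:F = (\n_x)%:F.
  unlock tofrac; rewrite -[LHS]FracField.pi_mul; apply/eqmodP => /=.
  rewrite FracField.equivfE /FracField.mulf !numden_Ratio ?mulr1 ?oner_eq0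
    ?denom_ratioP //.
  by rewrite mulrC.
by apply: (mulIf d0); rewrite mulfVK // -H reprK.
Qed.

(** Independence of the representative in the first argument: bracketing [a' b = a b'] with [z]
    eliminates the bracket of [a']. *)
Let frac_num_congl (a b a' b' c d : R) : a' * b = a * b' ->
  frac_num a' b' c d * b ^+ 2 = frac_num a b c d * b' ^+ 2.
Proof.
move=> E.
have D z : br a' z * b = a * br b' z + b' * br a z - a' * br b z.
  by have /eqP := congr1 (br^~ z) E; case: brP => _ BM _; rewrite !BM => /eqP <-; ring.
have H z : (b' * br a' z - a' * br b' z) * b ^+ 2
           = (b * br a z - a * br b z) * b' ^+ 2.
  transitivity (b' * b * (br a' z * b) - (a' * b) * b * br b' z); first by ring.
  rewrite D E; transitivity (b * b' ^+ 2 * br a z - (a' * b) * b' * br b z); first by ring.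
  by rewrite E; ring.
transitivity (d * ((b' * br a' c - a' * br b' c) * b ^+ 2)
              - c * ((b' * br a' d - a' * br b' d) * b ^+ 2)).
  by rewrite /frac_num; ring.
by rewrite !H /frac_num; ring.
Qed.

Let frac_numC a b c d : frac_num c d a b = - frac_num a b c d.
Proof.
rewrite /frac_num (brC brP c a) (brC brP c b) (brC brP d a) (brC brP d b); ring.
Qed.

Let frac_num_congr (a b c d c' d' : R) : c' * d = c * d' ->
  frac_num a b c' d' * d ^+ 2 = frac_num a b c d * d' ^+ 2.
Proof.
by move=> E; rewrite -(opprK (frac_num a b c' d')) -frac_numC mulNr
  (frac_num_congl _ _ E) frac_numC; ring.
Qed.

(** The quotient rule holds for every way of writing the two fractions, so the laws of a
    biderivation can be checked on convenient numerators and denominators. *)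
Lemma frac_bracketE (a b c d : R) : b != 0 -> d != 0 ->
  frac_bracket br (a%:F / b%:F) (c%:F / d%:F)
  = (b * d * br a c - b * c * br a d - a * d * br b c + a * c * br b d)%:F
    / (b ^+ 2 * d ^+ 2)%:F.
Proof.
move=> b0 d0; rewrite /frac_bracket.
have cross (x y : R) : y != 0 ->
    \n_(repr (x%:F / y%:F)) * y = x * \d_(repr (x%:F / y%:F)).
  move=> y0; have := frac_repr (x%:F / y%:F); set f := repr _.
  move/eqP; rewrite eqr_div ?tofrac_eq0 ?denom_ratioP // -!tofracM tofrac_eq.
  by move/eqP.
have E1 := cross a b b0; have E2 := cross c d d0.
have f0 := denom_ratioP (repr (a%:F / b%:F)).
have g0 := denom_ratioP (repr (c%:F / d%:F)).
move: (frac (repr (a%:F / b%:F))) (frac (repr (c%:F / d%:F))) E1 E2 f0 g0.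
move=> [a' b'] [c' d'] /= E1 E2 f0 g0.
apply/eqP; rewrite eqr_div ?tofrac_eq0 ?mulf_neq0 ?expf_neq0 //.
rewrite -!tofracM tofrac_eq; apply/eqP.
have H1 := frac_num_congl c' d' E1; have H2 := frac_num_congr a b E2.
rewrite -!/(frac_num _ _ _ _).
transitivity ((frac_num a' b' c' d' * b ^+ 2) * d ^+ 2); first by ring.
rewrite H1; transitivity ((frac_num a b c' d' * d ^+ 2) * b' ^+ 2); first by ring.
by rewrite H2; ring.
Qed.

Lemma frac_bracket_biderivation : biderivation (frac_bracket br).
Proof.
have BM := brMl brP; have BMr := brMr brP.
have BD : forall x y z, br (x + y) z = br x z + br y z by case: brP.
split=> [x y z|x y z|x y].
- rewrite (frac_repr x) (frac_repr y) (frac_repr z).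
  move: (denom_ratioP (repr x)) (denom_ratioP (repr y)) (denom_ratioP (repr z)).
  move: (frac (repr x)) (frac (repr y)) (frac (repr z)).
  move=> [a b] [c d] [e f] /= b0 d0 f0.
  rewrite addf_div ?tofrac_eq0 // -!tofracM -!tofracD.
  rewrite !frac_bracketE ?mulf_neq0 //.
  rewrite addf_div ?tofrac_eq0 ?mulf_neq0 ?expf_neq0 // -!tofracM -!tofracD.
  apply/eqP; rewrite eqr_div ?tofrac_eq0 ?mulf_neq0 ?expf_neq0 //.
  rewrite -!tofracM tofrac_eq; apply/eqP.
  by rewrite !BD !BM; ring.
- rewrite (frac_repr x) (frac_repr y) (frac_repr z).
  move: (denom_ratioP (repr x)) (denom_ratioP (repr y)) (denom_ratioP (repr z)).
  move: (frac (repr x)) (frac (repr y)) (frac (repr z)).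
  move=> [a b] [c d] [e f] /= b0 d0 f0.
  rewrite mulf_div -!tofracM.
  rewrite !frac_bracketE ?mulf_neq0 // !mulf_div -!tofracM.
  rewrite addf_div ?tofrac_eq0 ?mulf_neq0 ?expf_neq0 // -!tofracM -!tofracD.
  apply/eqP; rewrite eqr_div ?tofrac_eq0 ?mulf_neq0 ?expf_neq0 //.
  rewrite -!tofracM tofrac_eq; apply/eqP.
  by rewrite !BM; ring.
rewrite (frac_repr x) (frac_repr y).
move: (denom_ratioP (repr x)) (denom_ratioP (repr y)).
move: (frac (repr x)) (frac (repr y)) => [a b] [c d] /= b0 d0.
rewrite !frac_bracketE // -!/(frac_num _ _ _ _) (frac_numC a b c d).
by rewrite tofracN mulNr opprK [X in _ = _ / X%:F]mulrC.
Qed.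

Lemma frac_bracket_tofrac (a b : R) :
  frac_bracket br a%:F b%:F = (br a b)%:F.
Proof.
rewrite -[a%:F]divr1 -[b%:F]divr1 -tofrac1 frac_bracketE ?oner_eq0 //.
rewrite (br1l brP) (brC brP a 1) !(br1l brP) !expr1n !mulr1 !mul1r tofrac1 divr1.
by rewrite !oppr0 !mulr0 !subr0 addr0.
Qed.

End FractionBracket.

(** * Minors and their brackets *)

Section Minors.

Variable R : comNzRingType.
Implicit Types M : nat -> nat -> R.

(** Rows and columns are selected by functions rather than sets: exchanging one index is then [upd],
    and a minor in which an index repeats is defined and equal to 0. Both facts drive the bracket
    computations. *)
Definition minor_mx M m (r c : 'I_m -> nat) : 'M[R]_m := \matrix_(a, b) M (r a) (c b).
Definition mnr M m (r c : 'I_m -> nat) : R := \det (minor_mx M r c).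
Definition upd m (r : 'I_m -> nat) (i : 'I_m) (x : nat) : 'I_m -> nat :=
  fun t => if t == i then x else r t.

Lemma eq_mnr M M' m (r r' c c' : 'I_m -> nat) :
  (forall a b, M (r a) (c b) = M' (r' a) (c' b)) -> mnr M r c = mnr M' r' c'.
Proof. by move=> E; congr (\det _); apply/matrixP => a b; rewrite !mxE. Qed.

Lemma upd_id m (r : 'I_m -> nat) i t : upd r i (r i) t = r t.
Proof. by rewrite /upd; case: eqP => // ->. Qed.

Lemma mnr_tr M m (r c : 'I_m -> nat) : mnr (fun i j => M j i) c r = mnr M r c.
Proof. by rewrite /mnr -det_tr; congr (\det _); apply/matrixP => a b; rewrite !mxE. Qed.

Lemma mnr_alt_row M m (r c : 'I_m -> nat) t t' :
  t != t' -> r t = r t' -> mnr M r c = 0.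
Proof.
move=> tt' E; apply: (determinant_alternate tt') => b; by rewrite !mxE E.
Qed.

Lemma mnr_alt_col M m (r c : 'I_m -> nat) t t' :
  t != t' -> c t = c t' -> mnr M r c = 0.
Proof. by move=> tt' E; rewrite -mnr_tr; apply: (mnr_alt_row _ _ tt'). Qed.

Lemma mnr_upd_row0 M m (r c : 'I_m -> nat) i t :
  t != i -> mnr M (upd r i (r t)) c = 0.
Proof.
by move=> ti; apply: (mnr_alt_row _ _ ti); rewrite /upd eqxx (negPf ti).
Qed.

Lemma mnr_upd_col0 M m (r c : 'I_m -> nat) j t :
  t != j -> mnr M r (upd c j (c t)) = 0.
Proof.
by move=> ti; apply: (mnr_alt_col _ _ ti); rewrite /upd eqxx (negPf ti).
Qed.

(** The cofactors along row [i] do not see that row, so they are those of the minor before the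
    substitution. *)
Lemma mnr_expand_row M m (r c : 'I_m -> nat) i x :
  mnr M (upd r i x) c = \sum_j M x (c j) * cofactor (minor_mx M r c) i j.
Proof.
rewrite /mnr (expand_det_row _ i); apply: eq_bigr => j _.
rewrite mxE /upd eqxx /cofactor; congr (_ * (_ * \det _)).
by apply/matrixP => a b; rewrite !mxE eq_sym (negPf (neq_lift _ _)).
Qed.

Lemma mnr_expand_col M m (r c : 'I_m -> nat) j x :
  mnr M r (upd c j x) = \sum_i M (r i) x * cofactor (minor_mx M r c) i j.
Proof.
rewrite -mnr_tr mnr_expand_row; apply: eq_bigr => i _; congr (_ * _).
by rewrite -cofactor_tr; congr (cofactor _ _ _); apply/matrixP => a b; rewrite !mxE.
Qed.

Lemma cofactor_col_orth (m : nat) (A : 'M[R]_m) l l' :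
  \sum_k A k l' * cofactor A k l = (l == l')%:R * \det A.
Proof.
have /matrixP/(_ l l') := mul_adj_mx A; rewrite !mxE => E.
rewrite mulr_natl -E; apply: eq_bigr => k _; by rewrite !mxE mulrC.
Qed.

(* Exchanging row [i] of the smaller minor with every row of the larger one
   in turn: the simplest Pluecker relation. *)
Lemma plucker_row M m m' (r c : 'I_m -> nat) (r' c' : 'I_m' -> nat)
    (g : 'I_m -> 'I_m') i : (forall t, c t = c' (g t)) ->
  \sum_k mnr M (upd r i (r' k)) c * mnr M (upd r' k (r i)) c'
  = mnr M r c * mnr M r' c'.
Proof.
move=> gE.
under eq_bigr => k _ do rewrite !mnr_expand_row mulr_suml.
rewrite exchange_big /=.
have -> : mnr M r c = \sum_j M (r i) (c j) * cofactor (minor_mx M r c) i j.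
  by rewrite -mnr_expand_row; apply: eq_mnr => a b; rewrite upd_id.
rewrite mulr_suml; apply: eq_bigr => t _.
under eq_bigr => k _ do rewrite mulr_sumr.
(* With both factors expanded, the sum over [k] pairs a column of the larger minor with the
   cofactors of column [l]; only [l = g t] survives. *)
rewrite exchange_big /= (bigD1 (g t)) //= [X in _ + X]big1 => [|l lt].
  transitivity (M (r i) (c t) * cofactor (minor_mx M r c) i t *
     \sum_k minor_mx M r' c' k (g t) * cofactor (minor_mx M r' c') k (g t)).
    rewrite addr0 mulr_sumr; apply: eq_bigr => k _; rewrite mxE gE; ring.
  by rewrite cofactor_col_orth eqxx mul1r.
transitivity (M (r i) (c' l) * cofactor (minor_mx M r c) i t *
   \sum_k minor_mx M r' c' k (g t) * cofactor (minor_mx M r' c') k l).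
  rewrite mulr_sumr; apply: eq_bigr => k _; rewrite mxE gE; ring.
by rewrite cofactor_col_orth (negPf lt) mul0r mulr0.
Qed.

Section Derivation.

Variables (D : R -> R).
Hypotheses (DD : forall x y, D (x + y) = D x + D y)
           (DM : forall x y, D (x * y) = x * D y + y * D x).

Let D0 : D 0 = 0. Proof. by apply: (addrI (D 0)); rewrite -DD !addr0. Qed.

Let D1 : D 1 = 0.
Proof. by apply: (addrI (D 1)); rewrite -{3}(mulr1 1) DM !mul1r addr0. Qed.

Let DN x : D (- x) = - D x.
Proof. by apply: (addrI (D x)); rewrite -DD !subrr D0. Qed.

Lemma derivation_prod (I : finType) (P : pred I) (x : I -> R) :
  D (\prod_(i | P i) x i) = \sum_(i | P i) D (x i) * \prod_(k | P k && (k != i)) x k.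
Proof.
elim: {P}_.+1 {-2}P (ltnSn #|P|) => // N IH P le.
have [i0 Pi0|P0] := pickP P; last by rewrite !big_pred0.
rewrite (bigD1 i0) //= DM (bigD1 i0 (P := P)) //= IH; last first.
  rewrite -ltnS (leq_trans _ le) // ltnS.
  rewrite (cardD1 i0 P) [i0 \in P]Pi0 add1n ltnS.
  by apply/eq_leq/eq_card => k; rewrite !inE andbC.
rewrite [LHS]addrC [X in X + _]mulrC; congr (_ + _); rewrite mulr_sumr.
apply: eq_bigr => i /andP[Pi ii0]; rewrite mulrCA; congr (_ * _).
rewrite [RHS](bigD1 i0) ?Pi0 1?eq_sym //; congr (_ * _).
by apply: eq_bigl => k; rewrite andbAC.
Qed.

Lemma derivation_det m (A : 'M[R]_m) :
  D (\det A) = \sum_i \sum_j cofactor A i j * D (A i j).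
Proof.
(* [B i] is [A] with row [i] differentiated; the Leibniz rule is applied to each permutation
   term. *)
pose B i : 'M[R]_m := \matrix_(a, b) if a == i then D (A i b) else A a b.
transitivity (\sum_i \det (B i)); last first.
  apply: eq_bigr => i _; rewrite (expand_det_row _ i); apply: eq_bigr => j _.
  rewrite mxE eqxx mulrC; congr (_ * _); rewrite /cofactor; congr (_ * \det _).
  by apply/matrixP => a b; rewrite !mxE eq_sym (negPf (neq_lift _ _)).
have Dsum (J : finType) (f : J -> R) : D (\sum_i f i) = \sum_i D (f i).
  exact: (big_morph D DD D0).
rewrite Dsum exchange_big /=; apply: eq_bigr => s _.
have Ds x : D ((-1) ^+ perm.odd_perm s * x) = (-1) ^+ perm.odd_perm s * D x.
  by case: (perm.odd_perm s); rewrite ?expr1 ?expr0 ?mul1r // !mulN1r DN.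
rewrite Ds derivation_prod -mulr_sumr; congr (_ * _); apply: eq_bigr => i _.
rewrite [RHS](bigD1 i) //= mxE eqxx; congr (_ * _).
by apply: eq_bigr => k ki; rewrite mxE (negPf ki).
Qed.

End Derivation.

(** When the weight and the replacements depend on the columns alone, the two sums over the rows are
    cofactor expansions along the replaced columns. *)
Lemma sum_cofactor_cols M m m' (r c : 'I_m -> nat) (r' c' : 'I_m' -> nat)
    (w : nat -> nat -> R) (x y : nat -> nat -> nat) :
  \sum_i \sum_j \sum_k \sum_l
    cofactor (minor_mx M r c) i j * (cofactor (minor_mx M r' c') k l *
    (w (c j) (c' l) * (M (r i) (x (c j) (c' l)) * M (r' k) (y (c j) (c' l)))))
  = \sum_j \sum_l w (c j) (c' l) *
    (mnr M r (upd c j (x (c j) (c' l))) * mnr M r' (upd c' l (y (c j) (c' l)))).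
Proof.
rewrite exchange_big /=; apply: eq_bigr => j _.
under eq_bigr => i _ do rewrite exchange_big /=.
rewrite exchange_big /=; apply: eq_bigr => l _.
rewrite !mnr_expand_col mulr_suml mulr_sumr; apply: eq_bigr => i _.
rewrite mulr_sumr mulr_sumr; apply: eq_bigr => k _; ring.
Qed.

Lemma sum_cofactor_rows M m m' (r c : 'I_m -> nat) (r' c' : 'I_m' -> nat)
    (w : nat -> nat -> R) (x y : nat -> nat -> nat) :
  \sum_i \sum_j \sum_k \sum_l
    cofactor (minor_mx M r c) i j * (cofactor (minor_mx M r' c') k l *
    (w (r i) (r' k) * (M (x (r i) (r' k)) (c j) * M (y (r i) (r' k)) (c' l))))
  = \sum_i \sum_k w (r i) (r' k) *
    (mnr M (upd r i (x (r i) (r' k))) c * mnr M (upd r' k (y (r i) (r' k))) c').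
Proof.
apply: eq_bigr => i _; rewrite exchange_big /=; apply: eq_bigr => k _.
rewrite !mnr_expand_row mulr_suml mulr_sumr; apply: eq_bigr => j _.
rewrite mulr_sumr mulr_sumr; apply: eq_bigr => l _; ring.
Qed.

Lemma biderivation_mnr (br : R -> R -> R) (brP : biderivation br)
    M m m' (r c : 'I_m -> nat) (r' c' : 'I_m' -> nat) :
  br (mnr M r c) (mnr M r' c') = \sum_i \sum_j \sum_k \sum_l
    cofactor (minor_mx M r c) i j * (cofactor (minor_mx M r' c') k l *
    br (M (r i) (c j)) (M (r' k) (c' l))).
Proof.
rewrite (derivation_det (D := br^~ _)); first last.
- by move=> x y; exact: brMl.
- by move=> x y; exact: brDl.
apply: eq_bigr => i _; apply: eq_bigr => j _.
rewrite (derivation_det (D := br _)); first last.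
- by move=> x y; exact: brMr.
- by move=> x y; exact: brDr.
rewrite mulr_sumr; apply: eq_bigr => k _; rewrite mulr_sumr.
by apply: eq_bigr => l _; rewrite !mxE.
Qed.

End Minors.

Section SklyaninRelations.

Variables (F : fieldType) (charF : [pchar F] =i pred0).
Variables (br : F -> F -> F) (brP : biderivation br) (n : nat).
Local Notation q_ := (ratF charF).
Local Notation inr := (fun i : nat => 0 < i <= n)%N.

(* The brackets of the matrix entries in the Poisson bracket given by the
   r-matrices [rho + \sum_(i < j) e_ji (x) e_ij + t e_{al+1,al} /\ e_{be,be+1}]
   with [t = tR] on the side of the right translations and [t = tL] on the
   side of the left translations; [rho] is the Cartan part. *)
Definition sklyanin (rho : nat -> nat -> rat) (al be : nat) (tR tL : bool)
    (M : nat -> nat -> F) : Prop :=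
  forall i j k l, inr i -> inr j -> inr k -> inr l ->
  br (M i j) (M k l) =
    q_ (rho j l) * (M i j * M k l) - q_ (rho i k) * (M i j * M k l)
    + (j < l)%N%:R * (M i l * M k j) - (k < i)%N%:R * (M k j * M i l)
    + tR%:R * (((j == al) && (l == be.+1))%:R * (M i al.+1 * M k be)
               - ((j == be.+1) && (l == al))%:R * (M i be * M k al.+1))
    - tL%:R * (((i == al.+1) && (k == be))%:R * (M al j * M be.+1 l)
               - ((i == be) && (k == al.+1))%:R * (M be.+1 j * M al l)).

Definition transpose (M : nat -> nat -> F) : nat -> nat -> F := fun i j => M j i.
(** Under transposition the row and column parts change places, whence the sign of [rho]. The
    Kronecker symbol comes from the triangular part, since [[j < l] + [l < j] = 1 - [j = l]]. *)
Definition dual_rho (rho : nat -> nat -> rat) : nat -> nat -> rat :=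
  fun i j => (i == j)%:R - rho i j.

Lemma sklyanin_tr rho al be tR tL M :
  sklyanin rho al be tR tL M ->
  sklyanin (dual_rho rho) be al tL tR (transpose M).
Proof.
move=> H i j k l hi hj hk hl; rewrite /transpose /dual_rho H //.
rewrite !rmorphB /= !rmorph_nat.
rewrite !(andbC (_ == al.+1)) !(andbC (_ == be.+1)).
case: (ltngtP i k) => [ik|ik|->]; case: (ltngtP j l) => [jl|jl|->];
  rewrite /= ?mul1r ?mul0r; ring.
Qed.

Section MinorBracket.

Variables (rho : nat -> nat -> rat) (al be : nat) (tR tL : bool).
Variables (M : nat -> nat -> F) (MP : sklyanin rho al be tR tL M).
Variables (m m' : nat) (r c : 'I_m -> nat) (r' c' : 'I_m' -> nat).
Hypotheses (hr : forall i, inr (r i)) (hc : forall i, inr (c i)).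
Hypotheses (hr' : forall i, inr (r' i)) (hc' : forall i, inr (c' i)).

Let S (f : 'I_m -> 'I_m -> 'I_m' -> 'I_m' -> F) : F :=
  \sum_i \sum_j \sum_k \sum_l
    cofactor (minor_mx M r c) i j * (cofactor (minor_mx M r' c') k l * f i j k l).

Let SD f g : S (fun i j k l => f i j k l + g i j k l) = S f + S g.
Proof.
rewrite /S -big_split; apply: eq_bigr => i _; rewrite -big_split.
apply: eq_bigr => j _; rewrite -big_split; apply: eq_bigr => k _.
by rewrite -big_split; apply: eq_bigr => l _ /=; rewrite !mulrDr.
Qed.

Let SZ x f : S (fun i j k l => x * f i j k l) = x * S f.
Proof.
rewrite /S mulr_sumr; apply: eq_bigr => i _; rewrite mulr_sumr.
apply: eq_bigr => j _; rewrite mulr_sumr; apply: eq_bigr => k _.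
by rewrite mulr_sumr; apply: eq_bigr => l _ /=; ring.
Qed.

(** Each term of the relations between entries replaces only columns or only rows, so the chain rule
    assembles it into products of two minors with one exchanged index each. *)
Lemma bracket_mnr :
  br (mnr M r c) (mnr M r' c') =
    q_ (\sum_j \sum_l rho (c j) (c' l) - \sum_i \sum_k rho (r i) (r' k))
      * (mnr M r c * mnr M r' c')
    + \sum_j \sum_l (c j < c' l)%N%:R *
        (mnr M r (upd c j (c' l)) * mnr M r' (upd c' l (c j)))
    - \sum_i \sum_k (r' k < r i)%N%:R *
        (mnr M (upd r i (r' k)) c * mnr M (upd r' k (r i)) c')
    + tR%:R * (\sum_j \sum_l ((c j == al) && (c' l == be.+1))%:R *
                 (mnr M r (upd c j al.+1) * mnr M r' (upd c' l be))
             - \sum_j \sum_l ((c j == be.+1) && (c' l == al))%:R *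
                 (mnr M r (upd c j be) * mnr M r' (upd c' l al.+1)))
    - tL%:R * (\sum_i \sum_k ((r i == al.+1) && (r' k == be))%:R *
                 (mnr M (upd r i al) c * mnr M (upd r' k be.+1) c')
             - \sum_i \sum_k ((r i == be) && (r' k == al.+1))%:R *
                 (mnr M (upd r i be.+1) c * mnr M (upd r' k al) c')).
Proof.
rewrite (biderivation_mnr brP).
transitivity (S (fun i j k l =>
    ((((q_ (rho (c j) (c' l)) * (M (r i) (c j) * M (r' k) (c' l))
    + (-1) * (q_ (rho (r i) (r' k)) * (M (r i) (c j) * M (r' k) (c' l))))
    + (c j < c' l)%N%:R * (M (r i) (c' l) * M (r' k) (c j)))
    + (-1) * ((r' k < r i)%N%:R * (M (r' k) (c j) * M (r i) (c' l))))
    + tR%:R * (((c j == al) && (c' l == be.+1))%:R * (M (r i) al.+1 * M (r' k) be)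
        + (-1) * (((c j == be.+1) && (c' l == al))%:R * (M (r i) be * M (r' k) al.+1))))
    + (- tL%:R) * (((r i == al.+1) && (r' k == be))%:R * (M al (c j) * M be.+1 (c' l))
        + (-1) * (((r i == be) && (r' k == al.+1))%:R
                  * (M be.+1 (c j) * M al (c' l)))))).
  rewrite /S; do 4!(apply: eq_bigr => ? _); congr (_ * (_ * _)).
  by rewrite MP // !mulN1r mulNr.
rewrite !SD !SZ !SD !SZ /S.
rewrite (sum_cofactor_cols M r c r' c' (fun j l => q_ (rho j l))
           (fun j l => j) (fun j l => l)).
rewrite (sum_cofactor_rows M r c r' c' (fun j l => q_ (rho j l))
           (fun j l => j) (fun j l => l)).
rewrite (sum_cofactor_cols M r c r' c' (fun j l => (j < l)%N%:R)
           (fun j l => l) (fun j l => j)).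
rewrite (sum_cofactor_rows M r c r' c' (fun i k => (k < i)%N%:R)
           (fun j l => l) (fun j l => j)).
rewrite (sum_cofactor_cols M r c r' c' (fun j l => ((j == al) && (l == be.+1))%:R)
           (fun j l => al.+1) (fun j l => be)).
rewrite (sum_cofactor_cols M r c r' c' (fun j l => ((j == be.+1) && (l == al))%:R)
           (fun j l => be) (fun j l => al.+1)).
rewrite (sum_cofactor_rows M r c r' c' (fun i k => ((i == al.+1) && (k == be))%:R)
           (fun j l => al) (fun j l => be.+1)).
rewrite (sum_cofactor_rows M r c r' c' (fun i k => ((i == be) && (k == al.+1))%:R)
           (fun j l => be.+1) (fun j l => al)).
rewrite !mulN1r mulNr rmorphB /= [in RHS]mulrBl.
have idE (p q : nat) (r1 c1 : 'I_p -> nat) (r2 c2 : 'I_q -> nat) i k :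
    (mnr M r1 (upd c1 i (c1 i)) * mnr M r2 (upd c2 k (c2 k))
     = mnr M r1 c1 * mnr M r2 c2) *
    (mnr M (upd r1 i (r1 i)) c1 * mnr M (upd r2 k (r2 k)) c2
     = mnr M r1 c1 * mnr M r2 c2).
  by split; congr (_ * _); apply: eq_mnr => a b; rewrite upd_id.
have sumE (f : nat -> nat -> rat) (u : 'I_m -> nat) (v : 'I_m' -> nat) x :
    \sum_i \sum_k q_ (f (u i) (v k)) * x = q_ (\sum_i \sum_k f (u i) (v k)) * x.
  rewrite rmorph_sum mulr_suml; apply: eq_bigr => i _.
  by rewrite rmorph_sum mulr_suml.
rewrite -!sumE; congr (_ - _ + _ - _ + _ - _);
  by apply: eq_bigr => i _; apply: eq_bigr => k _; rewrite idE.
Qed.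

End MinorBracket.
End SklyaninRelations.

(** * Log canonicity of the minors [f_ij] without exotic terms *)

Section InitialMinors.

Variables (F : fieldType) (charF : [pchar F] =i pred0).
Variables (br : F -> F -> F) (brP : biderivation br) (n : nat).
Local Notation lc := (log_br charF br).
Local Notation inr := (fun i : nat => 0 < i <= n)%N.

(** [f_ij] is the largest contiguous minor with upper left corner [(i, j)]. Beyond the grid the
    truncated subtraction gives the empty minor, equal to 1. *)
Definition fsize (i j : nat) : nat := n.+1 - maxn i j.
Definition from m (i : nat) : 'I_m -> nat := fun t => (i + t)%N.
Definition fm (M : nat -> nat -> F) (i j : nat) : F :=
  mnr M (from (m := fsize i j) i) (from j).

Lemma fsizeC i j : fsize i j = fsize j i.
Proof. by rewrite /fsize maxnC. Qed.

Lemma fm_tr M i j : fm (transpose M) i j = fm M j i.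
Proof.
rewrite /fm -[LHS]mnr_tr fsizeC.
by apply: eq_mnr.
Qed.

Lemma sum_geq m a x : (\sum_(s < m) (x <= a + s) = minn (a + m - x) m)%N.
Proof.
elim: m => [|m IH]; first by rewrite big_ord0 minn0.
by rewrite big_ord_recr /= IH; lia.
Qed.

Lemma sum_ltn m a i : (\sum_(k < m) (i + k < a) = minn (a - i) m)%N.
Proof.
elim: m => [|m IH]; first by rewrite big_ord0 minn0.
by rewrite big_ord_recr /= IH; lia.
Qed.

Definition toral (rho : nat -> nat -> rat) (v w : nat * nat) : rat :=
  \sum_(s < fsize v.1 v.2) \sum_(t < fsize w.1 w.2) rho (v.2 + s)%N (w.2 + t)%N
  - \sum_(s < fsize v.1 v.2) \sum_(t < fsize w.1 w.2) rho (v.1 + s)%N (w.1 + t)%N.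

(** For [v] and [w] on or above the diagonal, the number of Pluecker relations in the bracket: the
    rows of [f_v] below all rows of [f_w] if the columns of [f_v] are among those of [f_w],
    otherwise the rows of [f_w] above all rows of [f_v]. For [v] on or above and [w] below the
    diagonal the formula gives 0. *)
Definition overlap (v w : nat * nat) : nat :=
  if (w.2 <= v.2)%N then minn (v.1 + w.2 - (w.1 + v.2)) (n.+1 - v.2)
  else minn (v.1 - w.1) (n.+1 - w.2).

Section Standard.

Variables (rho : nat -> nat -> rat) (al be : nat).
Variables (M : nat -> nat -> F) (MP : sklyanin charF br n rho al be false false M).

(** The columns of [f_ab] reach [n], so each column exchange brings in a column already present and
    vanishes. Row exchanges either repeat a row or, for one fixed row, add up to a Pluecker relation
    whose value is the product of the two minors. *)
Lemma log_canonical_upper (a b i j : nat) : inr a -> inr b -> (a <= b)%N ->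
  inr i -> inr j ->
  lc (toral rho (a, b) (i, j) - (overlap (a, b) (i, j))%:R) (fm M a b) (fm M i j).
Proof.
move=> ha hb ab hi hj; rewrite /log_br /fm.
have m1 : fsize a b = (n.+1 - b)%N by rewrite /fsize; lia.
have inF x y (s : 'I_(fsize x y)) : inr x -> inr y -> inr (x + s)%N /\ inr (y + s)%N.
  by case: s => s /=; rewrite /fsize => *; lia.
rewrite (bracket_mnr brP MP); last first.
- by move=> t; case: (inF _ _ t hi hj).
- by move=> t; case: (inF _ _ t hi hj).
- by move=> t; case: (inF _ _ t ha hb).
- by move=> t; case: (inF _ _ t ha hb).
rewrite !mul0r addr0 subr0.
set P := mnr M _ _; set Q := mnr M _ _.
rewrite [X in _ + X - _]big1 ?addr0 => [|s _]; last first.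
  rewrite big1 // => t _; case: ltnP => h; last by rewrite mul0r.
  have s'P : (j + t - b < fsize a b)%N.
    by have [_] := inF _ _ t hi hj; move: h m1; rewrite /from; lia.
  have -> : from j t = from b (Ordinal s'P) by move: h; rewrite /from /=; lia.
  rewrite mnr_upd_col0 ?mul0r ?mulr0 //.
  by rewrite -val_eqE /=; move: h; rewrite /from; lia.
rewrite [in RHS]rmorphB [in RHS]mulrBl; congr (_ - _).
rewrite rmorph_nat.
(* Below the diagonal the rows of [f_ij] reach [n], and every row exchange repeats a row. *)
have [ji|ij] := ltnP j i.
  have -> : overlap (a, b) (i, j) = 0%N by rewrite /overlap /=; case: ifP; lia.
  rewrite mul0r big1 // => s _; rewrite big1 // => k _.
  case: ltnP => h; last by rewrite mul0r.
  have kP : (a + s - i < fsize i j)%N.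
    by have [+ _] := inF _ _ s ha hb; move: h; rewrite /fsize /from; lia.
  have -> : from a s = from i (Ordinal kP) by move: h; rewrite /from /=; lia.
  rewrite mnr_upd_row0 ?mul0r ?mulr0 //.
  by rewrite -val_eqE /=; move: h; rewrite /from; lia.
have m2 : fsize i j = (n.+1 - j)%N by rewrite /fsize; lia.
have [jb|bj] := leqP j b.
  have -> : overlap (a, b) (i, j) = (\sum_(s < fsize a b) (i + fsize i j <= a + s))%N.
    by rewrite sum_geq m1 m2 /overlap /= jb; lia.
  rewrite natr_sum mulr_suml; apply: eq_bigr => s _.
  case: leqP => h.
    rewrite mul1r.
    have gP (t : 'I_(fsize a b)) : (b - j + t < fsize i j)%N.
      by case: t => t /=; lia.
    rewrite -(plucker_row M _ _ s (g := fun t => Ordinal (gP t))); last first.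
      by move=> t; rewrite /from /=; lia.
    apply: eq_bigr => k _; rewrite (_ : (_ < _)%N) ?mul1r //.
    by case: k => k /=; rewrite /from /=; lia.
  rewrite mul0r big1 // => k _.
  case: ltnP => h'; last by rewrite mul0r.
  have kP : (a + s - i < fsize i j)%N by move: h h'; rewrite /from; lia.
  have -> : from a s = from i (Ordinal kP) by move: h'; rewrite /from /=; lia.
  rewrite mnr_upd_row0 ?mul0r ?mulr0 //.
  by rewrite -val_eqE /=; move: h'; rewrite /from; lia.
(* Now the columns of [f_ij] are among those of [f_ab], and the Pluecker relation is used with the
   two minors interchanged. *)
have -> : overlap (a, b) (i, j) = (\sum_(k < fsize i j) (i + k < a))%N.
  by rewrite sum_ltn m2 /overlap /= leqNgt bj.
rewrite exchange_big /= natr_sum mulr_suml; apply: eq_bigr => k _.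
case: (ltnP (i + k)) => h.
  rewrite mul1r.
  have gP (t : 'I_(fsize i j)) : (j - b + t < fsize a b)%N.
    by case: t => t /=; lia.
  rewrite [RHS]mulrC -(plucker_row M _ _ k (g := fun t => Ordinal (gP t))); last first.
    by move=> t; rewrite /from /=; lia.
  apply: eq_bigr => s _; rewrite (_ : (from i k < from a s)%N).
    by rewrite mul1r mulrC.
  by move: h; rewrite /from; lia.
rewrite mul0r big1 // => s _.
case: ltnP => h'; last by rewrite mul0r.
have kP : (i + k - a < fsize a b)%N.
  by move: h h'; case: s => s hs; rewrite /from /=; lia.
have -> : from i k = from a (Ordinal kP) by rewrite /from /=; lia.
rewrite mnr_upd_row0 ?mul0r ?mulr0 //.
by rewrite -val_eqE /=; move: h'; rewrite /from; lia.
Qed.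

End Standard.

(** Below the diagonal the coefficient is read off the transposed matrix. The position of [v]
    decides; [w] may lie on either side. *)
Definition omega (rho : nat -> nat -> rat) (v w : nat * nat) : rat :=
  if (v.1 <= v.2)%N then toral rho v w - (overlap v w)%:R
  else toral (dual_rho rho) (v.2, v.1) (w.2, w.1)
       - (overlap (v.2, v.1) (w.2, w.1))%:R.

Lemma log_canonical_fm rho al be M (v w : nat * nat) :
  sklyanin charF br n rho al be false false M ->
  inr v.1 -> inr v.2 -> inr w.1 -> inr w.2 ->
  lc (omega rho v w) (fm M v.1 v.2) (fm M w.1 w.2).
Proof.
case: v w => [a b] [i j] /= MP ha hb hi hj; rewrite /omega /=.
case: leqP => ab; first exact: (log_canonical_upper MP).
rewrite -(fm_tr M b a) -(fm_tr M j i).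
by apply: (log_canonical_upper (sklyanin_tr MP)) => //; exact: ltnW.
Qed.

End InitialMinors.

(** * Removing the exotic terms *)

Section Steps.

Variables (F : fieldType) (n : nat).
Local Notation fsize := (fsize n).
Implicit Types M : nat -> nat -> F.

(** Index sets of the neighbouring minors: [lastup] gives the right and down arrows, [firstdn] the
    left and up arrows. *)
Definition lastup m (i : nat) : 'I_m -> nat :=
  fun t => if t.+1 == m then (i + m)%N else (i + t)%N.
Definition firstdn m (i : nat) : 'I_m -> nat :=
  fun t => if val t == 0%N then i.-1 else (i + t)%N.

Definition stepL M (b : nat) (u : F) : nat -> nat -> F :=
  fun i j => M i j - (i == b)%:R * u * M i.+1 j.
Definition stepR M (a : nat) (s : F) : nat -> nat -> F :=
  fun i j => M i j - (j == a)%:R * s * M i j.+1.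

Lemma stepR_tr M a s : stepR M a s = transpose (stepL (transpose M) a s).
Proof. by []. Qed.

Lemma stepL_row M b u j : stepL M b u b j = M b j - u * M b.+1 j.
Proof. by rewrite /stepL eqxx mul1r. Qed.

Lemma mnr_stepL_none M b u m (r c : 'I_m -> nat) :
  (forall t, r t != b) -> mnr (stepL M b u) r c = mnr M r c.
Proof.
by move=> H; apply: eq_mnr => a d; rewrite /stepL (negPf (H a)) !mul0r subr0.
Qed.

Lemma mnr_stepL_in M b u m (r c : 'I_m -> nat) t0 :
  (forall t, r t = b -> t = t0) -> r t0 = b ->
  mnr (stepL M b u) r c = mnr M r c - u * mnr M (upd r t0 b.+1) c.
Proof.
move=> H rt0; have E M' : mnr M' r c = mnr M' (upd r t0 (r t0)) c.
  by apply: eq_mnr => a d; rewrite upd_id.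
rewrite (E (stepL _ _ _)) [in RHS](E M) !mnr_expand_row mulr_sumr -sumrB.
apply: eq_bigr => j _; rewrite rt0 stepL_row.
suff -> : cofactor (minor_mx (stepL M b u) r c) t0 j
          = cofactor (minor_mx M r c) t0 j by ring.
rewrite /cofactor; congr (_ * \det _); apply/matrixP => p q; rewrite !mxE /stepL.
case: eqP => [/H/eqP|_]; first by rewrite eq_sym (negPf (neq_lift _ _)).
by rewrite !mul0r subr0.
Qed.

(** A set of consecutive rows that contains [b] and does not end there contains [b+1], so adding a
    multiple of row [b+1] has no effect. Only a minor with last row [b] sees the step. *)
Lemma mnr_stepL_from M b u m i (c : 'I_m -> nat) : (0 < m)%N ->
  mnr (stepL M b u) (from i) c
  = mnr M (from i) c - (i + m == b.+1)%:R * u * mnr M (lastup i) c.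
Proof.
move=> m0; case: eqP => E.
  have tP : (m.-1 < m)%N by lia.
  rewrite (mnr_stepL_in _ _ _ (t0 := Ordinal tP)); last first.
  - by rewrite /from /=; lia.
  - by move=> t; rewrite /from => ?; apply: ord_inj => /=; lia.
  rewrite mul1r; congr (_ - _ * _); apply: eq_mnr => t d; congr (M _ _).
  rewrite /upd /lastup -val_eqE /=.
  by case: eqP => h; case: eqP => h'; rewrite /from; lia.
rewrite !mul0r subr0; have [bi|bi] := boolP ((i <= b) && (b < i + m))%N; last first.
  by rewrite mnr_stepL_none // => t; case: t => t /= ht; rewrite /from /=; lia.
have tP : (b - i < m)%N by lia.
have t1P : (b.+1 - i < m)%N by lia.
rewrite (mnr_stepL_in _ _ _ (t0 := Ordinal tP)); last first.
- by rewrite /from /=; lia.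
- by move=> t; rewrite /from => ?; apply: ord_inj => /=; lia.
have -> : b.+1 = from i (Ordinal t1P) by rewrite /from /=; lia.
by rewrite mnr_upd_row0 ?mulr0 ?subr0 // -val_eqE /=; lia.
Qed.

(** The hypotheses exclude the cases where row [b] occurs without row [b+1]. It follows that a step
    leaves the ratio defining it unchanged, which makes the change of coordinates invertible. *)
Lemma mnr_stepL_firstdn M b u m i (c : 'I_m -> nat) : (0 < i)%N ->
  b != i.-1 -> (i + m != b.+1)%N ->
  mnr (stepL M b u) (firstdn i) c = mnr M (firstdn i) c.
Proof.
move=> i0 bi im.
have [bm|bm] := boolP ((i < b) && (b < i + m))%N; last first.
  by rewrite mnr_stepL_none // => t; case: t => t /= ht;
     rewrite /firstdn /=; case: ifP; lia.
have tP : (b - i < m)%N by lia.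
have t1P : (b.+1 - i < m)%N by lia.
rewrite (mnr_stepL_in _ _ _ (t0 := Ordinal tP)); last first.
- by rewrite /firstdn /=; case: ifP; lia.
- by move=> t; rewrite /firstdn; case: ifP => h ?; apply: ord_inj => /=; lia.
have -> : b.+1 = firstdn i (Ordinal t1P).
  by rewrite /firstdn /=; case: ifP; lia.
by rewrite mnr_upd_row0 ?mulr0 ?subr0 // -val_eqE /=; lia.
Qed.

Lemma stepLK M b u : stepL (stepL M b u) b (- u) = M.
Proof.
apply/funext => i; apply/funext => j; rewrite /stepL.
have [->|_] := eqVneq i b; last by rewrite !mul0r !subr0.
by rewrite (gtn_eqF (ltnSn b)) !mul0r !mul1r; ring.
Qed.

End Steps.

(** * Removing the exotic term of the right translations *)

Section StepBracket.

Variables (F : fieldType) (charF : [pchar F] =i pred0).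
Variables (br : F -> F -> F) (brP : biderivation br) (n : nat).
Local Notation q_ := (ratF charF).
Local Notation fsize := (fsize n).
Local Notation fmn := (fm n).
Local Notation inr := (fun i : nat => 0 < i <= n)%N.

Variables (rho : nat -> nat -> rat) (c0 : rat) (al be : nat) (tL : bool).
Hypothesis rho_sym : forall j l, inr j -> inr l ->
  rho j l + rho l j = (j == l)%:R + c0.
Hypothesis rho_bd : forall l, inr l ->
  rho be l - rho be.+1 l + rho l al - rho l al.+1 = 0.
Hypotheses (hal : (0 < al < n)%N) (hbe : (0 < be < n)%N) (albe : al != be).
Hypothesis tLn : tL -> be.*2 != n.

Variables (M : nat -> nat -> F).
Hypothesis MP : sklyanin charF br n rho al be true tL M.

Lemma bracket_mnr1 m (r c : 'I_m -> nat) k l :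
  (forall i, inr (r i)) -> (forall i, inr (c i)) -> inr k -> inr l ->
  br (mnr M r c) (M k l) =
    q_ (\sum_j rho (c j) l - \sum_i rho (r i) k) * (mnr M r c * M k l)
    + \sum_j (c j < l)%N%:R * (mnr M r (upd c j l) * M k (c j))
    - \sum_i (k < r i)%N%:R * (mnr M (upd r i k) c * M (r i) l)
    + (\sum_j ((c j == al) && (l == be.+1))%:R * (mnr M r (upd c j al.+1) * M k be)
       - \sum_j ((c j == be.+1) && (l == al))%:R * (mnr M r (upd c j be) * M k al.+1))
    - tL%:R * (\sum_i ((r i == al.+1) && (k == be))%:R *
                 (mnr M (upd r i al) c * M be.+1 l)
             - \sum_i ((r i == be) && (k == al.+1))%:R *
                 (mnr M (upd r i be.+1) c * M al l)).
Proof.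
move=> hr hc hk hl.
have M1 (i j : 'I_1 -> nat) : mnr M i j = M (i ord0) (j ord0).
  by rewrite /mnr det_mx11 mxE.
have -> : M k l = mnr M (fun _ : 'I_1 => k) (fun _ : 'I_1 => l) by rewrite M1.
rewrite (bracket_mnr brP MP) // mul1r M1.
have S1 (f : nat -> nat -> rat) (u : 'I_m -> nat) x :
  \sum_i \sum_(t < 1) f (u i) x = \sum_i f (u i) x.
  by apply: eq_bigr => i _; rewrite big_ord1.
rewrite !S1.
by congr (_ + _ - _ + (_ - _) - _ * (_ - _)); apply: eq_bigr => i _;
  rewrite big_ord1 M1 /upd.
Qed.

Let m := fsize 1 be.+1.
Let mE : m = (n - be)%N. Proof. by rewrite /m /fsize; lia. Qed.
Let m0 : (0 < m)%N. Proof. by rewrite mE; lia. Qed.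

(* The columns of the minor are those of f_{1,be+1} or of its left neighbour. *)
Let top_rows (c : 'I_m -> nat) k l :
  (forall i, inr (c i)) -> inr k -> inr l ->
  br (mnr M (from 1) c) (M k l) =
    q_ (\sum_j rho (c j) l - \sum_i rho (from (m := m) 1 i) k)
      * (mnr M (from 1) c * M k l)
    + \sum_j (c j < l)%N%:R * (mnr M (from 1) (upd c j l) * M k (c j))
    + (\sum_j ((c j == al) && (l == be.+1))%:R * (mnr M (from 1) (upd c j al.+1) * M k be)
       - \sum_j ((c j == be.+1) && (l == al))%:R * (mnr M (from 1) (upd c j be) * M k al.+1)).
Proof.
move=> hc hk hl; rewrite bracket_mnr1 //; last first.
  by move=> i; case: i => i hi; rewrite /from /=; lia.
set L1 := (X in _ - X + _ - _); set L2 := tL%:R * _.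
(* An index smaller than one of the rows [1, ..., n - be] is again such a row. The left exotic term
   exchanges [al+1] for [al] or [be] for [be+1]; the second could leave the interval only if [be]
   were its last row, which [tLn] excludes. *)
suff [-> ->] : L1 = 0 /\ L2 = 0 by rewrite !subr0.
split; first rewrite /L1.
  rewrite big1 // => i _; case: ltnP => h; last by rewrite mul0r.
  have tP : (k.-1 < m)%N by move: h; case: i => i hi; rewrite /from /=; lia.
  rewrite (_ : k = from 1 (Ordinal tP)); last by rewrite /from /=; lia.
  rewrite mnr_upd_row0 ?mul0r ?mulr0 // -val_eqE /=.
  by move: h; rewrite /from; lia.
rewrite /L2; case: (tL) tLn => [/(_ isT) tn|_]; last by rewrite mul0r.
rewrite big1 ?sub0r => [|i _]; last first.
  case: eqP => h; last by rewrite mul0r.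
  have tP : (al.-1 < m)%N by move: h; case: i => i hi; rewrite /from /=; lia.
  rewrite (_ : al = from 1 (Ordinal tP)); last by rewrite /from /=; lia.
  rewrite mnr_upd_row0 ?mul0r ?mulr0 // -val_eqE /=.
  by move: h; rewrite /from; lia.
rewrite big1 ?oppr0 ?mulr0 // => i _.
case: eqP => h; last by rewrite mul0r.
have tP : (be < m)%N by move: h; case: i => i hi; rewrite /from /=; lia.
rewrite (_ : be.+1 = from 1 (Ordinal tP)); last by rewrite /from /=; lia.
rewrite mnr_upd_row0 ?mul0r ?mulr0 // -val_eqE /=.
by move: h; rewrite /from; lia.
Qed.

Let Delta := fmn M 1 be.+1.
Let Delta' := mnr M (from (m := m) 1) (firstdn be.+1).

(** Besides the Cartan part, only the exotic exchange of column [be+1] for [be] leaves distinct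
    columns; it produces [Delta']. *)
Let bracket_Delta k l : inr k -> inr l ->
  br Delta (M k l) =
    q_ (\sum_(j < m) rho (from be.+1 j) l - \sum_i rho (from (m := m) 1 i) k)
      * (Delta * M k l)
    - (l == al)%:R * (Delta' * M k al.+1).
Proof.
move=> hk hl; rewrite /Delta /fm top_rows //; last first.
  by move=> i; case: i => i hi; rewrite /from /=; lia.
rewrite [X in _ + X + _]big1 => [|j _]; last first.
  case: ltnP => h; last by rewrite mul0r.
  have tP : (l - be.+1 < m)%N by move: h; case: j => j hj; rewrite /from /=; lia.
  rewrite (_ : l = from be.+1 (Ordinal tP)); last by move: h; rewrite /from /=; lia.
  rewrite mnr_upd_col0 ?mul0r ?mulr0 // -val_eqE /=.
  by move: h; case: j => j hj; rewrite /from /=; lia.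
rewrite [X in _ + (X - _)]big1 => [|j _]; last first.
  case: eqP => h; last by rewrite mul0r.
  have tP : (al - be < m)%N by move: h; case: j => j hj; rewrite /from /=; lia.
  rewrite (_ : al.+1 = from be.+1 (Ordinal tP)); last by move: h; rewrite /from /=; lia.
  rewrite mnr_upd_col0 ?mul0r ?mulr0 // -val_eqE /=.
  by move: h; case: j => j hj; rewrite /from /=; lia.
rewrite addr0 sub0r; congr (_ - _).
rewrite (bigD1 (Ordinal m0)) //= [X in _ + X]big1 => [|j]; last first.
  rewrite -val_eqE /= => h; rewrite (_ : _ && _ = false) ?mul0r //.
  by move: h; case: j => j hj /= h; rewrite /from /=; lia.
by rewrite addr0 /from addn0 eqxx.
Qed.

(** The columns of [Delta'] have a gap at [be+1]. A triangular exchange survives only if it puts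
    this column in the place of [be], which restores [Delta]. *)
Let bracket_Delta' k l : inr k -> inr l ->
  br Delta' (M k l) =
    q_ (\sum_(j < m) rho (firstdn be.+1 j) l - \sum_i rho (from (m := m) 1 i) k)
      * (Delta' * M k l)
    + (l == be.+1)%:R * (Delta * M k be).
Proof.
move=> hk hl; rewrite /Delta' top_rows //; last first.
  by move=> i; case: i => i hi; rewrite /firstdn /=; case: ifP; lia.
rewrite -addrA; congr (_ + _).
rewrite [X in _ + (X - _)]big1 => [|j _]; last first.
  case: eqP => h; last by rewrite mul0r.
  have tP : (al - be < m)%N.
    by move: h; case: j => j hj; rewrite /firstdn /=; case: ifP; lia.
  rewrite (_ : al.+1 = firstdn be.+1 (Ordinal tP)); last first.
    by move: h; rewrite /firstdn /=; do 2!case: ifP; lia.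
  rewrite mnr_upd_col0 ?mul0r ?mulr0 // -val_eqE /=.
  by move: h; case: j => j hj; rewrite /firstdn /=; case: ifP; lia.
rewrite [X in _ + (_ - X)]big1 => [|j _]; last first.
  rewrite (_ : _ && _ = false) ?mul0r //.
  by case: j => j hj; rewrite /firstdn /=; case: ifP; lia.
rewrite subrr addr0 (bigD1 (Ordinal m0)) //= [X in _ + X]big1 => [|j]; last first.
  rewrite -val_eqE /= => j0; case: ltnP => h; last by rewrite mul0r.
  have tP : (l - be.+1 < m)%N.
    by move: h; case: j j0 => j hj /=; rewrite /firstdn /=; case: ifP; lia.
  rewrite (_ : l = firstdn be.+1 (Ordinal tP)); last first.
    by move: h; rewrite /firstdn /=; do 2!case: ifP; lia.
  rewrite mnr_upd_col0 ?mul0r ?mulr0 // -val_eqE /=.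
  by move: h; case: j j0 => j hj /=; rewrite /firstdn /=; case: ifP; lia.
rewrite addr0 {1 3}/firstdn /=.
have [->|lb] := eqVneq l be.+1.
  rewrite ltnSn; congr (_ * (_ * _)).
  apply: eq_mnr => a b; congr (M _ _); rewrite /upd /firstdn /from -val_eqE /=.
  by case: eqP => // ->; rewrite addn0.
rewrite mul0r; case: ltnP => h; last by rewrite mul0r.
have tP : (l - be.+1 < m)%N by lia.
rewrite (_ : l = firstdn be.+1 (Ordinal tP)); last first.
  by rewrite /firstdn /=; case: ifP; lia.
by rewrite mnr_upd_col0 ?mul0r ?mulr0 // -val_eqE /=; lia.
Qed.

Hypothesis Delta0 : Delta != 0.
Let s := Delta' / Delta.

(** [Delta] and [Delta'] have the same rows and differ in one column, so the Cartan part of the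
    quotient is the difference of the weights of columns [be] and [be+1]. *)
Let bracket_s k l : inr k -> inr l ->
  br s (M k l) = (l == be.+1)%:R * M k be
    + (q_ (rho be l) - q_ (rho be.+1 l)) * (s * M k l)
    + (l == al)%:R * (s ^+ 2 * M k al.+1).
Proof.
move=> hk hl.
have E : s * br Delta (M k l) + Delta * br s (M k l) = br Delta' (M k l).
  by rewrite -(brMl brP) /s mulfVK.
have D' : Delta' = s * Delta by rewrite /s mulfVK.
apply: (mulfI Delta0); rewrite -[LHS](addKr (s * br Delta (M k l))) E.
rewrite bracket_Delta // bracket_Delta' // D'.
have <- : q_ (\sum_(j < m) rho (firstdn be.+1 j) l
             - \sum_(j < m) rho (from be.+1 j) l) = q_ (rho be l) - q_ (rho be.+1 l).
  rewrite -rmorphB; congr (q_ _).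
  rewrite [X in X - _](bigD1 (Ordinal m0)) // [X in _ - X](bigD1 (Ordinal m0)) //=.
  rewrite {1}/firstdn {1}/from /= addn0.
  rewrite (eq_bigr (fun j => rho (from be.+1 j) l)) => [|j]; first by ring.
  by rewrite /firstdn /from -val_eqE /= => /negPf ->.
by rewrite !rmorphB /=; ring.
Qed.

(** Only column [al] changes. The term of [bracket_s] at [l = be+1] cancels the exotic term,
    [rho_bd] matches the Cartan weights, and the quadratic terms in [s] cancel when both entries lie
    in column [al]. *)
Lemma sklyanin_step : sklyanin charF br n rho al be false tL (stepR M al s).
Proof.
have brB x y z : br (x - y) z = br x z - br y z by rewrite (brDl brP) (brNl brP).
have brBr x y z : br z (x - y) = br z x - br z y.
  by rewrite (brC brP) brB opprB -(brC brP y) (brC brP x) opprK addrC.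
(* From here on [s] enters only through its brackets with the entries. *)
have brE := bracket_s; move: (s) brE => t brE.
have brtt : br t t = 0.
  have /eqP := brC brP t t; rewrite -addr_eq0 -mulr2n -mulr_natl mulf_eq0.
  by rewrite (natr_char0 charF) /= => /eqP.
have bd l : inr l -> q_ (rho l al.+1) = q_ (rho be l) - q_ (rho be.+1 l) + q_ (rho l al).
  by move=> hl; rewrite -rmorphB -rmorphD /=; congr (q_ _);
     apply/esym/eqP; rewrite -subr_eq0 rho_bd.
have bdC l : inr l -> q_ (rho al.+1 l)
    = (al.+1 == l)%:R + q_ c0 - (q_ (rho be l) - q_ (rho be.+1 l) + q_ (rho l al)).
  move=> hl; rewrite -bd // -[_%:R](rmorph_nat q_) -rmorphD -rmorphB /=; congr (q_ _).
  by apply/eqP; rewrite eq_sym subr_eq rho_sym //; lia.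
have symC l : inr l -> l != al -> q_ (rho al l) = q_ c0 - q_ (rho l al).
  move=> hl la; rewrite -rmorphB /=; congr (q_ _).
  apply/eqP; rewrite eq_sym subr_eq rho_sym //; last by lia.
  by rewrite [al == l]eq_sym (negPf la) add0r.
have ial : inr al by lia.
have ial1 : inr al.+1 by lia.
have symD1 : rho al.+1 al.+1 = rho al al.
  have := rho_sym ial ial; have := rho_sym ial1 ial1; rewrite !eqxx.
  by move=> <- /eqP; rewrite -!mulr2n eqrMn2r // => /eqP.
have symD : q_ c0 = q_ (rho al al) + q_ (rho al al) - 1.
  by rewrite -rmorphD rho_sym // eqxx -(rmorph1 q_) -rmorphB addrAC subrr add0r.
move=> i j k l hi hj hk hl; rewrite /stepR mul0r addr0.
have [ja|ja] := eqVneq j al; have [la|la] := eqVneq l al.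
- rewrite ja la in hj hl *; rewrite !mul1r.
  rewrite !(brBr, brB, brMr brP, brMl brP) !(brC brP (M _ _) t) brtt.
  rewrite !brE // !MP // symD1 (bdC _ ial) (bd _ ial) symD.
  rewrite !eqxx !ltnn !ltnSn [(al.+1 < al)%N]ltnNge leqnSn eqSS (negPf albe).
  rewrite (gtn_eqF (ltnSn al)) ?andbF ?andbT /=.
  by rewrite !mul0r !mul1r; ring.
- rewrite ja in hj *; rewrite !mul0r !subr0 !mul1r.
  rewrite brB (brMl brP) brE // !MP // (bdC _ hl) (symC _ hl la).
  rewrite (negPf la) !eqxx eqSS (negPf albe) ?andbF ?andbT /=.
  rewrite (gtn_eqF (ltnSn al)) /= !mul0r.
  have [->|l1] := eqVneq al.+1 l; last by rewrite [(al.+1 < l)%N]ltn_neqAle l1 /=; ring.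
  by rewrite ltnn leqnn /=; ring.
- rewrite la in hl *; rewrite !mul0r !subr0 !mul1r.
  rewrite brBr (brMr brP) (brC brP (M i j) t) brE // !MP // (bd _ hj).
  rewrite [(j < al.+1)%N]ltnS [(j <= al)%N]leq_eqVlt !(negPf ja) /= !eqxx.
  rewrite (gtn_eqF (ltnSn al)) ?andbF ?andbT /=.
  by ring.
- by rewrite !mul0r !subr0 MP // (negPf ja) (negPf la) !andbF /= !mul0r subr0 mulr0 addr0.
Qed.

End StepBracket.

(** * The initial cluster *)

Section InitialCluster.

Variables (F : fieldType) (n : nat).
Local Notation fsz := (fsize n).
Local Notation fm := (fm n).
Local Notation inr := (fun i : nat => 0 < i <= n)%N.
Implicit Types M Y : nat -> nat -> F.

Lemma mnr_stepR_from M a s m (r : 'I_m -> nat) j : (0 < m)%N ->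
  mnr (stepR M a s) r (from j)
  = mnr M r (from j) - (j + m == a.+1)%:R * s * mnr M r (lastup j).
Proof. by move=> m0; rewrite -!(mnr_tr M) -mnr_tr stepR_tr mnr_stepL_from. Qed.

Lemma mnr_stepR_firstdn M a s m (r : 'I_m -> nat) j : (0 < j)%N ->
  a != j.-1 -> (j + m != a.+1)%N ->
  mnr (stepR M a s) r (firstdn j) = mnr M r (firstdn j).
Proof. by move=> *; rewrite -!(mnr_tr M) -mnr_tr stepR_tr mnr_stepL_firstdn. Qed.

Definition fmR M i j := mnr M (from (m := fsz i j) i) (lastup j).
Definition fmL M i j := mnr M (from (m := fsz i j) i) (firstdn j).
Definition fmD M i j := mnr M (lastup (m := fsz i j) i) (from j).
Definition fmU M i j := mnr M (firstdn (m := fsz i j) i) (from j).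
Definition fmLD M i j := mnr M (lastup (m := fsz i j) i) (firstdn j).
Definition fmUR M i j := mnr M (firstdn (m := fsz i j) i) (lastup j).

Lemma fmR_tr M i j : fmR (transpose M) i j = fmD M j i.
Proof. by rewrite /fmR -[LHS]mnr_tr fsizeC. Qed.
Lemma fmL_tr M i j : fmL (transpose M) i j = fmU M j i.
Proof. by rewrite /fmL -[LHS]mnr_tr fsizeC. Qed.
Lemma fmD_tr M i j : fmD (transpose M) i j = fmR M j i.
Proof. by rewrite /fmD -[LHS]mnr_tr fsizeC. Qed.
Lemma fmU_tr M i j : fmU (transpose M) i j = fmL M j i.
Proof. by rewrite /fmU -[LHS]mnr_tr fsizeC. Qed.
Lemma fmLD_tr M i j : fmLD (transpose M) i j = fmUR M j i.
Proof. by rewrite /fmLD -[LHS]mnr_tr fsizeC. Qed.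
Lemma fmUR_tr M i j : fmUR (transpose M) i j = fmLD M j i.
Proof. by rewrite /fmUR -[LHS]mnr_tr fsizeC. Qed.

Definition theta_genM M al be k : F :=
  fm M (n + k - al) k * fm M 1 be.+1 - fmR M (n + k - al) k * fmL M 1 be.+1.
Definition psi_genM M al be m : F :=
  fm M m (n + m - be) * fm M al.+1 1 - fmD M m (n + m - be) * fmU M al.+1 1.
(** For [be = n/2], [psi_genM] at 1 and this function are [f_{al+1,1}] times the values of
    [f_{1,be+1}] and of its left neighbour after the left step. *)
Definition psi1_starM M al be : F :=
  fmL M 1 be.+1 * fm M al.+1 1 - fmLD M 1 be.+1 * fmU M al.+1 1.
Definition theta1_starM M al be : F :=
  fmU M al.+1 1 * fm M 1 be.+1 - fmUR M al.+1 1 * fmL M 1 be.+1.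
Definition thetaM M al be k : F :=
  if be.*2 == n then
    fm M (n + k - al) k * psi_genM M al be 1
    - fmR M (n + k - al) k * psi1_starM M al be
  else theta_genM M al be k.
Definition psiM M al be m : F :=
  if al.*2 == n then
    fm M m (n + m - be) * theta_genM M al be 1
    - fmD M m (n + m - be) * theta1_starM M al be
  else psi_genM M al be m.
Definition phiM M al be i j : F :=
  if (i + al == n + j)%N then thetaM M al be j
  else if (j + be == n + i)%N then psiM M al be i
  else fm M i j.

Definition f_tr_rules M := (fm_tr n M, fmR_tr M, fmL_tr M, fmD_tr M, fmU_tr M, fmLD_tr M, fmUR_tr M).

Lemma phiM_tr M al be i j : inr i -> inr j ->
  (al < n)%N -> (be < n)%N ->
  phiM (transpose M) be al j i = phiM M al be i j.
Proof.
move=> hi hj aln ben; have gE k : theta_genM (transpose M) be al k = psi_genM M al be k.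
  by rewrite /theta_genM !(f_tr_rules M).
have pE k : psi_genM (transpose M) be al k = theta_genM M al be k.
  by rewrite /psi_genM !(f_tr_rules M).
rewrite /phiM; case: eqP => h1; case: eqP => h2 //; first by lia.
- rewrite /thetaM /psiM; case: eqP => _; last exact: gE.
  by rewrite !(f_tr_rules M) pE /psi1_starM !(f_tr_rules M).
- rewrite /thetaM /psiM; case: eqP => _; last exact: pE.
  by rewrite !(f_tr_rules M) gE /theta1_starM !(f_tr_rules M).
exact: fm_tr.
Qed.

(* The exponents of f_{1,be+1} and of f_{al+1,1} in the initial cluster
   variable at (i, j), after the change of coordinates. *)
Definition exp1 (al be i j : nat) : nat :=
  (i + al == n + j) + (al.*2 == n) * (j + be == n + i).
Definition exp2 (al be i j : nat) : nat :=
  (j + be == n + i) + (be.*2 == n) * (i + al == n + j).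

Lemma fsize_gt0 i j : inr i -> inr j -> (0 < fsz i j)%N.
Proof. by rewrite /fsize; lia. Qed.

Lemma fm_stepL M b u i j : inr i -> inr j -> (b < n)%N ->
  fm (stepL M b u) i j = fm M i j - (j + b == n + i)%:R * u * fmD M i j.
Proof.
move=> hi hj bn; rewrite /fm mnr_stepL_from ?fsize_gt0 //.
by congr (_ - _%:R * _ * _); rewrite /fsize; lia.
Qed.

Lemma fm_stepR M a s i j : inr i -> inr j -> (a < n)%N ->
  fm (stepR M a s) i j = fm M i j - (i + a == n + j)%:R * s * fmR M i j.
Proof.
move=> hi hj an; rewrite /fm mnr_stepR_from ?fsize_gt0 //.
by congr (_ - _%:R * _ * _); rewrite /fsize; lia.
Qed.

Section Coordinates.

Variables (al be : nat).
Hypotheses (hal : (0 < al < n)%N) (hbe : (0 < be < n)%N) (albe : al != be).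
Hypothesis aln : al.*2 != n.

Definition coordU M : F := fmU M al.+1 1 / fm M al.+1 1.
Definition coordZ M := stepL M be (coordU M).
Definition coordS M : F := fmL M 1 be.+1 / fm M 1 be.+1.
(** Since [al != n/2], the last column [n - al] of [f_{al+1,1}] is not [al], so the right step keeps
    the denominator of [u]. *)
Definition coordY M := stepR (coordZ M) al (coordS (coordZ M)).

Let aln' : (al < n)%N. Proof. by case/andP: hal. Qed.
Let ben' : (be < n)%N. Proof. by case/andP: hbe. Qed.

(** The left step changes [f_ij] exactly when its last row is [be], the right step exactly when its
    last column is [al]. Clearing the denominators of [u] and [s] in the changed minors yields the
    functions psi and theta. *)
Lemma coordY_factor M i j : inr i -> inr j ->
  fm M al.+1 1 != 0 -> fm (coordZ M) 1 be.+1 != 0 ->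
  [/\ fm (coordY M) al.+1 1 = fm M al.+1 1,
      fm (coordY M) 1 be.+1 = fm (coordZ M) 1 be.+1
    & phiM M al be i j = fm (coordY M) i j
        * fm (coordY M) 1 be.+1 ^+ exp1 al be i j
        * fm (coordY M) al.+1 1 ^+ exp2 al be i j].
Proof.
move=> hi hj f20 f10.
have i1 : inr 1%N by lia.
have ia : inr al.+1 by lia.
have ib : inr be.+1 by lia.
have E2 : fm (coordY M) al.+1 1 = fm M al.+1 1.
  rewrite /coordY fm_stepR // fm_stepL //.
  rewrite (_ : (_ == _) = false); last by lia.
  rewrite (_ : (_ == _) = false); last by lia.
  by rewrite !mul0r !subr0.
have E1 : fm (coordY M) 1 be.+1 = fm (coordZ M) 1 be.+1.
  rewrite /coordY fm_stepR // (_ : (_ == _) = false); last by lia.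
  by rewrite !mul0r !subr0.
split=> //; rewrite E1 E2 /coordY fm_stepR // /exp1 /exp2 (negPf aln) mul0n addn0.
have uE : coordU M * fm M al.+1 1 = fmU M al.+1 1 by rewrite /coordU mulfVK.
have sE : coordS (coordZ M) * fm (coordZ M) 1 be.+1 = fmL (coordZ M) 1 be.+1.
  by rewrite /coordS mulfVK.
rewrite /phiM; case: eqP => hT.
  rewrite (_ : (j + be == n + i)%N = false) ?add0n ?muln1; last by lia.
  have -> : fm (coordZ M) i j = fm M i j.
    rewrite fm_stepL // (_ : (_ == _) = false); last by lia.
    by rewrite !mul0r !subr0.
  have -> : fmR (coordZ M) i j = fmR M i j.
    rewrite /fmR mnr_stepL_from ?fsize_gt0 // (_ : (_ == _) = false).
      by rewrite !mul0r !subr0.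
    by rewrite /fsize; lia.
  rewrite mul1r expr1 mulrBl mulrAC sE /thetaM.
  have -> : (n + j - al = i)%N by lia.
  have fLE : fmL (coordZ M) 1 be.+1
             = fmL M 1 be.+1 - (be.*2 == n)%:R * coordU M * fmLD M 1 be.+1.
    rewrite /fmL mnr_stepL_from ?fsize_gt0 //.
    by congr (_ - _%:R * _ * _); rewrite /fsize; lia.
  have fZE : fm (coordZ M) 1 be.+1
             = fm M 1 be.+1 - (be.*2 == n)%:R * coordU M * fmD M 1 be.+1.
    by rewrite fm_stepL //; congr (_ - _%:R * _ * _); lia.
  rewrite fLE fZE; case: eqP => hb.
    rewrite expr1 /psi_genM /psi1_starM -uE.
    have -> : (n + 1 - be = be.+1)%N by lia.
    by rewrite !mul1r; ring.
  rewrite expr0 /theta_genM (_ : (n + j - al = i)%N); last by lia.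
  by rewrite !(mul0r, subr0, mulr1) [fmR _ _ _ * _]mulrC.
rewrite mul0r mul0r subr0 muln0 addn0 expr0 mulr1.
case: eqP => hP.
  rewrite expr1 /psiM (negPf aln) /psi_genM (_ : (n + i - be = j)%N); last by lia.
  rewrite fm_stepL // (_ : (_ == _) = true); last by lia.
  by rewrite -uE mul1r; ring.
rewrite fm_stepL // (_ : (_ == _) = false); last by lia.
by rewrite !mul0r subr0 expr0 mulr1.
Qed.

(** The steps are undone in reverse order, with ratios computed from [Y] and then from [Z], which
    the steps do not alter. The determinant is recorded for the sake of SL_n. *)
Lemma coordY_onto Y : fm Y al.+1 1 != 0 -> fm Y 1 be.+1 != 0 ->
  exists M, [/\ coordY M = Y, fm M al.+1 1 != 0, fm (coordZ M) 1 be.+1 != 0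
              & fm M 1 1 = fm Y 1 1].
Proof.
move=> f20 f10.
have i1 : inr 1%N by lia.
have ia : inr al.+1 by lia.
have ib : inr be.+1 by lia.
pose s := coordS Y; pose Z := stepR Y al (- s).
pose u := coordU Z; pose M := stepL Z be (- u).
have Z1 : fm Z 1 be.+1 = fm Y 1 be.+1.
  rewrite fm_stepR // (_ : (_ == _) = false) ?mul0r ?subr0 //; first by lia.
have Z2 : fm Z al.+1 1 = fm Y al.+1 1.
  rewrite fm_stepR // (_ : (_ == _) = false) ?mul0r ?subr0 //; first by lia.
have M2 : fm M al.+1 1 = fm Z al.+1 1.
  rewrite fm_stepL // (_ : (_ == _) = false) ?mul0r ?subr0 //; first by lia.
have uE : coordU M = u.
  rewrite /coordU M2 /u /coordU; congr (_ / _).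
  by rewrite /fmU mnr_stepL_firstdn //; rewrite /fsize; lia.
have ZE : coordZ M = Z by rewrite /coordZ uE -[u in stepL _ _ u]opprK stepLK.
have sE : coordS Z = s.
  rewrite /coordS Z1 /s /coordS; congr (_ / _).
  by rewrite /fmL mnr_stepR_firstdn //; rewrite /fsize; lia.
exists M; split.
- rewrite /coordY ZE sE /Z !stepR_tr -[s in stepL _ _ s]opprK.
  have -> : transpose (transpose (stepL (transpose Y) al (- s)))
            = stepL (transpose Y) al (- s) by [].
  by rewrite stepLK.
- by rewrite M2 Z2.
- by rewrite ZE Z1.
rewrite fm_stepL // fm_stepR //.
rewrite (_ : (_ == _) = false); last by lia.
rewrite (_ : (_ == _) = false); last by lia.
by rewrite !mul0r !subr0.
Qed.

End Coordinates.

Lemma phiM_neq0_exists al be Y :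
  (0 < al < n)%N -> (0 < be < n)%N -> al != be ->
  (forall i j, inr i -> inr j -> fm Y i j != 0) ->
  exists M, fm M 1 1 = fm Y 1 1 /\
    forall i j, inr i -> inr j -> phiM M al be i j != 0.
Proof.
move=> hal hbe ab Y0.
have i1 : inr 1%N by lia.
have ia : inr al.+1 by lia.
have ib : inr be.+1 by lia.
have [aln|aln] := eqVneq al.*2 n; last first.
  have [M [YE f2 f1 M11]] := coordY_onto hal hbe ab aln (Y0 _ _ ia i1) (Y0 _ _ i1 ib).
  exists M; split=> // i j hi hj.
  have [_ _ ->] := coordY_factor hal hbe ab aln hi hj f2 f1.
  by rewrite YE !mulf_neq0 ?expf_neq0 ?Y0.
have ben : be.*2 != n by lia.
have Yt i j : inr i -> inr j -> fm (transpose Y) i j != 0.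
  by move=> hi hj; rewrite fm_tr Y0.
have ba : be != al by rewrite eq_sym.
have [M [YE f2 f1 M11]] := coordY_onto hbe hal ba ben (Yt _ _ ib i1) (Yt _ _ i1 ia).
exists (transpose M); split=> [|i j hi hj]; first by rewrite fm_tr M11 fm_tr.
rewrite -phiM_tr //; try by lia.
have -> : transpose (transpose M) = M by [].
have [_ _ ->] := coordY_factor hbe hal ba ben hj hi f2 f1.
by rewrite YE !mulf_neq0 ?expf_neq0 ?Yt.
Qed.

End InitialCluster.

(** * Coordinates in which the bracket has no exotic terms *)

Section StandardCoordinates.

Variables (F : fieldType) (charF : [pchar F] =i pred0).
Variables (br : F -> F -> F) (brP : biderivation br) (n : nat).
Local Notation inr := (fun i : nat => 0 < i <= n)%N.
Local Notation fm := (fm n).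

(* The Belavin-Drinfeld conditions for the data al |-> be. *)
Definition bd_cartan (rho : nat -> nat -> rat) (al be : nat) : Prop :=
  (exists c0, forall j l, inr j -> inr l -> rho j l + rho l j = (j == l)%:R + c0)
  /\ (forall l, inr l -> rho be l - rho be.+1 l + rho l al - rho l al.+1 = 0).

Lemma bd_cartan_dual rho al be : (0 < al < n)%N -> (0 < be < n)%N ->
  bd_cartan rho al be -> bd_cartan (dual_rho rho) be al.
Proof.
move=> hal hbe [[c0 sym] bd]; split.
  exists (- c0) => j l hj hl; rewrite /dual_rho (eq_sym l j).
  by have := sym j l hj hl; move: (rho l j) => x /(canRL (addKr _)) ->; ring.
move=> l hl; rewrite /dual_rho.
have S j : inr j -> rho j l = (l == j)%:R + c0 - rho l j.
  by move=> hj; rewrite -sym // addrAC subrr add0r.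
have := bd l hl; rewrite (S al) ?(S al.+1) ?(S be) ?(S be.+1); try by lia.
rewrite !(eq_sym _ l) => e; rewrite -[RHS]e; ring.
Qed.

Lemma dual_rhoK rho : dual_rho (dual_rho rho) = rho.
Proof. by apply/funext => i; apply/funext => j; rewrite /dual_rho; ring. Qed.

Let standard_noncentral rho al be M :
  (0 < al < n)%N -> (0 < be < n)%N -> al != be -> al.*2 != n ->
  bd_cartan rho al be -> sklyanin charF br n rho al be true true M ->
  (forall i j, inr i -> inr j -> phiM n M al be i j != 0) ->
  exists Y, sklyanin charF br n rho al be false false Y /\
    forall i j, inr i -> inr j -> phiM n M al be i j = fm Y i j
        * fm Y 1 be.+1 ^+ exp1 n al be i j * fm Y al.+1 1 ^+ exp2 n al be i j.
Proof.
move=> hal hbe ab aln bd MP phi0.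
have i1 : inr 1%N by lia.
have ia : inr al.+1 by lia.
have ib : inr be.+1 by lia.
have f20 : fm M al.+1 1 != 0.
  by have := phi0 _ _ ia i1; rewrite /phiM !ifF //; lia.
pose u := coordU n al M; pose Z := coordZ n al be M.
(* For [be = n/2] the cluster function [psi_1] equals [f_{al+1,1}(M) f_{1,be+1}(Z)]; otherwise the
   left step does not change [f_{1,be+1}]. *)
have f10 : fm Z 1 be.+1 != 0.
  apply: contraNneq (phi0 _ _ i1 ib) => Z0; apply/eqP.
  have ZE : fm Z 1 be.+1 = fm M 1 be.+1
      - (be.+1 + be == n + 1)%:R * coordU n al M * fmD n M 1 be.+1.
    by rewrite /Z /coordZ fm_stepL //; case/andP: hbe.
  rewrite /phiM (_ : (_ == _) = false); last by lia.
  move: ZE; rewrite Z0; case: eqP => h ZE; last by rewrite ZE mul0r mul0r subr0.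
  rewrite /psiM (negPf aln) /psi_genM (_ : (n + 1 - be = be.+1)%N); last by lia.
  have -> : fmU n M al.+1 1 = coordU n al M * fm M al.+1 1 by rewrite /coordU mulfVK.
  move: ZE; rewrite mul1r => /eqP; rewrite eq_sym subr_eq add0r => /eqP ->.
  by ring.
exists (coordY n al be M); split; last first.
  by move=> i j hi hj; have [-> -> ->] := coordY_factor hal hbe ab aln hi hj f20 f10.
(* The left step is a right step for the transposed matrix. The other exotic term is still present,
   so [al != n/2] serves as the condition [tLn]. *)
have ZP : sklyanin charF br n rho al be true false Z.
  have [[c0 sym'] bd'] := bd_cartan_dual hal hbe bd.
  have := sklyanin_step brP sym' bd' hbe hal _ (fun _ => aln) (sklyanin_tr MP).
  rewrite -/(fm (transpose M) 1 al.+1) fm_tr => /(_ _ f20).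
  rewrite eq_sym => /(_ ab) /sklyanin_tr; rewrite dual_rhoK.
  congr (sklyanin _ _ _ _ _ _ _ _ _).
  rewrite stepR_tr /Z /coordZ /coordU.
  by rewrite -(fmL_tr n M) /fmL.
have [[c0 sym'] bd'] := bd.
by apply: (sklyanin_step brP sym' bd' hal hbe ab _ ZP).
Qed.

Lemma standard_coordinates rho al be M :
  (0 < al < n)%N -> (0 < be < n)%N -> al != be ->
  bd_cartan rho al be -> sklyanin charF br n rho al be true true M ->
  (forall i j, inr i -> inr j -> phiM n M al be i j != 0) ->
  exists Y, sklyanin charF br n rho al be false false Y /\
    forall i j, inr i -> inr j -> phiM n M al be i j = fm Y i j
        * fm Y 1 be.+1 ^+ exp1 n al be i j * fm Y al.+1 1 ^+ exp2 n al be i j.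
Proof.
move=> hal hbe ab bd MP phi0.
have [aln|aln] := eqVneq al.*2 n; last exact: standard_noncentral.
have ben : be.*2 != n by lia.
have ba : be != al by rewrite eq_sym.
have [|Y [YP E]] := standard_noncentral hbe hal ba ben (bd_cartan_dual hal hbe bd)
  (sklyanin_tr MP).
  by move=> i j hi hj; rewrite phiM_tr ?phi0 //; lia.
exists (transpose Y); split.
  by have := sklyanin_tr YP; rewrite dual_rhoK.
move=> i j hi hj; rewrite -phiM_tr //; try by lia.
by rewrite E // !(fm_tr n Y) mulrAC.
Qed.

End StandardCoordinates.

(** * Compatibility with the quiver *)

Lemma overlap_le n a b i j : (j <= b)%N ->
  overlap n (a, b) (i, j) = minn (a + j - (i + b)) (n.+1 - b).
Proof. by move=> jb; rewrite /overlap /= jb. Qed.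

Lemma overlap_gt n a b i j : (b < j)%N ->
  overlap n (a, b) (i, j) = minn (a - i) (n.+1 - j).
Proof. by move=> bj; rewrite /overlap /= leqNgt bj. Qed.

Lemma overlap_eq0 n a b i j : (a <= b)%N -> (a <= i)%N || (j <= i)%N ->
  (a + j <= i + b)%N -> overlap n (a, b) (i, j) = 0%N.
Proof. by move=> ab h1 h2; rewrite /overlap /=; case: leqP; lia. Qed.

Lemma minn_hexagon x L : (0 < x)%N -> (0 < L)%N -> forall a,
  (minn (a - x) L.+1 + minn (a - x.-1) L + minn (a - x.+1) L.-1
   = minn (a - x) L.-1 + minn (a - x.+1) L + minn (a - x.-1) L.+1)%N.
Proof. by move=> x0 L0 a; case: (leqP a x) => ?; lia. Qed.

(** [overlap] is piecewise linear in [(i, j)], and its bends cancel in the hexagon sum except at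
    [(a, b)] itself. *)
Lemma overlap_hexagon n a b i j : (b <= n)%N -> (0 < i)%N -> (1 < j <= n)%N ->
  (overlap n (a, b) (i, j.-1) + overlap n (a, b) (i.-1, j)
     + overlap n (a, b) (i.+1, j.+1)
   = overlap n (a, b) (i, j.+1) + overlap n (a, b) (i.+1, j)
     + overlap n (a, b) (i.-1, j.-1) + ((a == i) && (b == j)))%N.
Proof.
move=> bn hi hj.
have [jb|ne] := eqVneq b j.
  rewrite -jb in hj *.
  rewrite ![overlap n _ (_, b.+1)]overlap_gt // !overlap_le ?leq_pred // andbT.
  have -> : (a + b.-1 - (i + b) = a - i.+1)%N by lia.
  have -> : (a + b - (i.-1 + b) = a - i.-1)%N by lia.
  have -> : (a + b - (i.+1 + b) = a - i.+1)%N by lia.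
  have -> : (a + b.-1 - (i.-1 + b) = a - i)%N by lia.
  have -> : (n.+1 - b = (n.+1 - b.+1).+1)%N by lia.
  by case: (ltngtP a i) => ?; lia.
have [jb|bj] := leqP j b.
  have [p1 p2] : (j.-1 <= b)%N /\ (j.+1 <= b)%N by lia.
  rewrite !overlap_le //.
  have -> : (a + j.-1 - (i + b) = a + j - (i.+1 + b))%N by lia.
  have -> : (a + j - (i.-1 + b) = a + j.+1 - (i + b))%N by lia.
  have -> : (a + j.+1 - (i.+1 + b) = a + j.-1 - (i.-1 + b))%N by lia.
  by rewrite andbF ?addn0; ring.
rewrite andbF addn0 [overlap n _ (i, j.+1)]overlap_gt 1?ltnW //.
rewrite [overlap n _ (i.-1, j)]overlap_gt // [overlap n _ (i.+1, j)]overlap_gt //.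
rewrite [overlap n _ (i.+1, j.+1)]overlap_gt 1?ltnW //.
have K : (0 < n.+1 - j)%N by lia.
have [jb1|jb1] := ltnP b j.-1.
  rewrite !overlap_gt //.
  have -> : (n.+1 - j.-1 = (n.+1 - j).+1)%N by lia.
  have -> : (n.+1 - j.+1 = (n.+1 - j).-1)%N by lia.
  exact: minn_hexagon.
rewrite !overlap_le //.
have -> : (n.+1 - b = (n.+1 - j).+1)%N by lia.
have -> : (n.+1 - j.+1 = (n.+1 - j).-1)%N by lia.
have -> : (a + j.-1 - (i + b) = a - i)%N by lia.
have -> : (a + j.-1 - (i.-1 + b) = a - i.-1)%N by lia.
exact: minn_hexagon.
Qed.

(** At [(1, be+1)] the hexagon is cut off by the border and continued in the last row. The defect
    [b == be+1] is what the Cartan part contributes in [corner_upper]. *)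
Lemma overlap_corner n a b al be : (0 < a <= b)%N -> (b <= n)%N ->
  (0 < al < n)%N -> (0 < be < n)%N ->
  (overlap n (a, b) (2, be.+1) + overlap n (a, b) (n, al)
     + overlap n (a, b) (1, be.+1) + ((a == 1) && (b == be.+1))
   = overlap n (a, b) (2, be.+2) + overlap n (a, b) (1, be)
     + overlap n (a, b) (n, al.+1) + (b == be.+1))%N.
Proof.
move=> ab bn hal hbe.
rewrite ![overlap n _ (n, _)]overlap_eq0 ?addn0; try lia.
have [jb|ne] := eqVneq b be.+1.
  rewrite jb in ab bn *.
  rewrite [overlap n _ (_, be.+2)]overlap_gt // !overlap_le // andbT.
  have -> : (a + be - (1 + be.+1) = a - 2)%N by lia.
  have -> : (a + be.+1 - (2 + be.+1) = a - 2)%N by lia.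
  have -> : (a + be.+1 - (1 + be.+1) = a - 1)%N by lia.
  have -> : (n.+1 - be.+1 = (n.+1 - be.+2).+1)%N by lia.
  by lia.
have [jb|bj] := leqP be.+1 b.
  have [p1 p2] : (be <= b)%N /\ (be.+2 <= b)%N by lia.
  rewrite !overlap_le //.
  have -> : (a + be.+1 - (2 + b) = a + be - (1 + b))%N by lia.
  have -> : (a + be.+2 - (2 + b) = a + be.+1 - (1 + b))%N by lia.
  by rewrite andbF ?addn0; ring.
rewrite andbF !addn0 ![overlap n _ (_, be.+1)]overlap_gt //.
rewrite [overlap n _ (_, be.+2)]overlap_gt 1?ltnW //.
have K : (0 < n.+1 - be.+1)%N by lia.
have -> : (n.+1 - be.+2 = (n.+1 - be.+1).-1)%N by lia.
have [jb1|jb1] := ltnP b be.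
  rewrite !overlap_gt //.
  have -> : (n.+1 - be = (n.+1 - be.+1).+1)%N by lia.
  by move: (n.+1 - be.+1)%N K => L; lia.
have -> : b = be by lia.
rewrite overlap_le //.
have -> : (a + be - (1 + be) = a - 1)%N by lia.
have -> : (n.+1 - be = (n.+1 - be.+1).+1)%N by lia.
by move: (n.+1 - be.+1)%N K => L; lia.
Qed.

Lemma overlap_corner_tr n a b al be : (0 < a <= b)%N -> (b <= n)%N ->
  (0 < al < n)%N -> (0 < be < n)%N ->
  (overlap n (a, b) (al.+1, 2) + overlap n (a, b) (be, n)
     + overlap n (a, b) (al.+1, 1)
   = overlap n (a, b) (al.+2, 2) + overlap n (a, b) (al, 1)
     + overlap n (a, b) (be.+1, n) + (a == be.+1))%N.
Proof.
move=> ab bn hal hbe.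
have z1 k : (k <= 2)%N -> overlap n (a, b) (al.+1, k) = 0%N.
  by move=> k2; rewrite /overlap /=; case: leqP; lia.
have z2 : overlap n (a, b) (al.+2, 2) = 0%N by rewrite /overlap /=; case: leqP; lia.
have z3 : overlap n (a, b) (al, 1) = 0%N by rewrite /overlap /=; case: leqP; lia.
have e k : overlap n (a, b) (k, n) = minn (a - k) 1.
  by rewrite /overlap /=; case: leqP => h; lia.
by rewrite !z1 // z2 z3 !e !add0n addn0; case: (ltngtP a be.+1); lia.
Qed.

Section Hexagons.

Variable n : nat.
Local Notation inr := (fun i : nat => 0 < i <= n)%N.
Local Notation fsz := (fsize n).

Definition hexagon (G : nat -> nat -> rat) i j : rat :=
  G i j.+1 + G i.+1 j + G i.-1 j.-1 - G i j.-1 - G i.-1 j - G i.+1 j.+1.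

(* The exchange relation at (1, be+1), in terms of the functions f_ij. *)
Definition corner (G : nat -> nat -> rat) al be : rat :=
  G 2 be.+1 - G 2 be.+2 + G n al - G 1%N be - G n al.+1 + G 1%N be.+1.

Lemma sum_from m j (h : nat -> rat) :
  \sum_(t < m) h (j + t)%N = \sum_(d < j + m) h d - \sum_(d < j) h d.
Proof. by rewrite big_split_ord /= [RHS]addrC addKr. Qed.

Section Upper.

Variables (rho : nat -> nat -> rat) (a b : nat).
Hypotheses (ha : inr a) (hb : inr b) (ab : (a <= b)%N).

Let W i j : rat := toral n rho (a, b) (i, j) - (overlap n (a, b) (i, j))%:R.
Let m := fsz a b.
(** With these partial sums [toral] depends only on the endpoints of the column and row intervals of
    [f_ij]. *)
Let C k : rat := \sum_(d < k) \sum_(s < m) rho (b + s)%N d.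
Let R k : rat := \sum_(d < k) \sum_(s < m) rho (a + s)%N d.

Let toralE i j : toral n rho (a, b) (i, j)
  = C (j + fsz i j) - C j - (R (i + fsz i j) - R i).
Proof.
rewrite /toral /=; congr (_ - _); rewrite exchange_big /=.
  exact: (sum_from _ _ (fun d => \sum_(s < m) rho (b + s)%N d)).
exact: (sum_from _ _ (fun d => \sum_(s < m) rho (a + s)%N d)).
Qed.

Let CS k : C k.+1 = C k + \sum_(s < m) rho (b + s)%N k.
Proof. by rewrite /C big_ord_recr. Qed.
Let RS k : R k.+1 = R k + \sum_(s < m) rho (a + s)%N k.
Proof. by rewrite /R big_ord_recr. Qed.

Lemma hexagon_upper i j : (1 < i <= n)%N -> (1 < j <= n)%N ->
  hexagon W i j = ((a == i) && (b == j))%:R.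
Proof.
move=> hi hj.
(* The endpoints of the six intervals agree in pairs of opposite sign, so the Cartan part drops out
   of the hexagon. *)
have E1 : (j.+1 + fsz i j.+1 = j + fsz i.-1 j)%N by rewrite /fsize; lia.
have E2 : (j + fsz i.+1 j = j.-1 + fsz i j.-1)%N by rewrite /fsize; lia.
have E3 : (j.-1 + fsz i.-1 j.-1 = j.+1 + fsz i.+1 j.+1)%N by rewrite /fsize; lia.
have E4 : (i + fsz i j.+1 = i.-1 + fsz i.-1 j)%N by rewrite /fsize; lia.
have E5 : (i.+1 + fsz i.+1 j = i + fsz i j.-1)%N by rewrite /fsize; lia.
have E6 : (i.-1 + fsz i.-1 j.-1 = i.+1 + fsz i.+1 j.+1)%N by rewrite /fsize; lia.
have bn : (b <= n)%N by case/andP: hb.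
have i0 : (0 < i)%N by case/andP: hi => /ltnW.
have ovE := overlap_hexagon a bn i0 hj.
rewrite /hexagon /W !toralE E1 E2 E3 E4 E5 E6.
move/(congr1 (fun k : nat => k%:R : rat)): ovE; rewrite !natrD => e.
lra.
Qed.

Variables (al be : nat).
Hypotheses (hal : (0 < al < n)%N) (hbe : (0 < be < n)%N) (albe : al != be).
Hypothesis bd : bd_cartan n rho al be.

Let bd_sum x : inr x -> rho x al - rho x al.+1 + rho x be.+1 - rho x be
  = (x == be.+1)%:R - (x == be)%:R.
Proof.
move=> hx; have [[c0 sym] bd'] := bd.
have s1 : rho x be = (x == be)%:R + c0 - rho be x.
  by rewrite -sym ?addrK //; lia.
have s2 : rho x be.+1 = (x == be.+1)%:R + c0 - rho be.+1 x.
  by rewrite -sym ?addrK //; lia.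
by rewrite s1 s2 -[RHS]addr0 -(bd' x hx); ring.
Qed.

Let sum_delta k c :
  \sum_(s < k) ((c + s)%N == be.+1)%:R - \sum_(s < k) ((c + s)%N == be)%:R
  = ((c == be.+1) && (0 < k)%N)%:R - (((c + k)%N == be.+1) && (0 < k)%N)%:R :> rat.
Proof.
elim: k => [|k IH]; first by rewrite !big_ord0 !andbF.
rewrite !big_ord_recr /= !andbT opprD addrACA IH.
case: (posnP k) => [->|k0].
  by rewrite !andbF !addn0 addn1 eqSS subr0 add0r.
by rewrite !andbT addnS eqSS; ring.
Qed.

Let bd_sums c : (forall s : 'I_m, inr (c + s)%N) ->
  \sum_(s < m) rho (c + s)%N al - \sum_(s < m) rho (c + s)%N al.+1
  + \sum_(s < m) rho (c + s)%N be.+1 - \sum_(s < m) rho (c + s)%N be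
  = (c == be.+1)%:R - ((c + m)%N == be.+1)%:R.
Proof.
move=> hc; rewrite -!(sumrB, big_split) /=.
rewrite (eq_bigr (fun s : 'I_m => ((c + s)%N == be.+1)%:R - ((c + s)%N == be)%:R)).
  have m0 : (0 < m)%N by rewrite /m /fsize; lia.
  by rewrite sumrB sum_delta m0 !andbT.
by move=> s _; exact: bd_sum.
Qed.

Lemma corner_upper : corner W al be = ((a == 1%N) && (b == be.+1))%:R.
Proof.
have mE : m = (n.+1 - b)%N by rewrite /m /fsize; lia.
have hb' : (0 < a <= b)%N by rewrite ab; case/andP: ha => ->.
have bn : (b <= n)%N by case/andP: hb.
have ovE := overlap_corner hb' bn hal hbe.
rewrite /corner /W !toralE.
have [e1 e2 e3] : [/\ (be.+1 + fsz 2 be.+1 = n.+1)%N, (be.+2 + fsz 2 be.+2 = n.+1)%N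
    & (al + fsz n al = al.+1)%N] by rewrite /fsize; split; lia.
have [e4 e5 e6] : [/\ (be + fsz 1 be = n.+1)%N, (al.+1 + fsz n al.+1 = al.+2)%N
    & (be.+1 + fsz 1 be.+1 = n.+1)%N] by rewrite /fsize; split; lia.
have [e7 e8 e9] : [/\ (2 + fsz 2 be.+1 = (n - be).+2)%N, (2 + fsz 2 be.+2 = (n - be).+1)%N
    & (n + fsz n al = n.+1)%N] by rewrite /fsize; split; lia.
have [e10 e11 e12] : [/\ (1 + fsz 1 be = (n - be).+2)%N, (n + fsz n al.+1 = n.+1)%N
    & (1 + fsz 1 be.+1 = (n - be).+1)%N] by rewrite /fsize; split; lia.
rewrite e1 e2 e3 e4 e5 e6 e7 e8 e9 e10 e11 e12 !CS.
have hc (s : 'I_m) : inr (b + s)%N by case: s => s /=; lia.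
have := bd_sums hc; rewrite (_ : (b + m == be.+1)%N = false); last by lia.
rewrite /= => e.
move/(congr1 (fun k : nat => k%:R : rat)): ovE; rewrite !natrD => e'.
lra.
Qed.

(** The Cartan sum now runs over the rows of [f_ab]. Its contribution from the first row cancels the
    defect of [overlap_corner_tr]; the one from the last row remains, and is nonzero exactly on the
    diagonal of the functions psi. *)
Lemma corner_upper_tr : corner (fun j i => W i j) be al = - ((b + be)%N == (n + a)%N)%:R.
Proof.
have mE : m = (n.+1 - b)%N by rewrite /m /fsize; lia.
have hb' : (0 < a <= b)%N by rewrite ab; case/andP: ha => ->.
have bn : (b <= n)%N by case/andP: hb.
have ovE := overlap_corner_tr hb' bn hal hbe.
rewrite /corner /W !toralE.
have [e1 e2 e3] : [/\ (al.+1 + fsz al.+1 2 = n.+1)%N, (al.+2 + fsz al.+2 2 = n.+1)%N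
    & (be + fsz be n = be.+1)%N] by rewrite /fsize; split; lia.
have [e4 e5 e6] : [/\ (al + fsz al 1 = n.+1)%N, (be.+1 + fsz be.+1 n = be.+2)%N
    & (al.+1 + fsz al.+1 1 = n.+1)%N] by rewrite /fsize; split; lia.
have [e7 e8 e9] : [/\ (2 + fsz al.+1 2 = (n - al).+2)%N, (2 + fsz al.+2 2 = (n - al).+1)%N
    & (n + fsz be n = n.+1)%N] by rewrite /fsize; split; lia.
have [e10 e11 e12] : [/\ (1 + fsz al 1 = (n - al).+2)%N, (n + fsz be.+1 n = n.+1)%N
    & (1 + fsz al.+1 1 = (n - al).+1)%N] by rewrite /fsize; split; lia.
rewrite e1 e2 e3 e4 e5 e6 e7 e8 e9 e10 e11 e12 !RS.
have hc (s : 'I_m) : inr (a + s)%N by case: s => s /=; lia.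
have := bd_sums hc; rewrite (_ : (a + m == be.+1)%N = (b + be == n + a)%N); last by lia.
rewrite /= => e.
move/(congr1 (fun k : nat => k%:R : rat)): ovE; rewrite !natrD => e'.
lra.
Qed.

End Upper.

End Hexagons.

(** * Arrow sums in the quiver *)

Section QuiverSums.

Variable n : nat.
Local Notation inr := (fun i : nat => 0 < i <= n)%N.
Variables (al be : nat).
Hypotheses (hal : (0 < al < n)%N) (hbe : (0 < be < n)%N) (albe : al != be).

Section Omega.

Variables (rho : nat -> nat -> rat) (a b : nat).
Hypotheses (ha : inr a) (hb : inr b).
Let W i j : rat := omega n rho (a, b) (i, j).

Let W_lower : (b < a)%N -> W = (fun i j =>
  toral n (dual_rho rho) (b, a) (j, i) - (overlap n (b, a) (j, i))%:R).
Proof.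
by move=> ba; apply/funext => i; apply/funext => j; rewrite /W /omega /= leqNgt ba.
Qed.

Let W_upper : (a <= b)%N -> W = (fun i j =>
  toral n rho (a, b) (i, j) - (overlap n (a, b) (i, j))%:R).
Proof.
by move=> ab; apply/funext => i; apply/funext => j; rewrite /W /omega /= ab.
Qed.

Lemma hexagon_omega i j : (1 < i <= n)%N -> (1 < j <= n)%N ->
  hexagon W i j = ((a == i) && (b == j))%:R.
Proof.
move=> hi hj; have [ab|ba] := leqP a b.
  by rewrite W_upper // hexagon_upper.
rewrite W_lower // andbC -(hexagon_upper (dual_rho rho) hb ha (ltnW ba)) //.
rewrite /hexagon; ring.
Qed.

Hypothesis bd : bd_cartan n rho al be.

Lemma corner_omega : corner n W al be
  = ((a == 1%N) && (b == be.+1))%:R - ((a + al)%N == (n + b)%N)%:R.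
Proof.
have [ab|ba] := leqP a b.
  rewrite W_upper // (corner_upper ha hb ab hal hbe albe bd).
  by rewrite (_ : (a + al == n + b)%N = false) ?subr0 //; lia.
have ba' : be != al by rewrite eq_sym.
rewrite W_lower // (_ : (_ && _) = false) ?sub0r; last by lia.
exact: (corner_upper_tr hb ha (ltnW ba) hbe hal ba' (bd_cartan_dual hal hbe bd)).
Qed.

Lemma corner_omega_tr : corner n (fun j i => W i j) be al
  = ((a == al.+1) && (b == 1%N))%:R - ((b + be)%N == (n + a)%N)%:R.
Proof.
have [ab|ba] := leqP a b.
  rewrite W_upper // (corner_upper_tr ha hb ab hal hbe albe bd).
  by rewrite (_ : (_ && _) = false) ?sub0r //; lia.
have ba' : be != al by rewrite eq_sym.
rewrite W_lower // (_ : (b + be == n + a)%N = false) ?subr0; last by lia.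
by rewrite andbC -(corner_upper hb ha (ltnW ba) hbe hal ba' (bd_cartan_dual hal hbe bd)).
Qed.

(** Minors starting outside the grid are empty. Hence the hexagon identity also covers the last row
    and column, where some neighbours are missing. *)
Lemma omega_out i j : (n < i)%N || (n < j)%N -> W i j = 0.
Proof.
move=> hij.
have f0 x y : (n < x)%N || (n < y)%N -> fsize n x y = 0%N by rewrite /fsize; lia.
have tor r v w : (n < w.1)%N || (n < w.2)%N -> toral n r v w = 0.
  move=> h; rewrite /toral (f0 w.1 w.2) //.
  by rewrite !big1 ?subrr // => s _; rewrite big_ord0.
have ov x y k l : inr x -> inr y -> (x <= y)%N -> (n < k)%N || (n < l)%N ->
    overlap n (x, y) (k, l) = 0%N.
  move=> hx hy xy hkl; rewrite /overlap /=; case: leqP; lia.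
have [ab|ba] := leqP a b.
  by rewrite W_upper // tor // ov.
have hji : (n < j)%N || (n < i)%N by rewrite orbC.
by rewrite W_lower // tor // ov // ltnW.
Qed.

End Omega.

Local Notation V := ('I_n * 'I_n)%type.
Implicit Types G : nat -> nat -> rat.

Definition inside G i j : rat := if inr i && inr j then G i j else 0.

Definition arrow_sum (p : nat * nat) G : rat :=
  \sum_(q : V) (b_entry n al be p (vpos q))%:~R * G (vpos q).1 (vpos q).2.

Lemma sum_vertex c G :
  \sum_(q : V) (vpos q == c)%:R * G (vpos q).1 (vpos q).2 = inside G c.1 c.2.
Proof.
rewrite /inside; case: ifP => h.
  have [c1 c2] : (c.1.-1 < n)%N /\ (c.2.-1 < n)%N by lia.
  have cE : vpos (Ordinal c1, Ordinal c2) = c.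
    by rewrite /vpos /=; case: c h c1 c2 => x y /= h c1 c2; congr pair; lia.
  rewrite (bigD1 (Ordinal c1, Ordinal c2)) // cE eqxx mul1r big1 => [|q /andP[_ qc]].
    by rewrite [LHS]addr0.
  case: eqP => [qE|_]; last by rewrite mul0r.
  case/eqP: qc; case: q qE => x y qE.
  have [e1 e2] : x.+1 = c.1 /\ y.+1 = c.2 by rewrite -qE.
  by congr pair; apply: ord_inj; rewrite /= -?e1 -?e2.
rewrite big1 // => q _; case: eqP => [qE|_]; last by rewrite mul0r.
case: q qE h => x y <- /=.
by rewrite !ltn_ord.
Qed.

(** The predecessors are truncated, but no vertex has a coordinate 0, so no arrow is added. *)
Lemma grid_arrowE (p q : nat * nat) : (0 < p.1)%N -> (0 < p.2)%N ->
  (0 < q.1)%N -> (0 < q.2)%N ->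
  (grid_arrow p q : nat) = (~~ (border p && border q) *
    ((q == (p.1, p.2.+1)) + (q == (p.1.+1, p.2)) + (q == (p.1.-1, p.2.-1))))%N.
Proof.
case: p q => i j [k l] /= i0 j0 k0 l0; rewrite /grid_arrow.
case: (border _ && _); first by rewrite andbF.
rewrite andbT mul1n.
have -> : ((i, j) == (k.+1, l.+1)) = ((k, l) == (i.-1, j.-1)).
  by rewrite !xpair_eqE; lia.
case: eqP => [[-> ->]|_] /=; first by rewrite !xpair_eqE /=; lia.
case: eqP => [[-> ->]|_] /=; first by rewrite !xpair_eqE /=; lia.
by [].
Qed.

Lemma grid_arrowE_in (p q : nat * nat) : (0 < p.1)%N -> (0 < p.2)%N ->
  (0 < q.1)%N -> (0 < q.2)%N ->
  (grid_arrow q p : nat) = (~~ (border p && border q) *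
    ((q == (p.1, p.2.-1)) + (q == (p.1.-1, p.2)) + (q == (p.1.+1, p.2.+1))))%N.
Proof.
move=> p1 p2 q1 q2; rewrite grid_arrowE // andbC.
case: p q p1 p2 q1 q2 => i j [k l] /= p1 p2 q1 q2; congr (_ * (_ + _ + _))%N;
  rewrite !xpair_eqE; lia.
Qed.

Lemma arrow_sumE (p : nat * nat) G : (0 < p.1)%N -> (0 < p.2)%N ->
  let g c := (~~ (border p && border c))%:R * inside G c.1 c.2 in
  arrow_sum p G =
    g (p.1, p.2.+1) + g (p.1.+1, p.2) + g (p.1.-1, p.2.-1)
    - g (p.1, p.2.-1) - g (p.1.-1, p.2) - g (p.1.+1, p.2.+1)
    + \sum_(e <- extra_arrows n al be)
        ((p == e.1)%:R * inside G e.2.1 e.2.2 - (p == e.2)%:R * inside G e.1.1 e.1.2).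
Proof.
move=> p1 p2 g.
have gE c : g c = \sum_(q : V) (~~ (border p && border (vpos q)))%:R
                  * (vpos q == c)%:R * G (vpos q).1 (vpos q).2.
  rewrite /g -sum_vertex mulr_sumr; apply: eq_bigr => q _.
  by rewrite mulrA; case: eqP => [->|_] //; rewrite !mulr0.
have extraE : \sum_(e <- extra_arrows n al be)
    ((p == e.1)%:R * inside G e.2.1 e.2.2 - (p == e.2)%:R * inside G e.1.1 e.1.2)
   = \sum_(q : V) ((count_mem (p, vpos q) (extra_arrows n al be))%:R
       - (count_mem (vpos q, p) (extra_arrows n al be))%:R) * G (vpos q).1 (vpos q).2.
  move: (extra_arrows n al be) => s.
  transitivity (\sum_(e <- s) \sum_(q : V)
      (((p == e.1) && (vpos q == e.2))%:R - ((p == e.2) && (vpos q == e.1))%:R)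
      * G (vpos q).1 (vpos q).2).
    apply: eq_bigr => e _; rewrite -!sum_vertex !mulr_sumr -sumrB.
    by apply: eq_bigr => q _; rewrite -!mulnb !natrM; ring.
  rewrite exchange_big /=; apply: eq_bigr => q _.
  rewrite -mulr_suml; congr (_ * _); rewrite -!sum1_count !natr_sum.
  rewrite [X in _ = X - _]big_mkcond [X in _ = _ - X]big_mkcond -sumrB.
  apply: eq_bigr => -[e1 e2] _ /=; rewrite !xpair_eqE !(eq_sym _ p) !(eq_sym _ (vpos q)).
  by rewrite [(vpos q == e1) && _]andbC; do 2!case: (_ && _).
rewrite extraE !gE -!(sumrB, big_split) /arrow_sum; apply: eq_bigr => q _ /=.
rewrite /b_entry /arrows rmorphB /= -!pmulrn !natrD.
rewrite grid_arrowE // grid_arrowE_in // !natrM !natrD.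
by ring.
Qed.

Hypothesis n3 : (2 < n)%N.

Lemma arrow_sum_interior i j G : (1 < i <= n)%N -> (1 < j <= n)%N ->
  arrow_sum (i, j) G = hexagon (inside G) i j
    + (((i == n) && (j == al.+1))%:R - ((i == n) && (j == al))%:R) * G 1%N be.+1
    + (((i == be.+1) && (j == n))%:R - ((i == be) && (j == n))%:R) * G al.+1 1%N.
Proof.
move=> hi hj; rewrite arrow_sumE /=; try by lia.
have -> : border (i, j) = false by rewrite /border /=; lia.
rewrite /= !mul1r /hexagon; rewrite -!addrA; do 6!congr (_ + _).
rewrite /extra_arrows !big_cons big_nil /= !xpair_eqE.
rewrite (_ : (j == 1%N) = false); last by lia.
rewrite (_ : (i == 1%N) = false); last by lia.
rewrite !andbF /= /inside.
have -> : inr 1%N by lia.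
have -> : inr be.+1 by lia.
have -> : inr al.+1 by lia.
by rewrite /=; ring.
Qed.

Lemma arrow_sum_corner G :
  arrow_sum (1%N, be.+1) G = inside G 2 be.+1 - inside G 2 be.+2
    + inside G n al - inside G 1 be - inside G n al.+1.
Proof.
rewrite arrow_sumE //= /border /=.
rewrite /extra_arrows !big_cons big_nil /= !xpair_eqE !eqxx /=.
rewrite (_ : (1 == al)%N && _ = false); last by lia.
rewrite (_ : (1 == al.+1)%N && _ = false); last by lia.
rewrite (_ : (1 == n)%N = false); last by lia.
rewrite (_ : (1 == be.+1)%N && _ = false); last by lia.
rewrite (_ : (1 == be)%N && _ = false); last by lia.
rewrite (_ : (be.+1 == be) = false); last by lia.
rewrite /= ?andbF ?andbT.
rewrite (_ : (be.+1 == 1)%N = false) /=; last by lia.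
have z k : inside G 0 k = 0 by [].
by rewrite !z; ring.
Qed.

Lemma arrow_sum_corner_tr G :
  arrow_sum (al.+1, 1%N) G = inside G al.+1 2 - inside G al.+2 2
    + inside G be n - inside G al 1 - inside G be.+1 n.
Proof.
rewrite arrow_sumE //= /border /= !andbT.
rewrite /extra_arrows !big_cons big_nil /= !xpair_eqE !eqxx /=.
rewrite (_ : (al.+1 == al) = false); last by lia.
rewrite (_ : (al.+1 == 1)%N = false); last by lia.
rewrite (_ : (al.+1 == n) && (1 == al.+1)%N = false); last by lia.
rewrite (_ : (al.+1 == n) && (1 == al)%N = false); last by lia.
rewrite (_ : (1 == n)%N = false); last by lia.
rewrite /= ?andbF ?andbT /=.
have z k : inside G k 0 = 0 by rewrite /inside andbF.
by rewrite !z orbT /=; ring.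
Qed.

Local Notation T i j := (((i + al)%N == (n + j)%N) : nat).
Local Notation P i j := (((j + be)%N == (n + i)%N) : nat).

Definition onT i j : rat := (T i j)%:R.
Definition onP i j : rat := (P i j)%:R.

Lemma insideTE x y :
  inside onT x y = ([&& inr x, inr y & (x + al == n + y)%N] : nat)%:R.
Proof.
by rewrite /inside /onT; case: (0 < x <= n)%N; case: (0 < y <= n)%N.
Qed.

Lemma insidePE x y :
  inside onP x y = ([&& inr x, inr y & (y + be == n + x)%N] : nat)%:R.
Proof.
by rewrite /inside /onP; case: (0 < x <= n)%N; case: (0 < y <= n)%N.
Qed.

(** The indicator of a diagonal cancels in the hexagon sum except near its end in the last row;
    there the remainder is opposite to the arrows joining [(n, al)] and [(n, al+1)] with
    [(1, be+1)]. *)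
Lemma hexagon_T i j : (1 < i <= n)%N -> (1 < j <= n)%N ->
  hexagon (inside onT) i j
  = ((i == n) && (j == al))%:R - ((i == n) && (j == al.+1))%:R.
Proof.
move=> hi hj; have gE := insideTE.
have E1 : inside onT i j.+1 = inside onT i.-1 j by rewrite !gE; congr (_%:R); lia.
have E2 : inside onT i j.-1 = inside onT i.+1 j + ((i == n) && (j == al.+1))%:R.
  by rewrite !gE -natrD; congr (_%:R); lia.
have E3 : inside onT i.-1 j.-1 = inside onT i.+1 j.+1 + ((i == n) && (j == al))%:R.
  by rewrite !gE -natrD; congr (_%:R); lia.
by rewrite /hexagon E1 E2 E3; ring.
Qed.

Lemma hexagon_P i j : (1 < i <= n)%N -> (1 < j <= n)%N ->
  hexagon (inside onP) i j
  = ((i == be) && (j == n))%:R - ((i == be.+1) && (j == n))%:R.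
Proof.
move=> hi hj; have gE := insidePE.
have E1 : inside onP i.+1 j = inside onP i j.-1 by rewrite !gE; congr (_%:R); lia.
have E2 : inside onP i.-1 j = inside onP i j.+1 + ((i == be.+1) && (j == n))%:R.
  by rewrite !gE -natrD; congr (_%:R); lia.
have E3 : inside onP i.-1 j.-1 = inside onP i.+1 j.+1 + ((i == be) && (j == n))%:R.
  by rewrite !gE -natrD; congr (_%:R); lia.
by rewrite /hexagon E1 E2 E3; ring.
Qed.

(* The passage from the brackets of the f_ij to those of the initial cluster
   variables f_ij f_{1,be+1}^exp1 f_{al+1,1}^exp2. *)
Definition twist G i j : rat :=
  G i j + (exp1 n al be i j)%:R * G 1%N be.+1 + (exp2 n al be i j)%:R * G al.+1 1%N.

Lemma twistE G i j : twist G i j = G i j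
  + ((T i j)%:R + (al.*2 == n)%:R * (P i j)%:R) * G 1%N be.+1
  + ((P i j)%:R + (be.*2 == n)%:R * (T i j)%:R) * G al.+1 1%N.
Proof. by rewrite /twist /exp1 /exp2 !natrD !natrM. Qed.

Lemma inside_twist G i j : inside (twist G) i j = inside G i j
  + (inside onT i j
     + (al.*2 == n)%:R * inside onP i j) * G 1%N be.+1
  + (inside onP i j
     + (be.*2 == n)%:R * inside onT i j) * G al.+1 1%N.
Proof. by rewrite /inside; case: ifP => _; rewrite ?twistE /onT /onP; ring. Qed.

Lemma central_exclusive : (al.*2 == n)%:R * (be.*2 == n)%:R = 0 :> rat.
Proof. by rewrite -natrM mulnb (_ : _ && _ = false) //; lia. Qed.

(** The vertex [(1, be+1)] lies on the diagonal of the functions psi exactly when [be = n/2]. *)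
Lemma twist_corner G : twist G 1%N be.+1 = G 1%N be.+1 + (be.*2 == n)%:R * G al.+1 1%N.
Proof.
rewrite twistE (_ : T 1 be.+1 = 0%N); last by lia.
rewrite (_ : P 1 be.+1 = (be.*2 == n)); last by lia.
by rewrite mulr0n central_exclusive; ring.
Qed.

Lemma twist_corner_tr G : twist G al.+1 1%N = G al.+1 1%N + (al.*2 == n)%:R * G 1%N be.+1.
Proof.
rewrite twistE (_ : P al.+1 1 = 0%N); last by lia.
rewrite (_ : T al.+1 1 = (al.*2 == n)); last by lia.
by rewrite mulr0n [_ * (al.*2 == n)%:R]mulrC central_exclusive; ring.
Qed.

Section Compatibility.

Variable rho : nat -> nat -> rat.
Hypothesis bd : bd_cartan n rho al be.

Let W (v : nat * nat) i j : rat := omega n rho v (i, j).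

(** Only the vertex summed over carries its monomial factor; [v] still stands for the plain minor
    [f_v]. The two correction terms disappear once [v] is twisted as well. *)
Lemma arrow_sum_omega (p v : nat * nat) :
  inr p.1 -> inr p.2 -> mutable al be p -> inr v.1 -> inr v.2 ->
  arrow_sum p (twist (W v)) = (v == p)%:R - (p == (1%N, be.+1))%:R * (T v.1 v.2)%:R
    - (p == (al.+1, 1%N))%:R * (P v.1 v.2)%:R.
Proof.
case: v p => a b [i j] /= hi hj mp ha hb.
have ins x y : (0 < x)%N -> (0 < y)%N -> inside (W (a, b)) x y = W (a, b) x y.
  move=> x0 y0; rewrite /inside; case: ifP => // h; rewrite /W omega_out //; lia.
have [bdr|] := boolP (border (i, j)); last first.
  rewrite /border /= => hij.
  have [i1 j1] : (1 < i <= n)%N /\ (1 < j <= n)%N by lia.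
  rewrite arrow_sum_interior // !twist_corner !twist_corner_tr.
  have -> : hexagon (inside (twist (W (a, b)))) i j
    = hexagon (W (a, b)) i j
    + (hexagon (inside onT) i j
       + (al.*2 == n)%:R * hexagon (inside onP) i j) * W (a, b) 1%N be.+1
    + (hexagon (inside onP) i j
       + (be.*2 == n)%:R * hexagon (inside onT) i j) * W (a, b) al.+1 1%N.
    rewrite /hexagon !inside_twist !ins; try by lia.
    by ring.
  rewrite hexagon_T // hexagon_P // hexagon_omega //.
  rewrite !xpair_eqE (_ : (i == 1%N) = false); last by lia.
  rewrite (_ : (j == 1%N) = false); last by lia.
  by rewrite andbF !mul0r !subr0; ring.
have : (i == al.+1) && (j == 1%N) || (i == 1%N) && (j == be.+1).
  by move: mp; rewrite /mutable bdr /= !inE !xpair_eqE.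
have ce := central_exclusive.
case/orP=> /andP[/eqP -> /eqP ->].
  have := corner_omega_tr ha hb bd; rewrite /corner -/(W (a, b)) => E.
  rewrite arrow_sum_corner_tr !inside_twist !ins //; try by lia.
  rewrite !insideTE !insidePE.
  have -> : [&& inr al.+1, inr 2 & (2 + be == n + al.+1)%N] = false by lia.
  have -> : [&& inr al.+2, inr 2 & (2 + be == n + al.+2)%N] = false by lia.
  have -> : [&& inr be, inr n & (n + be == n + be)%N] = true by lia.
  have -> : [&& inr al, inr 1 & (1 + be == n + al)%N] = false by lia.
  have -> : [&& inr be.+1, inr n & (n + be == n + be.+1)%N] = false by lia.
  have -> : [&& inr al.+1, inr 2 & (al.+1 + al == n + 2)%N] = (al + al == n + 1)%N by lia.
  have -> : [&& inr al.+2, inr 2 & (al.+2 + al == n + 2)%N] = (al.*2 == n) by lia.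
  have -> : [&& inr be, inr n & (be + al == n + n)%N] = false by lia.
  have -> : [&& inr al, inr 1 & (al + al == n + 1)%N] = (al + al == n + 1)%N by lia.
  have -> : [&& inr be.+1, inr n & (be.+1 + al == n + n)%N] = false by lia.
  rewrite !xpair_eqE !eqxx (_ : (al.+1 == 1)%N = false); last by lia.
  rewrite /= mul0r subr0 mul1r -E mulr1n !mulr0n.
  (* The remainder is a multiple of the product of the indicators of [al = n/2] and [be = n/2],
     which is 0 by [ce]. *)
  apply/eqP; rewrite -subr_eq0; apply/eqP.
  rewrite -[RHS](mulr0 (- W (a, b) al.+1 1%N)) -[in RHS]ce /W; ring.
have := corner_omega ha hb bd; rewrite /corner -/(W (a, b)) => E.
rewrite arrow_sum_corner !inside_twist !ins //; try by lia.
rewrite !insideTE !insidePE.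
have -> : [&& inr 2, inr be.+1 & (2 + al == n + be.+1)%N] = false by lia.
have -> : [&& inr 2, inr be.+2 & (2 + al == n + be.+2)%N] = false by lia.
have -> : [&& inr n, inr al & (n + al == n + al)%N] = true by lia.
have -> : [&& inr 1, inr be & (1 + al == n + be)%N] = false by lia.
have -> : [&& inr n, inr al.+1 & (n + al == n + al.+1)%N] = false by lia.
have -> : [&& inr 2, inr be.+1 & (be.+1 + be == n + 2)%N] = (be + be == n + 1)%N by lia.
have -> : [&& inr 2, inr be.+2 & (be.+2 + be == n + 2)%N] = (be.*2 == n) by lia.
have -> : [&& inr n, inr al & (al + be == n + n)%N] = false by lia.
have -> : [&& inr 1, inr be & (be + be == n + 1)%N] = (be + be == n + 1)%N by lia.
have -> : [&& inr n, inr al.+1 & (al.+1 + be == n + n)%N] = false by lia.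
rewrite !xpair_eqE !eqxx (_ : (be.+1 == 1)%N = false); last by lia.
rewrite /= andbF mul0r subr0 mul1r -E mulr1n !mulr0n.
apply/eqP; rewrite -subr_eq0; apply/eqP.
rewrite -[RHS](mulr0 (- W (a, b) 1%N be.+1)) -[in RHS]ce /W; ring.
Qed.

End Compatibility.

End QuiverSums.

(** * Compatibility of the initial seed *)

Section InitialSeedCompatible.

Variables (F : fieldType) (charF : [pchar F] =i pred0).
Variables (br : F -> F -> F) (brP : biderivation br) (n : nat).
Local Notation inr := (fun i : nat => 0 < i <= n)%N.
Local Notation lc := (log_br charF br).
Variables (al be : nat).
Hypotheses (n3 : (2 < n)%N) (hal : (0 < al < n)%N) (hbe : (0 < be < n)%N).
Hypothesis albe : al != be.

Lemma sum_twist (I : finType) (b : I -> rat) (X : I -> nat -> nat -> rat) i j :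
  \sum_q b q * twist n al be (X q) i j
  = twist n al be (fun x y => \sum_q b q * X q x y) i j.
Proof.
rewrite /twist [X in _ = _ + X + _]mulr_sumr [X in _ = _ + X]mulr_sumr -!big_split.
by apply: eq_bigr => q _ /=; ring.
Qed.

Lemma initial_seed_compatible rho (M : nat -> nat -> F) :
  bd_cartan n rho al be -> sklyanin charF br n rho al be true true M ->
  (forall i j, inr i -> inr j -> phiM n M al be i j != 0) ->
  compatible_seed charF br (-1)
    (@Seed F _ (@GL_mutable n al be)
      (fun v => phiM n M al be (vpos v).1 (vpos v).2)
      (fun p q => b_entry n al be (vpos (val p)) (vpos q))).
Proof.
move=> bd MP phi0.
have [Y [YP phiE]] := standard_coordinates brP hal hbe albe bd MP phi0.
have i1 : inr 1%N by lia.
have ia : inr al.+1 by lia.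
have ib : inr be.+1 by lia.
have vin (v : 'I_n * 'I_n) : inr (vpos v).1 /\ inr (vpos v).2.
  by case: v => x y; rewrite /vpos /=.
pose W v i j := omega n rho v (i, j).
(* The inner twist accounts for the monomial factors at [w], the outer one for those at [v], so
   [arrow_sum_omega] applies inside the outer twist. *)
pose TW v w : rat :=
  twist n al be (fun a b => twist n al be (W (a, b)) w.1 w.2) v.1 v.2.
have lcY v w : inr v.1 -> inr v.2 -> inr w.1 -> inr w.2 ->
    lc (W v w.1 w.2) (fm n Y v.1 v.2) (fm n Y w.1 w.2).
  by move=> v1 v2 w1 w2; have := log_canonical_fm brP YP v1 v2 w1 w2; case: w w1 w2.
have lcTW v w : inr v.1 -> inr v.2 -> inr w.1 -> inr w.2 ->
    lc (TW v w) (phiM n M al be v.1 v.2) (phiM n M al be w.1 w.2).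
  move=> v1 v2 w1 w2.
  have lcr x : inr x.1 -> inr x.2 ->
      lc (twist n al be (W x) w.1 w.2) (fm n Y x.1 x.2) (phiM n M al be w.1 w.2).
    move=> x1 x2; rewrite (phiE _ _ w1 w2).
    apply: (lcMr brP); last by apply: (lcXr brP); apply: (lcY x (al.+1, 1%N)).
    by apply: (lcMr brP); [exact: lcY | apply: (lcXr brP); apply: (lcY x (1%N, be.+1))].
  rewrite (phiE _ _ v1 v2).
  apply: (lcMl brP); last by apply: (lcXl brP); apply: (lcr (al.+1, 1%N)).
  apply: (lcMl brP); last by apply: (lcXl brP); apply: (lcr (1%N, be.+1)).
  by have := lcr v v1 v2; case: (v).
(* By skew-symmetry this is the coefficient of [phi_q] against [phi_v]; the sign accounts for
   [d = -1]. *)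
exists (fun q v => - TW (vpos v) (vpos q)); split.
- by move=> v; apply: phi0; case: (vin v).
- move=> p q; apply: (lcC brP).
  by case: (vin p) => ? ?; case: (vin q) => ? ?; apply: lcTW.
- by move=> i p; rewrite /= /b_entry opprB.
move=> p v /=; have [v1 v2] := vin v; have [p1 p2] := vin (val p).
set P := vpos (val p) in p1 p2 *.
have mutP : mutable al be P by exact: (valP p).
rewrite mulN1r.
have -> : \sum_(q : 'I_n * 'I_n) (b_entry n al be P (vpos q))%:~R * - TW (vpos v) (vpos q)
   = - twist n al be (fun a b => arrow_sum n al be P (twist n al be (W (a, b))))
         (vpos v).1 (vpos v).2.
  rewrite /arrow_sum -sum_twist -sumrN.
  by apply: eq_bigr => q _; rewrite mulrN.
congr (- _); rewrite twistE !(arrow_sum_omega hal hbe albe n3 bd) //=.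
have -> : (1 + al == n + be.+1)%N = false by lia.
have -> : (be.+1 + be == n + 1)%N = (be.*2 == n) by lia.
have -> : (al.+1 + al == n + 1)%N = (al.*2 == n) by lia.
have -> : (1 + be == n + al.+1)%N = false by lia.
have -> : ((vpos v).1, (vpos v).2) = vpos v by case: (vpos v).
have -> : (vpos v == P) = (val p == v).
  rewrite /P eq_sym /vpos xpair_eqE !eqSS.
  by case: (v) => x y; case: (val p) => z t; rewrite xpair_eqE /=.
rewrite !(eq_sym _ P).
have := central_exclusive hal hbe albe n3; set e1 := (be.*2 == n)%:R; set e2 := _%:R => e12.
set T : rat := (((vpos v).1 + al)%N == (n + (vpos v).2)%N)%:R.
set Q : rat := (((vpos v).2 + be)%N == (n + (vpos v).1)%N)%:R.
(* The outer twist adds the value at [p] times the exponents of [v], which cancels the corrections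
   up to a multiple of [e2 * e1]. *)
transitivity ((val p == v)%:R - e2 * e1 *
   ((P == (1%N, be.+1))%:R * T + (P == (al.+1, 1%N))%:R * Q)).
  by rewrite /=; ring.
by rewrite e12 mul0r subr0.
Qed.

End InitialSeedCompatible.

Section Restriction.

Variables (F : fieldType) (charF : [pchar F] =i pred0).
Variables (br : F -> F -> F) (brP : biderivation br).
Variables (V : finType) (mut Q : pred V).

Definition restricted_vertex (p : {v : {v : V | Q v} | mut (val v)}) :
  {v : V | mut v} := exist _ (val (val p)) (valP p).

Definition restricted_seed (s : seed F mut) :
    @seed F {v : V | Q v} (fun v => mut (val v)) :=
  Seed (fun v => cluster s (val v))
       (fun p q => exmx s (restricted_vertex p) (val q)).

Lemma compatible_restricted_seed d (s : seed F mut) :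
  (forall v, ~~ Q v -> cluster s v = 1) ->
  compatible_seed charF br d s -> compatible_seed charF br d (restricted_seed s).
Proof.
move=> s1 [Om [x0 xlc skew sumE]].
exists (fun p q => Om (val p) (val q)); split=> /=.
- by move=> v; exact: x0.
- by move=> p q; exact: xlc.
- by move=> i p; exact: (skew (restricted_vertex i) (restricted_vertex p)).
move=> p v; have := sumE (restricted_vertex p) (val v).
rewrite (bigID Q) /= [X in _ + X]big1 ?addr0 => [|q Qq]; last first.
  suff -> : Om q (val v) = 0 by rewrite mulr0.
  apply: (lc_inj (x0 q) (x0 (val v)) (xlc q (val v))).
  by rewrite s1 //; exact: (lc1l charF brP).
by rewrite (val_eqE (val p) v) => <-; rewrite [RHS]big_sub.
Qed.

End Restriction.

(** * The Cartan part of the r-matrix *)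

Section CartanPart.

Variables (L : fieldType) (n : nat).

Definition hcoef (i j : nat) : L := (if (j <= i)%N then (n - i)%:R else - i%:R) / n%:R.

(** The coefficient of [e_jj] tensor [e_ll] in [r_0]. The field is a parameter because the log
    canonical coefficients need the rational value, while the bracket contains its image in [K]. *)
Definition rho_coef (al be j l : nat) : L :=
  \sum_(1 <= i < n) hcoef i j * hcoef i l
  - \sum_(1 <= i < n.-1) hcoef i.+1 j * hcoef i l
  + (if be == al.+1 then 0 else 1) *
    ((hcoef al j * hcoef be l - hcoef be j * hcoef al l)
     + (hcoef be.-1 j * hcoef al l - hcoef al j * hcoef be.-1 l)
     + (hcoef be j * hcoef al.+1 l - hcoef al.+1 j * hcoef be l)).

End CartanPart.

Lemma rho_coef_morph (L L' : fieldType) (f : {rmorphism L -> L'}) n al be j l :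
  f (rho_coef L n al be j l) = rho_coef L' n al be j l.
Proof.
have fh i x : f (hcoef L n i x) = hcoef L' n i x.
  by rewrite /hcoef fmorph_div rmorph_nat; case: ifP => _; rewrite ?rmorphN rmorph_nat.
rewrite /rho_coef !(fh, rmorphD, rmorphN, rmorphM) /= !rmorph_sum /=.
congr (_ - _ + _ * _); last by case: ifP; rewrite ?rmorph0 ?rmorph1.
  by apply: eq_bigr => i _; rewrite rmorphM !fh.
by apply: eq_bigr => i _; rewrite rmorphM !fh.
Qed.

Section BelavinDrinfeld.

Variables (n al be : nat).
Hypotheses (n3 : (2 < n)%N) (al0 : (0 < al)%N) (albe : (al < be)%N) (ben : (be < n)%N).
Local Notation h := (hcoef rat n).
Local Notation rho := (rho_coef rat n al be).
Local Notation inr := (fun i : nat => 0 < i <= n)%N.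

Let nz : n%:R != 0 :> rat. Proof. by rewrite pnatr_eq0; lia. Qed.

Lemma hcoefE i j : (i <= n)%N -> h i j = (j <= i)%N%:R - i%:R / n%:R.
Proof.
move=> hi; rewrite /hcoef; case: ifP => _; last by rewrite sub0r mulNr.
by rewrite natrB // mulrBl mulfV.
Qed.

Lemma hcoef0 j : inr j -> h 0 j = 0.
Proof. by move=> hj; rewrite hcoefE // mul0r subr0 (_ : (j <= 0)%N = false) //; lia. Qed.

Lemma hcoefn j : inr j -> h n j = 0.
Proof. by move=> /andP[_ jn]; rewrite hcoefE // mulfV // jn subrr. Qed.

(** The [h_i] are the fundamental coweights, dual to the simple roots. *)
Lemma hcoef_root i j : (i <= n)%N -> h i j - h i j.+1 = (i == j)%:R.
Proof.
move=> hi; rewrite !hcoefE // opprB addrA subrK.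
by case: (ltngtP i j) => _; rewrite /= ?subrr ?subr0.
Qed.

Lemma hcoef_step i j : (i < n)%N -> h i.+1 j - h i j = (j == i.+1)%:R - n%:R^-1.
Proof.
move=> hi; rewrite !hcoefE //; last exact: ltnW.
rewrite -natr1 mulrDl mul1r [(j <= i.+1)%N]leq_eqVlt ltnS.
have [->|_] := eqVneq j i.+1; last by rewrite /=; ring.
by rewrite ltnn /=; ring.
Qed.

Let sum_pick (f : nat -> rat) a b c : (a <= c < b)%N ->
  \sum_(a <= i < b) (i == c)%:R * f i = f c.
Proof.
move=> hc; rewrite (big_cat_nat (n := c)) /=; [|lia|lia].
rewrite (big_cat_nat (n := c.+1) (p := b)) /=; [|lia|lia].
rewrite big_nat1 eqxx mul1r !big_nat !big1 ?addr0 ?add0r // => i hi;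
  by rewrite (_ : (i == c) = false) ?mul0r //; lia.
Qed.

(** With [h_0 = h_n = 0], the symmetrization of [r_0] is the sum of the tensor squares of
    [h_{i+1} - h_i = e_{i+1,i+1} - 1/n]; the wedge terms are skew. *)
Lemma rho_coef_sym_rat c d : inr c -> inr d ->
  rho c d + rho d c = (c == d)%:R - n%:R^-1.
Proof.
  move=> hc hd.
  have E : \sum_(0 <= i < n) (h i.+1 c - h i c) * (h i.+1 d - h i d)
    = (c == d)%:R - n%:R^-1.
    transitivity (\sum_(0 <= i < n)
       ((i == c.-1)%:R * ((d == i.+1)%:R - n%:R^-1) - n%:R^-1 * ((i == d.-1)%:R * 1)
        + n%:R^-1 * n%:R^-1 : rat)).
      rewrite !big_nat; apply: eq_bigr => i hi; rewrite !hcoef_step; try by lia.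
      have -> : (i == c.-1) = (c == i.+1) by lia.
      have -> : (i == d.-1) = (d == i.+1) by lia.
      by ring.
    rewrite big_split sumrB /= -mulr_sumr !sum_pick; try by lia.
    rewrite sumr_const_nat subn0 -[_ / _ *+ n]mulr_natr mulfVK //.
    have -> : (d == c.-1.+1) = (c == d) by lia.
    by ring.
  rewrite -E.
  have expand : \sum_(0 <= i < n) (h i.+1 c - h i c) * (h i.+1 d - h i d)
    = \sum_(0 <= i < n) h i.+1 c * h i.+1 d + \sum_(0 <= i < n) h i c * h i d
      - \sum_(0 <= i < n) h i.+1 c * h i d - \sum_(0 <= i < n) h i.+1 d * h i c.
    rewrite -big_split -!sumrB /=; apply: eq_bigr => i _; ring.
  have S1 : \sum_(0 <= i < n) h i c * h i d = \sum_(1 <= i < n) h i c * h i d.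
    by rewrite big_ltn ?hcoef0 ?mul0r ?add0r //; lia.
  have S2 : \sum_(0 <= i < n) h i.+1 c * h i.+1 d = \sum_(1 <= i < n) h i c * h i d.
    rewrite [RHS]big_add1; have {1}-> : n = n.-1.+1 by lia.
    rewrite big_nat_recr //=; have -> : n.-1.+1 = n by lia.
    by rewrite hcoefn // mul0r addr0.
  have S3 x y : inr x -> inr y -> \sum_(0 <= i < n) h i.+1 x * h i y
    = \sum_(1 <= i < n.-1) h i.+1 x * h i y.
    move=> hx hy; rewrite big_ltn ?hcoef0 ?mulr0 ?add0r //; last by lia.
    have {1}-> : n = n.-1.+1 by lia.
    rewrite big_nat_recr /=; last by lia.
    have -> : n.-1.+1 = n by lia.
    by rewrite hcoefn // mul0r addr0.
  rewrite expand S1 S2 !S3 // /rho_coef.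
  have -> : \sum_(1 <= i < n) h i d * h i c = \sum_(1 <= i < n) h i c * h i d.
    by apply: eq_bigr => i _; rewrite mulrC.
  by ring.
Qed.

(** Pairing with a simple root picks out single coweights. The two sums of [r_0] contribute
    [h_be - h_{be-1} + h_al - h_{al+1}], which is 0 if [be = al+1]; otherwise the wedge terms
    contribute its opposite. *)
Lemma rho_coef_bd : bd_cartan n rho al be.
Proof.
split; first by exists (- n%:R^-1); exact: rho_coef_sym_rat.
move=> l hl; rewrite /rho_coef.
have B1 : \sum_(1 <= i < n) h i be * h i l - \sum_(1 <= i < n) h i be.+1 * h i l = h be l.
  rewrite -sumrB -(sum_pick (fun i => h i l) (a := 1) (b := n) (c := be)); last by lia.
  by rewrite !big_nat; apply: eq_bigr => i hi; rewrite -mulrBl hcoef_root //; lia.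
have B2 : \sum_(1 <= i < n.-1) h i.+1 be * h i l
          - \sum_(1 <= i < n.-1) h i.+1 be.+1 * h i l = h be.-1 l.
  rewrite -sumrB -(sum_pick (fun i => h i l) (a := 1) (b := n.-1) (c := be.-1)); last by lia.
  rewrite !big_nat; apply: eq_bigr => i hi; rewrite -mulrBl hcoef_root; last by lia.
  by congr (_%:R * _); lia.
have B3 : \sum_(1 <= i < n) h i l * h i al - \sum_(1 <= i < n) h i l * h i al.+1 = h al l.
  rewrite -sumrB -(sum_pick (fun i => h i l) (a := 1) (b := n) (c := al)); last by lia.
  rewrite !big_nat; apply: eq_bigr => i hi; rewrite -mulrBr hcoef_root ; last by lia.
  by rewrite mulrC.
have B4 : \sum_(1 <= i < n.-1) h i.+1 l * h i al
          - \sum_(1 <= i < n.-1) h i.+1 l * h i al.+1 = h al.+1 l.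
  rewrite -sumrB -(sum_pick (fun i => h i.+1 l) (a := 1) (b := n.-1) (c := al)); last by lia.
  rewrite !big_nat; apply: eq_bigr => i hi; rewrite -mulrBr hcoef_root ; last by lia.
  by rewrite mulrC.
have R i j : (i <= n)%N -> h i j = h i j.+1 + (i == j)%:R.
  by move=> hi; rewrite -hcoef_root // addrC subrK.
have [e|ne] := eqVneq be al.+1.
  rewrite !mul0r !addr0; move: B1 B2 B3 B4; rewrite e /=; lra.
rewrite !mul1r !(R _ be) ?(R _ al); try by lia.
rewrite !eqxx.
have -> : (al == be) = false by lia.
have -> : (be.-1 == be) = false by lia.
have -> : (al.+1 == be) = false by lia.
have -> : (be == al) = false by lia.
have -> : (be.-1 == al) = false by lia.
have -> : (al.+1 == al) = false by lia.
rewrite /= !addr0.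
move: B1 B2 B3 B4; lra.
Qed.

End BelavinDrinfeld.

(** * The bracket on the polynomial ring *)

Lemma mulrB_distr (T : comPzRingType) (f g a b c d : T) :
  f * a + g * b - (f * c + g * d) = f * (a - c) + g * (b - d).
Proof. by ring. Qed.

Lemma addrB3 (T : comPzRingType) (a b c a' b' c' : T) :
  a + b + c - (a' + b' + c') = a - a' + b - b' + c - c'.
Proof. by ring. Qed.

(** Up to a constant the symmetric part of the r-matrix is the Casimir tensor, whose contributions
    from the left and the right translations coincide and cancel. *)
Lemma sklyanin_skew (T : comNzRingType) (M r : nat -> nat -> T) (c : T)
    (al be i j k l : nat) :
  r j l + r l j = (j == l)%:R + c -> r i k + r k i = (i == k)%:R + c ->
  let s i j k l := r j l * (M i j * M k l) - r i k * (M i j * M k l)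
    + (j < l)%N%:R * (M i l * M k j) - (k < i)%N%:R * (M k j * M i l)
    + (((j == al) && (l == be.+1))%:R * (M i al.+1 * M k be)
       - ((j == be.+1) && (l == al))%:R * (M i be * M k al.+1))
    - (((i == al.+1) && (k == be))%:R * (M al j * M be.+1 l)
       - ((i == be) && (k == al.+1))%:R * (M be.+1 j * M al l)) in
  s i j k l + s k l i j = 0.
Proof.
move=> /eqP; rewrite eq_sym -subr_eq => /eqP e1 /eqP; rewrite eq_sym -subr_eq => /eqP e2 s.
rewrite /s -e1 -e2.
rewrite (andbC (l == al)) (andbC (l == be.+1)) (andbC (k == al.+1)) (andbC (k == be)).
case: (ltngtP i k) => [ik|ik|->]; case: (ltngtP j l) => [jl|jl|->]; rewrite /=; ring.
Qed.

Lemma symmetrized_add (T : comPzRingType) (B : T -> T -> T) :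
  (forall f g z, B (f + g) z = B f z + B g z) ->
  (forall f g z, B z (f + g) = B z f + B z g) ->
  forall z f g, B (f + g) z + B z (f + g) = B f z + B z f + (B g z + B z g).
Proof. by move=> Dl Dr z f g; rewrite Dl Dr; ring. Qed.

Lemma symmetrized_mul (T : comPzRingType) (B : T -> T -> T) :
  (forall f g z, B (f * g) z = f * B g z + g * B f z) ->
  (forall f g z, B z (f * g) = f * B z g + g * B z f) ->
  forall z f g, B (f * g) z + B z (f * g) = f * (B g z + B z g) + g * (B f z + B z f).
Proof. by move=> Ml Mr z f g; rewrite Ml Mr; ring. Qed.

Lemma sum_delta2 (T : pzRingType) m (c : 'I_m -> 'I_m -> T) i j :
  \sum_a \sum_b c a b * ((b == i) && (a == j))%:R = c j i.
Proof.
rewrite (bigD1 j) //= (bigD1 i) //= !eqxx mulr1.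
rewrite !big1 ?addr0 // => [a aj|b bi].
  by rewrite big1 // => b _; rewrite (negPf aj) andbF mulr0.
by rewrite (negPf bi) mulr0.
Qed.

Section PolyBracket.

Variables (K : fieldType) (charK : [pchar K] =i pred0) (n al be : nat).
Local Notation R := {mpoly K[n * n]}.
Local Notation X := (genX K n).
Local Notation x := (x_ K n).
Local Notation inr := (fun i : nat => 0 < i <= n)%N.
Local Notation C := (@mpolyC (n * n) K).
Local Notation br := (@poly_bracket K n al be).
Implicit Types (A B : 'M[K]_n) (eta zeta : 'M[R]_n).

Lemma mxtrace_tens (T : comPzRingType) p q (A : 'M[T]_p) (B : 'M[T]_q) :
  \tr (A *t B) = \tr A * \tr B.
Proof. by rewrite /mxtrace mulr_sum; apply: eq_bigr => k _; rewrite mxE. Qed.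

Definition trC A eta : R := \tr (map_mx C A *m eta).

Lemma trC_tens A B eta zeta :
  \tr (map_mx C (A *t B) *m (eta *t zeta)) = trC A eta * trC B zeta.
Proof. by rewrite map_mxT tensmx_mul mxtrace_tens. Qed.

(** The value of [u] tensor [v] on [r_mx] for linear forms [u] and [v]; it serves the left and the
    right translations alike. *)
Definition tensor_sum (u v : 'M[K]_n -> R) : R :=
  \sum_(1 <= i < n) u (hhat K n i) * v (hhat K n i)
  - \sum_(1 <= i < n.-1) u (hhat K n i.+1) * v (hhat K n i)
  + C (if be == al.+1 then 0 else 1) *
    ((u (hhat K n al) * v (hhat K n be) - u (hhat K n be) * v (hhat K n al))
     + (u (hhat K n be.-1) * v (hhat K n al) - u (hhat K n al) * v (hhat K n be.-1))
     + (u (hhat K n be) * v (hhat K n al.+1) - u (hhat K n al.+1) * v (hhat K n be)))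
  + \sum_(1 <= i < n.+1) \sum_(i.+1 <= j < n.+1)
      u (eunit K n j i) * v (eunit K n i j)
  + (u (eunit K n al.+1 al) * v (eunit K n be be.+1)
     - u (eunit K n be be.+1) * v (eunit K n al.+1 al)).

Lemma r_pairingE eta zeta :
  r_pairing al be eta zeta = tensor_sum (trC^~ eta) (trC^~ zeta).
Proof.
pose f (r : 'M[K]_(n * n)) : R := \tr (map_mx C r *m (eta *t zeta)).
have fD r s : f (r + s) = f r + f s by rewrite /f map_mxD mulmxDl mxtraceD.
have fN r : f (- r) = - f r by rewrite /f map_mxN mulNmx raddfN.
have fZ c r : f (c *: r) = C c * f r by rewrite /f map_mxZ -scalemxAl mxtraceZ.
have f0 : f 0 = 0 by rewrite /f map_mx0 mul0mx mxtrace0.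
have fS (I : Type) (s : seq I) (g : I -> 'M_(n * n)) :
    f (\sum_(i <- s) g i) = \sum_(i <- s) f (g i) by exact: (big_morph f fD f0).
have fT A B : f (A *t B) = trC A eta * trC B zeta by exact: trC_tens.
rewrite /r_pairing -/(f _) /r_mx /r_zero /wedge !(fD, fN, fZ, fT) !fS.
rewrite /tensor_sum; congr (_ - _ + _ + _ + _);
  try by [apply: eq_bigr => i _; rewrite fT | rewrite fZ !(fD, fN, fT)].
by apply: eq_bigr => i _; rewrite fS; apply: eq_bigr => j _; rewrite fT.
Qed.

Lemma r_pairing_linl c eta eta' zeta :
  r_pairing al be (c *: eta + eta') zeta
  = c * r_pairing al be eta zeta + r_pairing al be eta' zeta.
Proof.
rewrite /r_pairing -mxtraceZ -mxtraceD scalemxAr -mulmxDr; congr (\tr (_ *m _)).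
by apply/matrixP => i j; rewrite !mxE mulrDl mulrA.
Qed.

Lemma r_pairing_linr c eta zeta zeta' :
  r_pairing al be eta (c *: zeta + zeta')
  = c * r_pairing al be eta zeta + r_pairing al be eta zeta'.
Proof.
rewrite /r_pairing -mxtraceZ -mxtraceD scalemxAr -mulmxDr; congr (\tr (_ *m _)).
by apply/matrixP => i j; rewrite !mxE mulrDr mulrCA.
Qed.

Lemma gradD (f g : R) : grad (f + g) = 1 *: grad f + grad g.
Proof. by apply/matrixP => i j; rewrite !mxE mderivD mul1r. Qed.

Lemma gradM (f g : R) : grad (f * g) = f *: grad g + g *: grad f.
Proof. by apply/matrixP => i j; rewrite !mxE mderivM addrC [_ * g]mulrC. Qed.

Lemma gradC c : grad (c%:MP : R) = 0.
Proof. by apply/matrixP => i j; rewrite !mxE mderivC. Qed.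

Lemma poly_bracketE f g : br f g =
  r_pairing al be (grad f *m X) (grad g *m X)
  - r_pairing al be (X *m grad f) (X *m grad g).
Proof. by rewrite /poly_bracket; congr (_ - _); exact: R_plusP. Qed.

Let r0l zeta : r_pairing al be 0 zeta = 0.
Proof.
have := r_pairing_linl 1 0 0 zeta; rewrite scale1r addr0 mul1r => /eqP.
by rewrite -subr_eq0 opprD addrA subrr sub0r oppr_eq0 => /eqP.
Qed.

Let r0r zeta : r_pairing al be zeta 0 = 0.
Proof.
have := r_pairing_linr 1 zeta 0 0; rewrite scale1r addr0 mul1r => /eqP.
by rewrite -subr_eq0 opprD addrA subrr sub0r oppr_eq0 => /eqP.
Qed.

Lemma poly_bracketDl f g z : br (f + g) z = br f z + br g z.
Proof.
rewrite !poly_bracketE gradD mulmxDl mulmxDr -scalemxAl -scalemxAr.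
move: (grad f *m X) (grad g *m X) (grad z *m X) (X *m grad f) (X *m grad g)
  (X *m grad z) => a b c a' b' c'.
by rewrite !r_pairing_linl !mul1r opprD addrACA.
Qed.

Lemma poly_bracketDr f g z : br z (f + g) = br z f + br z g.
Proof.
rewrite !poly_bracketE gradD mulmxDl mulmxDr -scalemxAl -scalemxAr.
move: (grad f *m X) (grad g *m X) (grad z *m X) (X *m grad f) (X *m grad g)
  (X *m grad z) => a b c a' b' c'.
by rewrite !r_pairing_linr !mul1r opprD addrACA.
Qed.

Lemma poly_bracketMl f g z : br (f * g) z = f * br g z + g * br f z.
Proof.
rewrite !poly_bracketE gradM mulmxDl mulmxDr -!scalemxAl -!scalemxAr.
move: (grad f *m X) (grad g *m X) (grad z *m X) (X *m grad f) (X *m grad g)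
  (X *m grad z) => a b c a' b' c'.
rewrite !r_pairing_linl.
have E d eta zeta : r_pairing al be (d *: eta) zeta = d * r_pairing al be eta zeta.
  by rewrite -[d *: eta]addr0 r_pairing_linl r0l addr0.
by rewrite !E mulrB_distr.
Qed.

Lemma poly_bracketMr f g z : br z (f * g) = f * br z g + g * br z f.
Proof.
rewrite !poly_bracketE gradM mulmxDl mulmxDr -!scalemxAl -!scalemxAr.
move: (grad f *m X) (grad g *m X) (grad z *m X) (X *m grad f) (X *m grad g)
  (X *m grad z) => a b c a' b' c'.
rewrite !r_pairing_linr.
have E d eta zeta : r_pairing al be eta (d *: zeta) = d * r_pairing al be eta zeta.
  by rewrite -[d *: zeta]addr0 r_pairing_linr r0r addr0.
by rewrite !E mulrB_distr.
Qed.

Lemma poly_bracketC0l c z : br c%:MP z = 0.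
Proof. by rewrite poly_bracketE gradC mul0mx mulmx0 !r0l subrr. Qed.

Lemma poly_bracketC0r c z : br z c%:MP = 0.
Proof. by rewrite poly_bracketE gradC mul0mx mulmx0 !r0r subrr. Qed.

Lemma derivation_eq0 (D : R -> R) :
  (forall f g, D (f + g) = D f + D g) ->
  (forall f g, D (f * g) = f * D g + g * D f) ->
  (forall c, D c%:MP = 0) -> (forall i j, D (X i j) = 0) -> forall f, D f = 0.
Proof.
move=> DD DM DC DX; elim/mpolyind => [|c m p _ _ IH].
  by rewrite -mpolyC0 DC.
rewrite DD IH addr0 -mul_mpolyC DM DC mulr0 addr0 mpolyXE_id.
rewrite (_ : D _ = 0) ?mulr0 //; elim/big_ind: _ => [|f g f0 g0|k _].
- by rewrite -mpolyC1 DC.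
- by rewrite DM f0 g0 !mulr0 addr0.
have Dk : D 'X_k = 0.
  by case/mxvec_indexP: k => i j; have := DX i j; rewrite mxE.
elim: (m k) => [|e IHe]; first by rewrite expr0 -mpolyC1 DC.
by rewrite exprS DM IHe Dk !mulr0 addr0.
Qed.

Lemma x_ord (a b : 'I_n) : x a.+1 b.+1 = X a b.
Proof. by rewrite /x_ /= !valK. Qed.

Lemma grad_genX a b : grad (X a b) = delta_mx b a.
Proof.
apply/matrixP => i j; rewrite !mxE mderivX mnmE eq_sym.
have -> : (mxvec_index j i == mxvec_index a b) = (i == b) && (j == a).
  apply/eqP/andP => [E|[/eqP-> /eqP->] //].
  (* Injectivity of [mxvec_index]: the matrix of index pairs is read at both positions. *)
  have := congr1 (fun k => mxvec (\matrix_(s, t) (s, t)) 0 k) E.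
  by rewrite !mxvecE !mxE => -[-> ->].
case: eqP => [->|_]; case: eqP => [->|_] /=; rewrite ?scale0r // scale1r.
by rewrite -mpolyX0; congr 'X_[_]; apply/mnmP => t; rewrite !mnmE subnn.
Qed.

Lemma mxtrace_delta_mul (T : pzRingType) (a b : 'I_n) (B : 'M[T]_n) :
  \tr (delta_mx b a *m B) = B a b.
Proof.
rewrite /mxtrace (bigD1 b) //= big1 => [|i ib]; last first.
  by rewrite mxE big1 // => j _; rewrite mxE (negPf ib) mul0r.
rewrite addr0 mxE (bigD1 a) //= big1 => [|j ja]; last first.
  by rewrite mxE (negPf ja) andbF mul0r.
by rewrite mxE !eqxx mul1r addr0.
Qed.

Lemma trC_right A a b : trC A (grad (X a b) *m X) = (X *m map_mx C A) a b.
Proof.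
by rewrite /trC grad_genX mulmxA mxtrace_mulC mulmxA mxtrace_mulC mxtrace_delta_mul.
Qed.

Lemma trC_left A a b : trC A (X *m grad (X a b)) = (map_mx C A *m X) a b.
Proof. by rewrite /trC grad_genX mulmxA mxtrace_mulC mxtrace_delta_mul. Qed.

Lemma hhatE i (a b : 'I_n) : hhat K n i a b = hcoef K n i a.+1 *+ (a == b).
Proof. by rewrite /hhat !mxE. Qed.

Lemma mulmx_hhat i a b :
  (X *m map_mx C (hhat K n i)) a b = C (hcoef K n i b.+1) * X a b.
Proof.
rewrite mxE (bigD1 b) //= big1 => [|k kb].
  by rewrite addr0 [map_mx _ _ _ _]mxE hhatE eqxx mulr1n mulrC.
by rewrite [map_mx _ _ _ _]mxE hhatE (negPf kb) mulr0n mpolyC0 mulr0.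
Qed.

Lemma hhat_mulmx i a b :
  (map_mx C (hhat K n i) *m X) a b = C (hcoef K n i a.+1) * X a b.
Proof.
rewrite mxE (bigD1 a) //= big1 => [|k ka].
  by rewrite addr0 [map_mx _ _ _ _]mxE hhatE eqxx mulr1n.
rewrite [map_mx _ _ _ _]mxE hhatE eq_sym (negPf ka).
by rewrite mulr0n mpolyC0 mul0r.
Qed.

Lemma mulmx_eunit p q a b : inr p ->
  (X *m map_mx C (eunit K n p q)) a b = (b.+1 == q)%:R * x a.+1 p.
Proof.
move=> hp; have pP : (p.-1 < n)%N by lia.
have pE : p = (Ordinal pP).+1 by rewrite /=; lia.
rewrite {2}pE x_ord mxE (bigD1 (Ordinal pP)) //= big1 => [|k kp].
  rewrite addr0 [map_mx _ _ _ _]mxE [eunit _ _ _ _ _ _]mxE /= -pE eqxx /=.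
  by rewrite rmorph_nat mulrC.
rewrite [map_mx _ _ _ _]mxE [eunit _ _ _ _ _ _]mxE.
rewrite (_ : (k.+1 == p) = false) ?mpolyC0 ?mulr0 //.
by move: kp; rewrite -val_eqE /=; lia.
Qed.

Lemma eunit_mulmx p q a b : inr q ->
  (map_mx C (eunit K n p q) *m X) a b = (a.+1 == p)%:R * x q b.+1.
Proof.
move=> hp; have qP : (q.-1 < n)%N by lia.
have qE : q = (Ordinal qP).+1 by rewrite /=; lia.
rewrite {2}qE x_ord mxE (bigD1 (Ordinal qP)) //= big1 => [|k kp].
  rewrite addr0 [map_mx _ _ _ _]mxE [eunit _ _ _ _ _ _]mxE /= -qE eqxx andbT.
  by rewrite rmorph_nat.
rewrite [map_mx _ _ _ _]mxE [eunit _ _ _ _ _ _]mxE.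
rewrite (_ : (k.+1 == q) = false) ?andbF ?mpolyC0 ?mul0r //.
by move: kp; rewrite -val_eqE /=; lia.
Qed.

Lemma rho_coef_tensor (T : comNzRingType) (f : {rmorphism K -> T}) (a b : T) j l :
  \sum_(1 <= i < n) (f (hcoef K n i j) * a) * (f (hcoef K n i l) * b)
  - \sum_(1 <= i < n.-1) (f (hcoef K n i.+1 j) * a) * (f (hcoef K n i l) * b)
  + f (if be == al.+1 then 0 else 1) *
    ((f (hcoef K n al j) * a * (f (hcoef K n be l) * b)
      - f (hcoef K n be j) * a * (f (hcoef K n al l) * b))
     + (f (hcoef K n be.-1 j) * a * (f (hcoef K n al l) * b)
        - f (hcoef K n al j) * a * (f (hcoef K n be.-1 l) * b))
     + (f (hcoef K n be j) * a * (f (hcoef K n al.+1 l) * b)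
        - f (hcoef K n al.+1 j) * a * (f (hcoef K n be l) * b)))
  = f (rho_coef K n al be j l) * (a * b).
Proof.
have E p q u : \sum_(p <= i < q) (f (hcoef K n (i + u) j) * a) * (f (hcoef K n i l) * b)
   = f (\sum_(p <= i < q) hcoef K n (i + u) j * hcoef K n i l) * (a * b).
  rewrite rmorph_sum mulr_suml; apply: eq_bigr => i _.
  by rewrite rmorphM /=; ring.
have E0 := E 1%N n 0%N; have E1 := E 1%N n.-1 1%N.
under eq_bigr do rewrite -[X in hcoef K n X j]addn0.
rewrite E0; under [X in _ - X]eq_bigr do rewrite -[X in hcoef K n X j]addn1.
rewrite E1 /rho_coef.
have -> : \sum_(1 <= i < n) hcoef K n (i + 0) j * hcoef K n i l
   = \sum_(1 <= i < n) hcoef K n i j * hcoef K n i l.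
  by apply: eq_bigr => i _; rewrite addn0.
have -> : \sum_(1 <= i < n.-1) hcoef K n (i + 1) j * hcoef K n i l
   = \sum_(1 <= i < n.-1) hcoef K n i.+1 j * hcoef K n i l.
  by apply: eq_bigr => i _; rewrite addn1.
move: (\sum_(_ <= _ < _) _) (\sum_(_ <= _ < _) _) => s1 s2.
move: (hcoef K n) => h; move: (if _ then _ else _) => e.
by rewrite !(rmorphD, rmorphN, rmorphM) /=; ring.
Qed.

Lemma sum_root_pair (T : pzRingType) (f : nat -> nat -> T) b d : inr b -> inr d ->
  \sum_(1 <= i < n.+1) \sum_(i.+1 <= j < n.+1) ((b == i) && (d == j))%:R * f i j
  = (b < d)%N%:R * f b d.
Proof.
move=> hb hd.
rewrite (big_cat_nat (n := b)) /=; [|lia|lia].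
rewrite (big_cat_nat (n := b.+1) (p := n.+1)) /=; [|lia|lia].
rewrite big_nat1 big_nat big1 ?add0r => [|i hi]; last first.
  by rewrite big1 // => j _; rewrite (_ : (b == i) = false) ?mul0r //; lia.
rewrite [X in _ + X]big_nat [X in _ + X]big1 ?addr0 => [|i hi]; last first.
  by rewrite big1 // => j _; rewrite (_ : (b == i) = false) ?mul0r //; lia.
rewrite eqxx /=; case: ltnP => h; last first.
  rewrite mul0r big_nat big1 // => j hj.
  by rewrite (_ : (d == j) = false) ?mul0r //; lia.
rewrite (big_cat_nat (n := d)) /=; [|lia|lia].
rewrite (big_cat_nat (n := d.+1) (p := n.+1)) /=; [|lia|lia].
rewrite big_nat1 eqxx !big_nat !big1 ?add0r ?addr0 // => j hj;
  by rewrite (_ : (d == j) = false) ?mul0r //; lia.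
Qed.

Hypotheses (hal : (0 < al < n)%N) (hbe : (0 < be < n)%N).
Local Notation rho := (rho_coef K n al be).

Let ial : inr al. Proof. by lia. Qed.
Let ial1 : inr al.+1. Proof. by lia. Qed.
Let ibe : inr be. Proof. by lia. Qed.
Let ibe1 : inr be.+1. Proof. by lia. Qed.

Section TensorSum.

Variables (u v : 'M[K]_n -> R) (f g : nat -> R) (j l : nat).
Hypotheses (hj : inr j) (hl : inr l).
Hypothesis uh : forall p, u (hhat K n p) = C (hcoef K n p j) * f j.
Hypothesis vh : forall p, v (hhat K n p) = C (hcoef K n p l) * g l.

Lemma tensor_sum_right :
  (forall p q, inr p -> u (eunit K n p q) = (j == q)%:R * f p) ->
  (forall p q, inr p -> v (eunit K n p q) = (l == q)%:R * g p) ->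
  tensor_sum u v = C (rho j l) * (f j * g l) + (j < l)%N%:R * (f l * g j)
     + (((j == al) && (l == be.+1))%:R * (f al.+1 * g be)
       - ((j == be.+1) && (l == al))%:R * (f be * g al.+1)).
Proof.
move=> ue ve; rewrite -(rho_coef_tensor C) -(sum_root_pair (fun s t => f t * g s)) //.
rewrite /tensor_sum !uh !vh !ue // !ve //; congr (_ - _ + _ + _ + (_ - _)).
- by apply: eq_bigr => p _; rewrite uh vh.
- by apply: eq_bigr => p _; rewrite uh vh.
- rewrite !big_nat; apply: eq_bigr => p hp; rewrite !big_nat.
  apply: eq_bigr => q hq; rewrite ue ?ve; try by lia.
  by rewrite -mulnb natrM mulrACA.
- by rewrite -mulnb natrM mulrACA.
by rewrite -mulnb natrM mulrACA.
Qed.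

Lemma tensor_sum_left :
  (forall p q, inr q -> u (eunit K n p q) = (j == p)%:R * f q) ->
  (forall p q, inr q -> v (eunit K n p q) = (l == p)%:R * g q) ->
  tensor_sum u v = C (rho j l) * (f j * g l) + (l < j)%N%:R * (f l * g j)
     + (((j == al.+1) && (l == be))%:R * (f al * g be.+1)
       - ((j == be) && (l == al.+1))%:R * (f be.+1 * g al)).
Proof.
move=> ue ve; rewrite -(rho_coef_tensor C) -(sum_root_pair (fun s t => f s * g t)) //.
rewrite /tensor_sum !uh !vh !ue // !ve //; congr (_ - _ + _ + _ + (_ - _)).
- by apply: eq_bigr => p _; rewrite uh vh.
- by apply: eq_bigr => p _; rewrite uh vh.
- rewrite !big_nat; apply: eq_bigr => p hp; rewrite !big_nat.
  apply: eq_bigr => q hq; rewrite ue ?ve; try by lia.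
  by rewrite andbC -mulnb natrM mulrACA.
- by rewrite -mulnb natrM mulrACA.
by rewrite -mulnb natrM mulrACA.
Qed.

End TensorSum.

Lemma poly_bracket_entries i j k l : inr i -> inr j -> inr k -> inr l ->
  br (x i j) (x k l) =
    C (rho j l) * (x i j * x k l) - C (rho i k) * (x i j * x k l)
    + (j < l)%N%:R * (x i l * x k j) - (k < i)%N%:R * (x k j * x i l)
    + (((j == al) && (l == be.+1))%:R * (x i al.+1 * x k be)
       - ((j == be.+1) && (l == al))%:R * (x i be * x k al.+1))
    - (((i == al.+1) && (k == be))%:R * (x al j * x be.+1 l)
       - ((i == be) && (k == al.+1))%:R * (x be.+1 j * x al l)).
Proof.
have ordE p : inr p -> exists a : 'I_n, p = a.+1.
  move=> hp; have pP : (p.-1 < n)%N by lia.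
  by exists (Ordinal pP) => /=; lia.
move=> hi hj hk hl.
case: (ordE _ hi) => a aE; case: (ordE _ hj) => b bE.
case: (ordE _ hk) => c cE; case: (ordE _ hl) => d dE.
have uR A : trC A (grad (x i j) *m X) = (X *m map_mx C A) a b.
  by rewrite aE bE x_ord trC_right.
have vR A : trC A (grad (x k l) *m X) = (X *m map_mx C A) c d.
  by rewrite cE dE x_ord trC_right.
have uL A : trC A (X *m grad (x i j)) = (map_mx C A *m X) a b.
  by rewrite aE bE x_ord trC_left.
have vL A : trC A (X *m grad (x k l)) = (map_mx C A *m X) c d.
  by rewrite cE dE x_ord trC_left.
have hR p : ((X *m map_mx C (hhat K n p)) a b = C (hcoef K n p j) * x i j)
          * ((X *m map_mx C (hhat K n p)) c d = C (hcoef K n p l) * x k l).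
  by rewrite aE bE cE dE !x_ord !mulmx_hhat.
have hL p : ((map_mx C (hhat K n p) *m X) a b = C (hcoef K n p i) * x i j)
          * ((map_mx C (hhat K n p) *m X) c d = C (hcoef K n p k) * x k l).
  by rewrite aE bE cE dE !x_ord !hhat_mulmx.
have eR p q : inr p -> ((X *m map_mx C (eunit K n p q)) a b = (j == q)%:R * x i p)
          * ((X *m map_mx C (eunit K n p q)) c d = (l == q)%:R * x k p).
  by move=> hp; rewrite aE bE cE dE !mulmx_eunit.
have eL p q : inr q -> ((map_mx C (eunit K n p q) *m X) a b = (i == p)%:R * x q j)
          * ((map_mx C (eunit K n p q) *m X) c d = (k == p)%:R * x q l).
  by move=> hp; rewrite aE bE cE dE !eunit_mulmx.
have tR := tensor_sum_right (u := trC^~ (grad (x i j) *m X))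
  (v := trC^~ (grad (x k l) *m X)) (f := x i) (g := x k) hj hl
  (fun p => etrans (uR _) (hR p).1) (fun p => etrans (vR _) (hR p).2)
  (fun p q hp => etrans (uR _) (eR p q hp).1) (fun p q hp => etrans (vR _) (eR p q hp).2).
have tL := tensor_sum_left (u := trC^~ (X *m grad (x i j)))
  (v := trC^~ (X *m grad (x k l))) (f := x^~ j) (g := x^~ l) hi hk
  (fun p => etrans (uL _) (hL p).1) (fun p => etrans (vL _) (hL p).2)
  (fun p q hq => etrans (uL _) (eL p q hq).1) (fun p q hq => etrans (vL _) (eL p q hq).2).
have e1 := etrans (r_pairingE _ _) tR; have e2 := etrans (r_pairingE _ _) tL.
by rewrite poly_bracketE e1 e2; exact: addrB3.
Qed.

Hypotheses (n3 : (2 < n)%N) (albe : (al < be)%N).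

Lemma rho_coef_sym j l : inr j -> inr l -> rho j l + rho l j = (j == l)%:R - n%:R^-1.
Proof.
move=> hj hl; rewrite -!(rho_coef_morph (ratF charK)).
have al0 : (0 < al)%N by lia.
have ben : (be < n)%N by lia.
have -> : (j == l)%:R - n%:R^-1 = ratF charK ((j == l)%:R - n%:R^-1).
  by rewrite rmorphB fmorphV !rmorph_nat.
by rewrite -rmorphD; congr (ratF charK _); exact: rho_coef_sym_rat.
Qed.

(** The symmetrized bracket is a derivation in each argument and kills constants, so it suffices to
    test it on the matrix entries. *)
Lemma poly_bracket_skew f g : br f g = - br g f.
Proof.
have symD := symmetrized_add poly_bracketDl poly_bracketDr.
have symM := symmetrized_mul poly_bracketMl poly_bracketMr.
have symC c h : br c%:MP h + br h c%:MP = 0.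
  by rewrite poly_bracketC0l poly_bracketC0r addr0.
have symC' c h : br h c%:MP + br c%:MP h = 0 by rewrite addrC symC.
apply/eqP; rewrite -addr_eq0; apply/eqP; move: f.
apply: derivation_eq0 => [u v|u v|c|i j]; [exact: symD | exact: symM | exact: symC |].
rewrite addrC; move: g.
apply: derivation_eq0 => [u v|u v|c|k l]; [exact: symD | exact: symM | exact: symC |].
rewrite -!x_ord !poly_bracket_entries //; try by rewrite /= ltn_ord.
have sym (a b : 'I_n) :
    C (rho a.+1 b.+1) + C (rho b.+1 a.+1) = (a.+1 == b.+1)%:R + C (- n%:R^-1).
  by rewrite -mpolyCD rho_coef_sym ?mpolyCD ?rmorph_nat //= ltn_ord.
exact: (@sklyanin_skew R x (fun s t => C (rho s t)) _ al be k.+1 l.+1 i.+1 j.+1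
  (sym l j) (sym k i)).
Qed.

Lemma poly_bracket_biderivation : biderivation br.
Proof.
split; [exact: poly_bracketDl | | exact: poly_bracket_skew].
exact: poly_bracketMl.
Qed.

Lemma grad_det : grad (detX K n) = \adj X.
Proof.
apply/matrixP => i j; rewrite mxE /detX [RHS]mxE.
rewrite (derivation_det (D := mderiv (mxvec_index j i))); first last.
- by move=> f g; rewrite mderivM addrC [_ * g]mulrC.
- by move=> f g; rewrite mderivD.
have D a b : (X a b)^`M(mxvec_index j i) = ((b == i) && (a == j))%:R.
  have := congr1 (fun A : 'M[R]_n => A i j) (grad_genX a b).
  by rewrite !mxE eq_sym [j == a]eq_sym.
transitivity (\sum_a \sum_b cofactor X a b * ((b == i) && (a == j))%:R).
  by apply: eq_bigr => a _; apply: eq_bigr => b _; congr (_ * _); exact: D.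
exact: sum_delta2.
Qed.

Lemma trC_scalar A (d : R) : \tr A = 0 -> trC A d%:M = 0.
Proof.
move=> A0; rewrite /trC mul_mx_scalar mxtraceZ.
have -> : \tr (map_mx C A) = C (\tr A).
  by rewrite /mxtrace rmorph_sum; apply: eq_bigr => i _; rewrite mxE.
by rewrite A0 mpolyC0 mulr0.
Qed.

Lemma hhat_trace i : (i <= n)%N -> \tr (hhat K n i) = 0.
Proof.
move=> hi; rewrite /mxtrace.
have -> : \sum_a hhat K n i a a
   = \sum_(a < n) ((a < i)%N%:R * n%:R - i%:R) / n%:R :> K.
  apply: eq_bigr => a _; rewrite hhatE eqxx mulr1n /hcoef; congr (_ / _).
  by case: (a < i)%N; rewrite ?mul1r ?mul0r ?sub0r // natrB.
rewrite -mulr_suml sumrB -mulr_suml -natr_sum.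
have -> : (\sum_(a < n) (a < i) = i)%N by apply: etrans (sum_ltn n i 0) _; lia.
by rewrite sumr_const card_ord -[i%:R *+ n]mulr_natr subrr mul0r.
Qed.

Lemma eunit_trace p q : p != q -> \tr (eunit K n p q) = 0.
Proof.
move=> pq; rewrite /mxtrace big1 // => i _; rewrite mxE.
by case: eqP => // ->; rewrite (negPf pq).
Qed.

(** The gradient of [det X] is the adjugate, so both translated gradients are scalar matrices; every
    first factor in [r_mx] has trace 0. *)
Lemma poly_bracket_det g : br (detX K n) g = 0.
Proof.
have T0 v : tensor_sum (trC^~ (detX K n)%:M) v = 0.
  have h0 i : (i <= n)%N -> trC (hhat K n i) (detX K n)%:M = 0.
    by move=> hi; apply/trC_scalar/hhat_trace.
  have e0 p q : p != q -> trC (eunit K n p q) (detX K n)%:M = 0.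
    by move=> pq; apply/trC_scalar/eunit_trace.
  rewrite /tensor_sum !h0 ?e0; try by lia.
  rewrite !mul0r !subr0 !addr0 !mulr0 addr0 !big_nat.
  rewrite big1 => [|i hi]; last by rewrite h0 ?mul0r //; lia.
  rewrite big1 => [|i hi]; last by rewrite h0 ?mul0r //; lia.
  rewrite big1 ?subr0 ?addr0 // => i hi.
  by rewrite big_nat big1 // => j hj; rewrite e0 ?mul0r //; lia.
have P0 zeta : r_pairing al be (detX K n)%:M zeta = 0 by apply: etrans (r_pairingE _ _) (T0 _).
by rewrite poly_bracketE grad_det mul_mx_adj mul_adj_mx (P0 (grad g *m X)) P0 subr0.
Qed.

End PolyBracket.

(** * Evaluation of the initial cluster at a matrix *)

Section EvaluationOfCluster.

Variables (K F : fieldType) (n : nat) (f : {rmorphism {mpoly K[n * n]} -> F}).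
Local Notation inr := (fun i : nat => 0 < i <= n)%N.
Local Notation fsz := (fsize n).
Let M i j : F := f (x_ K n i j).

Let minorE (rs cs : seq nat) m (r c : 'I_m -> nat) : size rs = m ->
  (forall t : 'I_m, nth 0%N rs t = r t) -> (forall t : 'I_m, nth 0%N cs t = c t) ->
  f (minor K n rs cs) = mnr M r c.
Proof.
move=> sm; subst m => hr hc; rewrite /minor -det_map_mx; congr (\det _).
by apply/matrixP => a b; rewrite !mxE hr hc.
Qed.

Let nth_from j m (t : 'I_m) : nth 0%N (irange j (j + m).-1) t = from j t.
Proof. by case: t => t tm /=; rewrite /irange nth_iota /from //=; lia. Qed.

Let nth_lastup j m (t : 'I_m) : (0 < j)%N ->
  nth 0%N (rcons (irange j (j + m).-2) (j + m)) t = lastup j t.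
Proof.
case: t => t tm j0 /=; rewrite nth_rcons size_iota /lastup /=.
case: ltnP => h.
  by rewrite /irange nth_iota // (_ : (t.+1 == m) = false) //; lia.
have -> : (t.+1 == m) by lia.
by rewrite (_ : (t == _)) //; lia.
Qed.

Let nth_firstdn j m (t : 'I_m) :
  nth 0%N (j.-1 :: irange j.+1 (j + m).-1) t = firstdn j t.
Proof.
case: t => -[|t] tm //=; rewrite /firstdn /= /irange nth_iota; lia.
Qed.

Let size_from j m : (0 < j)%N -> size (irange j (j + m).-1) = m.
Proof. by rewrite size_iota; lia. Qed.

Let size_lastup j m : (0 < j)%N -> (0 < m)%N ->
  size (rcons (irange j (j + m).-2) (j + m)) = m.
Proof. by rewrite size_rcons size_iota; lia. Qed.

Let size_firstdn j m : (0 < j)%N -> (0 < m)%N ->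
  size (j.-1 :: irange j.+1 (j + m).-1) = m.
Proof. by rewrite /= size_iota; lia. Qed.

Let lastrowE i j : inr i -> inr j -> lastrow n i j = (i + fsz i j).-1.
Proof. by rewrite /lastrow /fsize => hi hj; case: leqP; lia. Qed.

Let lastcolE i j : inr i -> inr j -> lastcol n i j = (j + fsz i j).-1.
Proof. by rewrite /lastcol /fsize => hi hj; case: leqP; lia. Qed.

Let sz_gt0 i j : inr i -> inr j -> (0 < fsz i j)%N.
Proof. by rewrite /fsize; lia. Qed.

Let succ_last i j : inr i -> inr j ->
  ((j + fsz i j).-1.+1 = j + fsz i j)%N.
Proof. by move=> hi hj; have := sz_gt0 hi hj; lia. Qed.

Let succ_last' i j : inr i -> inr j ->
  ((i + fsz i j).-1.+1 = i + fsz i j)%N.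
Proof. by move=> hi hj; have := sz_gt0 hi hj; lia. Qed.

Lemma eval_f i j : inr i -> inr j -> f (f_ K n i j) = fm n M i j.
Proof.
move=> hi hj; rewrite /f_ lastrowE // lastcolE //.
by apply: minorE => //; apply: size_from; case/andP: hi.
Qed.

Lemma eval_f_right i j : inr i -> inr j -> f (f_right K n i j) = fmR n M i j.
Proof.
move=> hi hj; rewrite /f_right lastrowE // lastcolE // succ_last //.
apply: minorE => [|//|t]; first by apply: size_from; case/andP: hi.
by apply: nth_lastup; case/andP: hj.
Qed.

Lemma eval_f_left i j : inr i -> inr j -> f (f_left K n i j) = fmL n M i j.
Proof.
move=> hi hj; rewrite /f_left lastrowE // lastcolE //.
by apply: minorE => //; apply: size_from; case/andP: hi.
Qed.

Lemma eval_f_down i j : inr i -> inr j -> f (f_down K n i j) = fmD n M i j.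
Proof.
move=> hi hj; rewrite /f_down lastrowE // lastcolE // succ_last' //.
apply: minorE => [|t|//]; last by apply: nth_lastup; case/andP: hi.
by apply: size_lastup; rewrite ?sz_gt0 //; case/andP: hi.
Qed.

Lemma eval_f_up i j : inr i -> inr j -> f (f_up K n i j) = fmU n M i j.
Proof.
move=> hi hj; rewrite /f_up lastrowE // lastcolE //.
by apply: minorE => //; apply: size_firstdn; rewrite ?sz_gt0 //; case/andP: hi.
Qed.

Variables (al be : nat).
Hypotheses (hal : (0 < al < n)%N) (hbe : (0 < be < n)%N).

Let i1 : inr 1%N. Proof. by lia. Qed.
Let ia : inr al.+1. Proof. by lia. Qed.
Let ib : inr be.+1. Proof. by lia. Qed.

Lemma eval_psi1_star : be.*2 = n -> f (psi1_star K n al be) = psi1_starM n M al be.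
Proof.
move=> hn; rewrite /psi1_star rmorphB !rmorphM /= eval_f // eval_f_up //.
have sE : fsz 1 be.+1 = be by rewrite /fsize; lia.
have e1 : irange 1 be = irange 1 (1 + fsz 1 be.+1).-1 by rewrite sE.
have e2 : be :: irange be.+2 n = be.+1.-1 :: irange be.+2 (be.+1 + fsz 1 be.+1).-1.
  by rewrite sE; congr (_ :: irange _ _); lia.
have e3 : rcons (irange 1 be.-1) be.+1
    = rcons (irange 1 (1 + fsz 1 be.+1).-2) (1 + fsz 1 be.+1) by rewrite sE.
rewrite /psi1_starM; congr (_ * _ - _ * _).
  by rewrite e1 e2; apply: minorE => //; apply: size_from.
rewrite e3 e2; apply: minorE => [|t|//]; last exact: nth_lastup.
by apply: size_lastup => //; rewrite sE; lia.
Qed.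

Lemma eval_theta1_star : al.*2 = n -> f (theta1_star K n al be) = theta1_starM n M al be.
Proof.
move=> hn; rewrite /theta1_star rmorphB !rmorphM /= eval_f // eval_f_left //.
have sE : fsz al.+1 1 = al by rewrite /fsize; lia.
have e1 : irange 1 al = irange 1 (1 + fsz al.+1 1).-1 by rewrite sE.
have e2 : al :: irange al.+2 n = al.+1.-1 :: irange al.+2 (al.+1 + fsz al.+1 1).-1.
  by rewrite sE; congr (_ :: irange _ _); lia.
have e3 : rcons (irange 1 al.-1) al.+1
    = rcons (irange 1 (1 + fsz al.+1 1).-2) (1 + fsz al.+1 1) by rewrite sE.
have sz : size (al.+1.-1 :: irange al.+2 (al.+1 + fsz al.+1 1).-1) = fsz al.+1 1.
  by apply: size_firstdn => //; rewrite sE; lia.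
rewrite /theta1_starM; congr (_ * _ - _ * _).
  by rewrite e1 e2; apply: minorE.
by rewrite e3 e2; apply: minorE => // t; exact: nth_lastup.
Qed.

Lemma eval_phi i j : inr i -> inr j ->
  f (phi_ K n al be (i, j)) = phiM n M al be i j.
Proof.
move=> hi hj; rewrite /phi_ /phiM.
have theta_genE k : inr k -> (k <= al)%N ->
    f (theta_gen K n al be k) = theta_genM n M al be k.
  move=> hk ka; have hk' : inr (n + k - al)%N by lia.
  by rewrite /theta_gen rmorphB !rmorphM /= !eval_f // eval_f_right // eval_f_left.
have psi_genE k : inr k -> (k <= be)%N ->
    f (psi_gen K n al be k) = psi_genM n M al be k.
  move=> hk ka; have hk' : inr (n + k - be)%N by lia.
  by rewrite /psi_gen rmorphB !rmorphM /= !eval_f // eval_f_down // eval_f_up.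
have -> : (1 <= j <= al)%N && (i == n + j - al)%N = (i + al == n + j)%N by lia.
case: eqP => hT.
  have ja : (j <= al)%N by lia.
  have hk' : inr (n + j - al)%N by lia.
  rewrite /theta_ /thetaM; case: eqP => hb; last exact: theta_genE.
  rewrite rmorphB !rmorphM /= eval_f // eval_f_right // eval_psi1_star //.
  by rewrite psi_genE //; lia.
have -> : (1 <= i <= be)%N && (j == n + i - be)%N = (j + be == n + i)%N by lia.
case: eqP => hP; last exact: eval_f.
have ib' : (i <= be)%N by lia.
have hk' : inr (n + i - be)%N by lia.
rewrite /psi_ /psiM; case: eqP => hb; last exact: psi_genE.
rewrite rmorphB !rmorphM /= eval_f // eval_f_down // eval_theta1_star //.
by rewrite theta_genE //; lia.
Qed.

End EvaluationOfCluster.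

(** * Nonvanishing *)

Section Extensionality.

Variables (F : fieldType) (n : nat).
Local Notation inr := (fun i : nat => 0 < i <= n)%N.
Local Notation fsz := (fsize n).
Variables (M M' : nat -> nat -> F) (MM' : forall i j, inr i -> inr j -> M i j = M' i j).

Let from_in i j (t : 'I_(fsz i j)) : inr i -> inr j -> inr (from i t) /\ inr (from j t).
Proof. by case: t => t; rewrite /fsize /from /=; lia. Qed.

Let lastup_in m i (t : 'I_m) : inr i -> (i + m <= n)%N -> inr (lastup i t).
Proof. by case: t => t; rewrite /lastup /=; case: ifP; lia. Qed.

Let firstdn_in i j (t : 'I_(fsz i j)) : (1 < i <= n)%N -> inr j -> inr (firstdn i t).
Proof. by case: t => t; rewrite /fsize /firstdn /=; case: ifP; lia. Qed.

Let firstdn_in' i j (t : 'I_(fsz i j)) : (1 < j <= n)%N -> inr i -> inr (firstdn j t).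
Proof. by case: t => t; rewrite /fsize /firstdn /=; case: ifP; lia. Qed.

Let ext_mnr m (r c : 'I_m -> nat) : (forall t, inr (r t)) -> (forall t, inr (c t)) ->
  mnr M r c = mnr M' r c.
Proof. by move=> hr hc; apply: eq_mnr => a b; apply: MM'. Qed.

Lemma eq_fm i j : inr i -> inr j -> fm n M i j = fm n M' i j.
Proof.
by move=> hi hj; apply: ext_mnr => t; have [] := from_in t hi hj.
Qed.

Lemma eq_fmR i j : inr i -> inr j -> (j + fsz i j <= n)%N -> fmR n M i j = fmR n M' i j.
Proof.
move=> hi hj h; apply: ext_mnr => t; last exact: lastup_in.
by have [] := from_in t hi hj.
Qed.

Lemma eq_fmL i j : inr i -> (1 < j <= n)%N -> fmL n M i j = fmL n M' i j.
Proof.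
move=> hi h; have hj : inr j by lia.
apply: ext_mnr => t; last exact: firstdn_in'.
by have [] := from_in t hi hj.
Qed.

Lemma eq_fmD i j : inr i -> inr j -> (i + fsz i j <= n)%N -> fmD n M i j = fmD n M' i j.
Proof.
move=> hi hj h; apply: ext_mnr => t; first exact: lastup_in.
by have [] := from_in t hi hj.
Qed.

Lemma eq_fmU i j : (1 < i <= n)%N -> inr j -> fmU n M i j = fmU n M' i j.
Proof.
move=> h hj; have hi : inr i by lia.
apply: ext_mnr => t; first exact: firstdn_in.
by have [] := from_in t hi hj.
Qed.

Lemma eq_fmLD i j : inr i -> (1 < j <= n)%N -> (i + fsz i j <= n)%N ->
  fmLD n M i j = fmLD n M' i j.
Proof.
by move=> hi h h'; apply: ext_mnr => t; [exact: lastup_in | exact: firstdn_in'].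
Qed.

Lemma eq_fmUR i j : (1 < i <= n)%N -> inr j -> (j + fsz i j <= n)%N ->
  fmUR n M i j = fmUR n M' i j.
Proof.
by move=> hi h h'; apply: ext_mnr => t; [exact: firstdn_in | exact: lastup_in].
Qed.

Lemma eq_phiM al be i j : (0 < al < n)%N -> (0 < be < n)%N -> inr i -> inr j ->
  phiM n M al be i j = phiM n M' al be i j.
Proof.
move=> hal hbe hi hj.
have i1 : inr 1%N by lia.
have ia : inr al.+1 by lia.
have ib : inr be.+1 by lia.
have ia' : (1 < al.+1 <= n)%N by lia.
have ib' : (1 < be.+1 <= n)%N by lia.
have theta_genE k : inr k -> (k <= al)%N -> theta_genM n M al be k = theta_genM n M' al be k.
  move=> hk ka; congr (_ * _ - _ * _).
  - by apply: eq_fm; lia.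
  - exact: eq_fm.
  - by apply: eq_fmR; rewrite /fsize; lia.
  - exact: eq_fmL.
have psi_genE k : inr k -> (k <= be)%N -> psi_genM n M al be k = psi_genM n M' al be k.
  move=> hk ka; congr (_ * _ - _ * _).
  - by apply: eq_fm; lia.
  - exact: eq_fm.
  - by apply: eq_fmD; rewrite /fsize; lia.
  - exact: eq_fmU.
rewrite /phiM; case: eqP => hT.
  have ja : (j <= al)%N by lia.
  rewrite /thetaM; case: eqP => hb; last exact: theta_genE.
  congr (_ * _ - _ * (_ * _ - _ * _)).
  - by apply: eq_fm; lia.
  - by apply: psi_genE; lia.
  - by apply: eq_fmR; rewrite /fsize; lia.
  - exact: eq_fmL.
  - exact: eq_fm.
  - by apply: eq_fmLD; rewrite /fsize; lia.
  - exact: eq_fmU.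
case: eqP => hP; last exact: eq_fm.
have ibe : (i <= be)%N by lia.
rewrite /psiM; case: eqP => hb; last exact: psi_genE.
congr (_ * _ - _ * (_ * _ - _ * _)).
- by apply: eq_fm; lia.
- by apply: theta_genE; lia.
- by apply: eq_fmD; rewrite /fsize; lia.
- exact: eq_fmU.
- exact: eq_fm.
- by apply: eq_fmUR; rewrite /fsize; lia.
- exact: eq_fmL.
Qed.

End Extensionality.

Section Evaluation.

Variables (K : fieldType) (n : nat).
Local Notation R := {mpoly K[n * n]}.
Local Notation inr := (fun i : nat => 0 < i <= n)%N.
Local Notation x := (x_ K n).

Lemma x_ordP i : inr i -> exists a : 'I_n, i = a.+1.
Proof.
move=> hi; have iP : (i.-1 < n)%N by lia.
by exists (Ordinal iP); rewrite /=; lia.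
Qed.

Definition evmx (F : fieldType) (h : {rmorphism K -> F}) (M : nat -> nat -> F)
    (p : R) : F :=
  mmap h (fun k => mxvec (\matrix_(a < n, b < n) M a.+1 b.+1) 0 k) p.

HB.instance Definition _ (F : fieldType) (h : {rmorphism K -> F}) M :=
  GRing.isZmodMorphism.Build R F (evmx h M) (rmorphB (mmap h _)).
HB.instance Definition _ (F : fieldType) (h : {rmorphism K -> F}) M :=
  GRing.isMonoidMorphism.Build R F (evmx h M)
    (conj (rmorph1 (mmap h _)) (rmorphM (mmap h _))).

Lemma evmx_x (F : fieldType) (h : {rmorphism K -> F}) M i j : inr i -> inr j ->
  evmx h M (x i j) = M i j.
Proof.
move=> /x_ordP[a ->] /x_ordP[b ->].
by rewrite x_ord /evmx mxE mmapX mmap1U mxvecE mxE.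
Qed.

Lemma fm11_det (F : fieldType) (f : {rmorphism R -> F}) :
  (0 < n)%N -> fm n (fun i j => f (x i j)) 1 1 = f (detX K n).
Proof.
move=> n0; rewrite /fm (_ : fsize n 1 1 = n); last by rewrite /fsize; lia.
rewrite /detX -det_map_mx; congr (\det _).
by apply/matrixP => a b; rewrite !mxE /from !add1n x_ord mxE.
Qed.

Lemma f_neq0 i j : inr i -> inr j -> f_ K n i j != 0.
Proof.
(* [D] has ones exactly on the diagonal through [(i, j)], so [f_ij] becomes the determinant of an
   identity matrix. *)
move=> hi hj; pose D k l : K := ((k + j)%N == (i + l)%N)%:R.
apply/eqP => /(congr1 (evmx idfun D)); rewrite rmorph0 eval_f // => /eqP.
rewrite (_ : fm n _ i j = 1) ?oner_eq0 //.
rewrite (eq_fm (M' := D)) //; last by move=> k l hk hl; exact: evmx_x.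
rewrite /fm /mnr (_ : minor_mx _ _ _ = 1%:M) ?det1 //.
apply/matrixP => a b; rewrite !mxE /D /from; congr (_%:R).
by rewrite -addnA eqn_add2l addnC eqn_add2l.
Qed.

Lemma mnr_scale_rows (F : fieldType) (d : nat -> F) (M : nat -> nat -> F) m
    (r c : 'I_m -> nat) :
  mnr (fun i j => d i * M i j) r c = (\prod_a d (r a)) * mnr M r c.
Proof.
have -> : \prod_a d (r a) = \det (diag_mx (\row_a d (r a))).
  by rewrite det_diag; apply: eq_bigr => a _; rewrite mxE.
rewrite /mnr -det_mulmx; congr (\det _).
by apply/matrixP => a b; rewrite mul_diag_mx !mxE.
Qed.

Local Notation Fr := {fraction R}.
Local Notation "p %:F" := (tofrac p).

Let KF : {rmorphism K -> Fr} := (@tofrac R \o @mpolyC (n * n) K)%FUN.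

(* A point of SL_n over the field of rational functions at which no f_ij
   vanishes. *)
Let pt i j : Fr := (if i == 1%N then (detX K n)%:F^-1 else 1) * (x i j)%:F.

Let pt_f i j : inr i -> inr j -> fm n pt i j != 0.
Proof.
move=> hi hj; rewrite /fm mnr_scale_rows mulf_neq0 //.
  apply/prodf_neq0 => a _; case: ifP => _; rewrite ?oner_eq0 //.
  by rewrite invr_eq0 tofrac_eq0 genX_det_neq0.
rewrite -/(fm n (fun i j => (x i j)%:F) i j) -(eval_f (@tofrac R)) //.
by rewrite tofrac_eq0 f_neq0.
Qed.

Let pt_det : (0 < n)%N -> fm n pt 1 1 = 1.
Proof.
move=> n0; rewrite /fm mnr_scale_rows -/(fm n (fun i j => (x i j)%:F) 1 1).
rewrite (fm11_det (@tofrac R)) //.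
have m0 : (0 < fsize n 1 1)%N by rewrite /fsize; lia.
rewrite (bigD1 (Ordinal m0)) //= big1 => [|a a0].
  by rewrite mulr1 /from /= mulVf // tofrac_eq0 genX_det_neq0.
by rewrite /from ifF //; move: a0; rewrite -val_eqE /=; lia.
Qed.

(** Evaluation at a point of determinant 1 factors through [K[SL_n]], so this point shows
    nonvanishing on both groups. *)
Lemma cluster_point al be : (0 < al < n)%N -> (0 < be < n)%N -> al != be ->
  exists f : {rmorphism R -> Fr}, f (detX K n) = 1 /\
    forall i j, inr i -> inr j -> f (phi_ K n al be (i, j)) != 0.
Proof.
move=> hal hbe ab; have n0 : (0 < n)%N by lia.
have [M [M1 Mphi]] := phiM_neq0_exists hal hbe ab pt_f.
have evM i j : inr i -> inr j -> evmx KF M (x i j) = M i j by exact: evmx_x.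
exists (evmx KF M); split.
  rewrite -fm11_det // (eq_fm evM) ?M1 ?pt_det //; lia.
by move=> i j hi hj; rewrite eval_phi // (eq_phiM evM) // Mphi.
Qed.

End Evaluation.

(** * Compatibility of the initial seeds *)

Section Specialization.

Variables (K : fieldType) (charK : [pchar K] =i pred0) (n al be : nat).
Local Notation R := {mpoly K[n * n]}.
Local Notation inr := (fun i : nat => 0 < i <= n)%N.
Local Notation x := (x_ K n).
Local Notation pbr := (@poly_bracket K n al be).
Local Notation "p %:F" := (tofrac p).

Hypotheses (n3 : (2 < n)%N) (hal : (0 < al < n)%N) (hbe : (0 < be < n)%N).
Hypothesis albe : (al < be)%N.

Variables (A : idomainType) (g : {rmorphism R -> A}) (br : A -> A -> A).
Hypothesis (brP : biderivation br) (brg : forall p q, br (g p) (g q) = g (pbr p q)).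
Hypothesis g_phi : forall i j, inr i -> inr j -> g (phi_ K n al be (i, j)) != 0.

Let gF : {rmorphism R -> {fraction A}} := (@tofrac A \o g)%FUN.
Let cF : {rmorphism K -> {fraction A}} := (gF \o @mpolyC (n * n) K)%FUN.

Lemma pchar_specialization : [pchar {fraction A}] =i pred0.
Proof. by move=> p; rewrite (fmorph_pchar cF) charK. Qed.

Let charF := pchar_specialization.

(** One statement for both groups: [g] is the identity for GL_n and the residue map for SL_n. *)
Definition specialized_seed : seed {fraction A} (GL_mutable (n := n) al be) :=
  Seed (fun v => (g (phi_ K n al be (vpos v)))%:F)
       (fun p q => b_entry n al be (vpos (val p)) (vpos q)).

Lemma sklyanin_specialization :
  sklyanin charF (frac_bracket br) n (rho_coef rat n al be) al be true true
    (fun i j => gF (x i j)).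
Proof.
have gC j l : gF (rho_coef K n al be j l)%:MP = ratF charF (rho_coef rat n al be j l).
  by rewrite (rho_coef_morph (ratF charF)) -(rho_coef_morph cF).
move=> i j k l hi hj hk hl; rewrite -!gC !mul1r.
rewrite [LHS]frac_bracket_tofrac // brg -[LHS]/(gF _) poly_bracket_entries //.
by rewrite !(rmorphB, rmorphD, rmorphM, rmorph_nat).
Qed.

Lemma specialized_seed_compatible :
  compatible_seed charF (frac_bracket br) (-1) specialized_seed.
Proof.
have ab : al != be by rewrite neq_ltn albe.
have phiE i j : inr i -> inr j ->
    (g (phi_ K n al be (i, j)))%:F = phiM n (fun i j => gF (x i j)) al be i j.
  by move=> hi hj; rewrite -(eval_phi gF).
have vin (i : 'I_n) : inr i.+1 by have := ltn_ord i; lia.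
have -> : specialized_seed =
    Seed (fun v => phiM n (fun i j => gF (x i j)) al be (vpos v).1 (vpos v).2)
         (fun p q => b_entry n al be (vpos (val p)) (vpos q)).
  by congr Seed; apply/funext => v; rewrite /= -phiE.
apply: initial_seed_compatible => //.
- exact: frac_bracket_biderivation.
- by case/andP: hal hbe => ? ? /andP[? ?]; apply: rho_coef_bd.
- exact: sklyanin_specialization.
by move=> i j hi hj; rewrite -phiE // tofrac_eq0 g_phi.
Qed.

End Specialization.

Section GLSL.

Variables (K : fieldType) (charK : [pchar K] =i pred0) (n al be : nat).
Local Notation R := {mpoly K[n * n]}.
Local Notation inr := (fun i : nat => 0 < i <= n)%N.
Local Notation pbr := (@poly_bracket K n al be).
Local Notation res := (@SL_res K n).
Local Notation det := (detX K n).

Fact SL_res_zmod : zmod_morphism res.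
Proof. exact: (@pi_is_zmod_morphism _ _ _ {ideal_quot @SL_ideal K n}). Qed.

Fact SL_res_monoid : monoid_morphism res.
Proof. exact: (@pi_is_monoid_morphism _ _ _ {ideal_quot @SL_ideal K n}). Qed.

HB.instance Definition _ := GRing.isZmodMorphism.Build R (SL_ring K n) res SL_res_zmod.
HB.instance Definition _ := GRing.isMonoidMorphism.Build R (SL_ring K n) res SL_res_monoid.

Lemma SL_resP p q : reflect (exists s, p = q + s * (det - 1)) (res p == res q).
Proof.
have -> : (res p == res q) = (p - q \in @SL_ideal K n).
  by rewrite Quotient.idealrBE; apply/eqP/eqP.
apply: (iffP (SL_idealP _)) => [[s Es]|[s ->]]; exists s; last by rewrite addrC addKr.
by rewrite -Es addrC subrK.
Qed.

Lemma SL_res_onto (a : SL_ring K n) : exists p, a = res p.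
Proof. by exists (repr a); rewrite /SL_res reprK. Qed.

Hypotheses (n3 : (2 < n)%N) (hal : (0 < al < n)%N) (hbe : (0 < be < n)%N).
Hypothesis albe : (al < be)%N.

Let pbrP : biderivation pbr := poly_bracket_biderivation charK hal hbe n3 albe.

Lemma SL_ring_bracketE p q :
  SL_ring_bracket al be (res p) (res q) = res (pbr p q).
Proof.
have res1 : res (det - 1) = 0.
  rewrite -(rmorph0 res); apply/eqP/SL_resP; exists 1; by rewrite add0r mul1r.
(* Changing a representative by a multiple of [det X - 1] changes the bracket by such a multiple;
   skew-symmetry carries this to the second argument. *)
have Casimir s u t : res (pbr (u + s * (det - 1)) t) = res (pbr u t).
  have [D M S] := pbrP; rewrite D M.
  have -> : pbr (det - 1) t = 0.
    by rewrite brDl // brNl // poly_bracket_det // br1l // subr0.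
  by rewrite mulr0 add0r rmorphD rmorphM /= res1 mul0r addr0.
have lift u : exists s, repr (res u) = u + s * (det - 1).
  by apply/SL_resP; rewrite /SL_res reprK.
rewrite /SL_ring_bracket; have [s ->] := lift p; have [t ->] := lift q.
apply: etrans (Casimir s p _) _.
have [_ _ S] := pbrP.
apply: etrans (congr1 res (S p _)) _; rewrite rmorphN.
apply: etrans (congr1 -%R (Casimir t q p)) _; rewrite -rmorphN.
by apply: (congr1 res); apply/esym/S.
Qed.

Lemma SL_ring_bracket_biderivation : biderivation (@SL_ring_bracket K n al be).
Proof.
have [D M S] := pbrP; split.
- move=> a b c; have [p ->] := SL_res_onto a; have [q ->] := SL_res_onto b.
  have [r ->] := SL_res_onto c; rewrite -rmorphD !SL_ring_bracketE -rmorphD.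
  by apply: (congr1 res); exact: D.
- move=> a b c; have [p ->] := SL_res_onto a; have [q ->] := SL_res_onto b.
  have [r ->] := SL_res_onto c; rewrite -rmorphM !SL_ring_bracketE -!rmorphM -rmorphD.
  by apply: (congr1 res); exact: M.
move=> a b; have [p ->] := SL_res_onto a; have [q ->] := SL_res_onto b.
by rewrite !SL_ring_bracketE -rmorphN; apply: (congr1 res); exact: S.
Qed.

Let alNbe : al != be. Proof. by rewrite neq_ltn albe. Qed.

Lemma phi_neq0 i j : inr i -> inr j -> phi_ K n al be (i, j) != 0.
Proof.
move=> hi hj; have [f [_ fphi]] := cluster_point K hal hbe alNbe.
by apply: contraNneq (fphi _ _ hi hj) => ->; rewrite rmorph0.
Qed.

Lemma SL_res_phi_neq0 i j : inr i -> inr j -> res (phi_ K n al be (i, j)) != 0.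
Proof.
move=> hi hj; have [f [f1 fphi]] := cluster_point K hal hbe alNbe.
apply: contraNneq (fphi _ _ hi hj); rewrite -(rmorph0 res) => /eqP/SL_resP[s ->].
by rewrite add0r rmorphM rmorphB f1 rmorph1 subrr mulr0.
Qed.

Lemma SL_res_phi11 : res (phi_ K n al be (1, 1)%N) = 1.
Proof.
apply/eqP; rewrite -tofrac_eq -/((@tofrac _ \o res)%FUN _).
rewrite (eval_phi (@tofrac _ \o res)%FUN) //; try lia.
rewrite /phiM !ifF; try lia.
rewrite (fm11_det (@tofrac _ \o res)%FUN) /=; last by lia.
rewrite tofrac_eq -(rmorph1 res); apply/SL_resP; exists 1.
by rewrite mul1r addrC subrK.
Qed.

Lemma GL_compatible :
  compatible (@GL_bracket K n al be) (GL_seed K n al be).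
Proof.
have brP : biderivation (@GL_bracket K n al be) by exact: frac_bracket_biderivation.
have := @specialized_seed_compatible K charK n al be n3 hal hbe albe R idfun
  pbr pbrP (fun p q => erefl) phi_neq0.
by apply: compatible_seed_compatible.
Qed.

(** The seed with all vertices is compatible over [K[SL_n]]; its variable at [(1, 1)] is the residue
    1 of [det X], and removing that vertex gives [SL_seed]. *)
Lemma SL_compatible :
  compatible (@SL_bracket K n al be) (SL_seed K n al be).
Proof.
have brP : biderivation (@SL_bracket K n al be).
  exact: frac_bracket_biderivation SL_ring_bracket_biderivation.
have full := @specialized_seed_compatible K charK n al be n3 hal hbe albe _ res
  _ SL_ring_bracket_biderivation SL_ring_bracketE SL_res_phi_neq0.
have v11 v : ~~ (vpos v != (1, 1)%N) ->
    cluster (specialized_seed al be res) v = 1.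
  rewrite negbK -[cluster _ _]/(tofrac (res (phi_ K n al be (vpos v)))) => /eqP->.
  by rewrite SL_res_phi11 rmorph1.
have := compatible_restricted_seed brP v11 full.
by apply: compatible_seed_compatible.
Qed.

End GLSL.

Local Close Scope quotient_scope.
Local Close Scope ring_scope.

Theorem theorem4p2 (K : fieldType) (charK : ([pchar K] =i pred0)%R)
    (n alpha beta : nat) (hn : 3 <= n)
    (halpha : 1 <= alpha) (hab : alpha < beta) (hbeta : beta <= n.-1) :
  compatible (@GL_bracket K n alpha beta) (GL_seed K n alpha beta) /\
  compatible (@SL_bracket K n alpha beta) (SL_seed K n alpha beta).
Proof.
have hal : 0 < alpha < n by lia.
have hbe : 0 < beta < n by lia.
by split; [exact: GL_compatible | exact: SL_compatible].
Qed.
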